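(* Let $(X_n)_{n\le0}$ be a $d$-dimensional monotonic Markov process and $\mathcal{F}$ the filtration it generates. The following are equivalent: (a) $\mathcal{F}$ is Kolmogorovian; (b) for every $n\le0$, $\mathcal{L}(X_n\mid\mathcal{F}_{-\infty})=\mathcal{L}(X_n)$ almost surely; (c) $\mathcal{F}$ is standard.
   Context: $d\ge1$ is an integer or $d=\infty$; $X_n$ takes values in $\mathbb{R}^d$ and $A_n$ is the support of its law. Filtrations are indexed by $n\le0$, $\mathcal F_n=\sigma(X_m;m\le n)$, $\mathcal F_{-\infty}=\bigcap_n\mathcal F_n$; Kolmogorovian means $\mathcal F_{-\infty}$ is trivial. $\mathcal{F}$ is immersed in $\mathcal{G}$ if $\mathcal{F}_n\subset\mathcal{G}_n$ and $\mathcal{F}_{n+1}$ is conditionally independent of $\mathcal{G}_n$ given $\mathcal{F}_n$ for each $n<0$; product type means generated by independent random variables; standard means a filtration generated by a copy (same law) of $(X_n)$ is immersed in a filtration of product type. The $\mathbb{R}^d$-valued Markov process is monotonic if for each $n<0$ and all $x,x'\in A_n$ there is a coupling $(Y,Y')$ of $\mathcal{L}(X_{n+1}\mid X_n=x)$ and $\mathcal{L}(X_{n+1}\mid X_n=x')$, with law depending measurably on $(x,x')$, such that for each coordinate $k$: $x(k)\le x'(k)\Rightarrow Y(k)\le Y'(k)$ a.s., and $x(k)\ge x'(k)\Rightarrow Y(k)\ge Y'(k)$ a.s. *)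

(* Defs.v *)
From HB Require Import structures.
From mathcomp Require Import all_boot all_order all_algebra.
From mathcomp Require Import all_classical all_reals all_analysis.
Unset Printing Implicit Defensive.
Import Order.TTheory GRing.Theory Num.Theory.
Import numFieldNormedType.Exports.
Local Open Scope classical_set_scope.
Local Open Scope ring_scope.

(* Dimension: [Some d] stands for the integer d (>= 1), [None] for d = oo. *)
Definition coord (D : option nat) : Type :=
  match D with Some d => 'I_d | None => nat end.

Definition vec (R : realType) (D : option nat) : Type := coord D -> R.
HB.instance Definition _ R D := gen_eqMixin (vec R D).
HB.instance Definition _ R D := gen_choiceMixin (vec R D).
HB.instance Definition _ (R : realType) D := isPointed.Build (vec R D) (fun _ => 0).

Definition cyl_sys (R : realType) (D : option nat) : set (set (vec R D)) :=
  [set A | exists (k : coord D) (B : set R), measurable B /\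
             A = [set x | B (x k)]].

Notation state R D := (g_sigma_algebraType (cyl_sys R D)).

Definition gen_filt {d} {T : measurableType d} {Vd : int -> measure_display}
  (V : forall m, measurableType (Vd m)) (xi : forall m, T -> V m) (n : int)
  : set (set T) :=
  <<s \bigcup_(m in [set m : int | m <= n]) preimage_set_system setT (xi m) measurable >>.

Definition tail_sig {T : Type} (F : int -> set (set T)) : set (set T) :=
  [set A | forall n : int, n <= 0 -> F n A].

Definition sig_of {d dv} {T : measurableType d} {V : measurableType dv}
  (X : T -> V) : set (set T) := preimage_set_system setT X measurable.

Definition cond_prob_version {d} {T : measurableType d} {R : realType}
  (P : probability T R) (C : set (set T)) (A : set T) (Y : T -> R) : Prop :=
  (forall B : set R, measurable B -> C (Y @^-1` B)) /\
  P.-integrable setT (EFin \o Y) /\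
  (forall B, C B -> (\int[P]_(x in B) (Y x)%:E = P (A `&` B))%E).

Definition cond_indep {d} {T : measurableType d} {R : realType}
  (P : probability T R) (F G H : set (set T)) : Prop :=
  forall A B, F A -> G B ->
  forall YA YB YAB, cond_prob_version P H A YA -> cond_prob_version P H B YB ->
    cond_prob_version P H (A `&` B) YAB ->
    {ae P, forall x, YAB x = YA x * YB x}.

Definition immersed {d} {T : measurableType d} {R : realType}
  (P : probability T R) (F G : int -> set (set T)) : Prop :=
  (forall n : int, n <= 0 -> F n `<=` G n) /\
  (forall n : int, n < 0 -> cond_indep P (F (n + 1)) (G n) (F n)).

Definition indep_rvs {d} {T : measurableType d} {R : realType}
  (P : probability T R) {Vd : int -> measure_display}
  (V : forall m, measurableType (Vd m)) (xi : forall m, T -> V m) : Prop :=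
  forall (s : seq int) (B : forall m, set (V m)),
    uniq s -> all (fun m => m <= 0) s -> (forall m, measurable (B m)) ->
    P (\big[setI/setT]_(m <- s) (xi m @^-1` B m)) =
    (\prod_(m <- s) P (xi m @^-1` B m))%E.

Definition product_type {d} {T : measurableType d} {R : realType}
  (P : probability T R) (G : int -> set (set T)) : Prop :=
  exists (Vd : int -> measure_display) (V : forall m, measurableType (Vd m))
         (xi : forall m, T -> V m),
    (forall m : int, m <= 0 -> measurable_fun setT (xi m)) /\
    indep_rvs P V xi /\
    (forall n : int, n <= 0 -> G n = gen_filt V xi n).

Definition nat_filt {d} {T : measurableType d} {R : realType} {D : option nat}
  (X : int -> T -> state R D) : int -> set (set T) :=
  gen_filt (fun _ : int => state R D) X.

Definition path_sys (R : realType) (D : option nat) : set (set (int -> state R D)) :=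
  <<s [set E | exists (m : int) (B : set (state R D)), m <= 0 /\ measurable B /\
             E = [set w | B (w m)]] >>.

Definition same_law {d d'} {T : measurableType d} {T' : measurableType d'}
  {R : realType} {D : option nat}
  (P : probability T R) (X : int -> T -> state R D)
  (P' : probability T' R) (X' : int -> T' -> state R D) : Prop :=
  forall E, path_sys R D E ->
    P [set w | E (fun m => X m w)] = P' [set w | E (fun m => X' m w)].

Definition Kolmogorovian {d} {T : measurableType d} {R : realType}
  (P : probability T R) (F : int -> set (set T)) : Prop :=
  forall A, tail_sig F A -> P A = 0%E \/ P A = 1%E.

Definition standard_filt {d} {T : measurableType d} {R : realType} {D : option nat}
  (P : probability T R) (X : int -> T -> state R D) : Prop :=
  exists (d' : measure_display) (T' : measurableType d') (P' : probability T' R)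
         (X' : int -> T' -> state R D),
    (forall n : int, n <= 0 -> measurable_fun setT (X' n)) /\
    same_law P X P' X' /\
    exists G : int -> set (set T'), product_type P' G /\ immersed P' (nat_filt X') G.

Definition markov_process {d} {T : measurableType d} {R : realType} {D : option nat}
  (P : probability T R) (X : int -> T -> state R D) : Prop :=
  forall n : int, n < 0 -> cond_indep P (sig_of (X (n + 1))) (nat_filt X n) (sig_of (X n)).

Definition law_support {d} {T : measurableType d} {R : realType} {D : option nat}
  (P : probability T R) (Xn : T -> state R D) : set {ptws coord D -> R} :=
  [set x | forall U : set {ptws coord D -> R}, open U -> U x ->
     (0 < P (Xn @^-1` U))%E].

Definition transition_version {d} {T : measurableType d} {R : realType}
  {D : option nat} (P : probability T R) (X : int -> T -> state R D) (n : int)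
  (Q : R.-pker state R D ~> state R D) : Prop :=
  forall B : set (state R D), measurable B ->
    cond_prob_version P (sig_of (X n)) (X (n + 1) @^-1` B)
      (fun w => fine (Q (X n w) B)).

Definition monotonic_markov {d} {T : measurableType d} {R : realType} {D : option nat}
  (P : probability T R) (X : int -> T -> state R D) : Prop :=
  forall n : int, n < 0 ->
  exists (Q : R.-pker state R D ~> state R D)
         (C : R.-pker (state R D * state R D)%type ~> (state R D * state R D)%type),
    transition_version P X n Q /\
    forall x x' : state R D, law_support P (X n) x -> law_support P (X n) x' ->
      (forall B : set (state R D), measurable B ->
         C (x, x') (B `*` setT) = Q x B /\ C (x, x') (setT `*` B) = Q x' B) /\
      (forall k : coord D, x k <= x' k ->
         {ae C (x, x'), forall y : state R D * state R D, y.1 k <= y.2 k}) /\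
      (forall k : coord D, x' k <= x k ->
         {ae C (x, x'), forall y : state R D * state R D, y.2 k <= y.1 k}).

(* Main.v *)
(** Under (a) every tail event has probability 0 or 1, which yields (b); and (c)
    implies (a) by Kolmogorov's zero-one law, the tail of a copy of the process
    being contained in the tail of the independent variables.

    For (b) => (c), the process is rebuilt from independent uniform variables
    [U (t, K)], where [t] stands for the time [-t]. Stage [K] is a copy [Z_K] of
    the process that starts at a remote time, with a variable independent of
    everything before, and whose time [-t] value uses only the noise before time
    [-t] and the first [K + 1] variables attached to it. Stage [K + 1] starts much
    earlier and, once stage [K] has started, is coupled to it through the monotone
    couplings; the fresh variable [U (t, K + 1)] makes each coupling step possible
    without destroying the Markov property of either copy with respect to the
    noise. A coordinate that is ordered when stage [K] starts stays ordered, so the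
    event that [Z_K] and [Z_(K+1)] lie on different sides of a level at time [-t]
    has probability at most twice the L1 distance between the conditional law of
    the later value given the value at the starting time and its unconditional
    law. By (b) and the reverse martingale theorem this distance is as small as
    desired when the starting time is remote. Hence the stages converge, and the
    limit is a copy of the process adapted to the noise and still Markov with
    respect to it, which is immersion. *)

Require Import Defs.
From HB Require Import structures.
From mathcomp Require Import all_boot all_order all_algebra.
From mathcomp Require Import all_classical all_reals all_analysis.
From mathcomp Require Import measurable_realfun zify ring lra.
Import Order.TTheory GRing.Theory Num.Theory.
Import numFieldNormedType.Exports.
Local Open Scope classical_set_scope.
Local Open Scope ring_scope.
Set Implicit Arguments.
Unset Strict Implicit.
Unset Printing Implicit Defensive.

(* [vector.coord] shadows the coordinate type of [Defs]. *)
Local Notation coord := Defs.coord.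

(** * Laws, mixtures and kernels *)

Local Open Scope ereal_scope.

(** Condition (b) bears on one time at a time, and the couplings compare one coordinate with one
    level, so only the events [X (-t) k <= q] are controlled directly. Full convergence comes from
    the fact that all stages have the same law [mu t] at time [-t]: a countable union can be
    truncated with an error uniform in the stage, so convergence in probability holds for every
    measurable set, and the Markov property passes to the limit although the kernels are merely
    measurable, not continuous. The couplings are prescribed only on the supports; as there are
    countably many coordinates, a support carries the whole mass. In several dimensions a kernel is
    not sampled by one quantile function. Instead a uniform variable is cut along an enumeration of
    the rays [y k <= q], with nested conditional probabilities. The conditioning is on the whole
    past sigma-algebra rather than on the current state, which makes the constructed process Markov
    with respect to the noise. The factor 2 in the estimate is one L1 distance for each of the two
    copies, which have the same law at the time where they are compared. *)

Section ProbOf.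
Context d (T : measurableType d) (R : realType).
Variables (m : {measure set T -> \bar R}) (h : m setT = 1).

(** The proof is a dummy argument: the instances attached to this name depend on it. The same device
    serves for [fin_fun], [slice_fun] and [kpre_fun]. *)
Definition prob_fun (_ : m setT = 1) : set T -> \bar R := m.

HB.instance Definition _ := Measure.copy (prob_fun h) m.

HB.instance Definition _ := Measure_isProbability.Build _ T R (prob_fun h) h.

Definition prob_of : probability T R := prob_fun h.

End ProbOf.

Section Law.
Context d d' (T : measurableType d) (T' : measurableType d') (R : realType).
Variables (P : probability T R) (f : T -> T') (mf : measurable_fun setT f).

Let mfun_f : {mfun T >-> T'} :=
  HB.pack f (@isMeasurableFun.Build _ _ _ _ f mf).

Definition law : probability T' R := distribution P mfun_f.

Lemma lawE A : law A = P (f @^-1` A).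
Proof. by []. Qed.

Lemma ge0_integral_law (D : set T') (g : T' -> \bar R) : measurable D ->
  measurable_fun setT g -> (forall y, 0 <= g y) ->
  \int[law]_(y in D) g y = \int[P]_(x in f @^-1` D) g (f x).
Proof.
move=> mD mg g0; rewrite /law ge0_integral_pushforward//.
exact: measurable_funTS.
Qed.

End Law.

Lemma prob_eq d (T : measurableType d) (R : realType) (G : set (set T))
    (P Q : {measure set T -> \bar R}) : measurable = <<s G >> -> setI_closed G ->
  P setT = Q setT -> P setT < +oo -> (forall A, G A -> P A = Q A) ->
  forall A, measurable A -> P A = Q A.
Proof.
move=> mG GI PQT Poo PQ A mA.
(* Adjoining [setT] to [G] lets the constant sequence [setT] serve as the exhausting sequence in the
   uniqueness theorem for measures. *)
have mGs : <<s [set A | G A \/ A = setT] >> = <<s G >>.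
  apply/seteqP; split.
    apply: smallest_sub; first exact: smallest_sigma_algebra.
    move=> B [GB|->]; first exact: sub_sigma_algebra.
    by rewrite -mG; exact: measurableT.
  by apply: sub_sigma_algebra2 => B GB; left.
apply: (@measure_unique _ _ _ [set A | G A \/ A = setT] (fun=> setT)) => //.
- by rewrite mGs.
- move=> B C [GB|->] [GC|->]; rewrite ?setIT ?setTI; try by [left|right].
  by left; exact: GI.
- by move=> _; right.
- by rewrite bigcup_const.
- by move=> B [/PQ|->].
Qed.

Lemma prod_gen d d' (T : measurableType d) (T' : measurableType d') :
  let G := [set C : set (T * T') | exists A B,
     [/\ measurable A, measurable B & C = A `*` B]] in
  measurable = <<s G >> /\ setI_closed G.
Proof.
move=> G; split.
  rewrite measurable_prod_measurableType; congr (<<s _ >>); apply/seteqP; split.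
    by move=> _ [A mA [B mB <-]]; exists A, B.
  by move=> _ [A [B [mA mB ->]]]; exists A => //; exists B.
move=> _ _ [A [B [mA mB ->]]] [A' [B' [mA' mB' ->]]].
exists (A `&` A'), (B `&` B'); split; [exact: measurableI..|].
by rewrite setXI.
Qed.

Lemma prob_eq_prod d d' (T : measurableType d) (T' : measurableType d')
    (R : realType) (P Q : {measure set (T * T') -> \bar R}) :
  P setT < +oo ->
  (forall A B, measurable A -> measurable B -> P (A `*` B) = Q (A `*` B)) ->
  forall A, measurable A -> P A = Q A.
Proof.
move=> Poo PQ; have [mG GI] := @prod_gen _ _ T T'.
apply: (prob_eq mG GI) => //; first by rewrite -setXTT PQ.
by move=> _ [A [B [mA mB ->]]]; exact: PQ.
Qed.

Section Mixture.
Context d d' (V : measurableType d) (S : measurableType d') (R : realType).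
Variables (mu : probability V R) (k : R.-pker V ~> S).

(** The mixture, that is the law of a pair whose first component has law [mu] and whose second has
    law [k v] given the first, is obtained as a composition of kernels started from [unit]. Its
    measure axioms and its integration formula then come from [kcomp]. *)
Definition mixture_base (_ : unit) : {measure set V -> \bar R} := mu.

Let base_meas U : measurable U -> measurable_fun setT (mixture_base ^~ U).
Proof. by move=> mU. Qed.

HB.instance Definition _ :=
  isKernel.Build _ _ unit V R mixture_base base_meas.

Let base_prob : forall x, mixture_base x setT = 1.
Proof. by move=> x; exact: (@probability_setT _ V R mu). Qed.

HB.instance Definition _ :=
  Kernel_isProbability.Build _ _ unit V R mixture_base base_prob.

Lemma measurable_pairr (v : V) : measurable_fun setT (fun y : S => (v, y)).
Proof. exact: measurable_fun_pair. Qed.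

Let kv v : probability S R := prob_of (@prob_kernel _ _ _ _ _ k v).

Definition mixture_ker (p : unit * V) : {measure set (V * S) -> \bar R} :=
  law (kv p.2) (measurable_pairr p.2).

Lemma mixture_kerE p A : mixture_ker p A = k p.2 (xsection A p.2).
Proof.
rewrite -[LHS]/(k p.2 ((pair p.2) @^-1` A)); congr (k p.2 _).
by apply/seteqP; split=> y; rewrite /xsection /= inE.
Qed.

Let ker_meas U : measurable U -> measurable_fun setT (mixture_ker ^~ U).
Proof.
move=> mU; under eq_fun do rewrite mixture_kerE.
apply: (measurableT_comp (f := fun v => k v (xsection U v)) (g := snd)) => //.
by apply: measurable_fun_xsection_finite_kernel; rewrite inE.
Qed.

HB.instance Definition _ :=
  isKernel.Build _ _ (unit * V)%type (V * S)%type R mixture_ker ker_meas.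

Let ker_prob p : mixture_ker p setT = 1.
Proof. exact: (@probability_setT _ _ _ (law (kv p.2) (measurable_pairr p.2))). Qed.

HB.instance Definition _ :=
  Kernel_isProbability.Build _ _ (unit * V)%type (V * S)%type R mixture_ker
    ker_prob.

Let mixm : {measure set (V * S) -> \bar R} :=
  (mkcomp mixture_base mixture_ker) tt.

Let mixE A : mixm A = \int[mu]_v k v (xsection A v).
Proof.
rewrite /mixm /= /kcomp; apply: eq_integral => v _; exact: mixture_kerE.
Qed.

Let mixT : mixm setT = 1.
Proof.
rewrite mixE (eq_integral (cst 1)).
  by rewrite integral_cst// mul1e; exact: (@probability_setT _ V R mu).
move=> v _; rewrite -(@prob_kernel _ _ _ _ _ k v); congr (k v _).
by apply/seteqP; split=> y; rewrite /xsection /= inE.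
Qed.

Definition mixture : probability (V * S)%type R :=
  prob_of mixT.

Lemma mixtureE A : mixture A = \int[mu]_v k v (xsection A v).
Proof. exact: mixE. Qed.

Lemma mixture_prod A B : measurable A -> measurable B ->
  mixture (A `*` B) = \int[mu]_(v in A) k v B.
Proof.
move=> mA mB; rewrite mixtureE [RHS]integral_mkcond; apply: eq_integral => v _.
rewrite patchE; case: ifPn => vA; first by rewrite in_xsectionX.
by rewrite notin_xsectionX// measure0.
Qed.

Lemma integral_mixture (f : V * S -> \bar R) : (forall z, 0 <= f z) ->
  measurable_fun setT f ->
  \int[mixture]_z f z = \int[mu]_v \int[k v]_y f (v, y).
Proof.
move=> f0 mf.
rewrite -[LHS]/(\int[kcomp mixture_base mixture_ker tt]_z f z).
rewrite integral_kcomp//; apply: eq_integral => v _.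
by rewrite /= /mixture_ker ge0_integral_law// preimage_setT.
Qed.

End Mixture.

Section KernelPrecomp.
Context d d' d'' (V : measurableType d) (W : measurableType d')
  (S : measurableType d'') (R : realType).
Variables (f : V -> W) (mf : measurable_fun setT f) (k : R.-pker W ~> S).

Definition kpre_fun (_ : measurable_fun setT f) (v : V) :
  {measure set S -> \bar R} := k (f v).

Let kpre_meas U : measurable U -> measurable_fun setT (kpre_fun mf ^~ U).
Proof. by move=> mU; exact: (measurableT_comp (measurable_kernel k U mU)). Qed.

HB.instance Definition _ := isKernel.Build _ _ V S R (kpre_fun mf) kpre_meas.

Let kpre_prob v : kpre_fun mf v setT = 1.
Proof. exact: prob_kernel. Qed.

HB.instance Definition _ :=
  Kernel_isProbability.Build _ _ V S R (kpre_fun mf) kpre_prob.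

Definition kpre : R.-pker V ~> S := kpre_fun mf.

Lemma kpreE v : kpre v = k (f v). Proof. by []. Qed.

End KernelPrecomp.

Section KernelConst.
Context d d' (V : measurableType d) (S : measurableType d') (R : realType).
Variables (m : probability S R).

Definition kcst_fun (v : V) : {measure set S -> \bar R} := m.

Let kcst_meas U : measurable U -> measurable_fun setT (kcst_fun ^~ U).
Proof. by move=> mU. Qed.

HB.instance Definition _ := isKernel.Build _ _ V S R kcst_fun kcst_meas.

Let kcst_prob v : kcst_fun v setT = 1.
Proof. exact: probability_setT. Qed.

HB.instance Definition _ :=
  Kernel_isProbability.Build _ _ V S R kcst_fun kcst_prob.

Definition kcst : R.-pker V ~> S := kcst_fun.

End KernelConst.

Local Close Scope ereal_scope.

(** * Sub-sigma-algebras *)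

Local Open Scope ereal_scope.

Section SubSigma.
Context d (T : measurableType d) (F : set (set T)).
Hypothesis sF : sigma_algebra setT F.

(** A sub-sigma-algebra [F] is turned into a measurable type on the same carrier, so that general
    results apply to it; an [F]-measurable function is a measurable function out of that type. *)
Lemma measurable_subE : @measurable _ (g_sigma_algebraType F) = F.
Proof. exact: sigma_algebra_id. Qed.

Lemma measurable_subP d' (V : measurableType d') (f : T -> V) :
  measurable_fun [set: g_sigma_algebraType F] (f : g_sigma_algebraType F -> V) <->
  (forall B, measurable B -> F (f @^-1` B)).
Proof.
split=> [mf B mB|Ff _ B mB]; last by rewrite setTI measurable_subE; exact: Ff.
by rewrite -measurable_subE -[X in measurable X]setTI; exact: mf.
Qed.

Hypothesis Fm : F `<=` measurable.

Lemma measurable_id_sub :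
  measurable_fun [set: T] (id : T -> g_sigma_algebraType F).
Proof. by move=> _ B; rewrite measurable_subE setTI => /Fm. Qed.

Lemma measurable_sub_fun d' (V : measurableType d') (f : T -> V) :
  measurable_fun [set: g_sigma_algebraType F] (f : g_sigma_algebraType F -> V) ->
  measurable_fun [set: T] f.
Proof. by move=> /measurable_subP mf _ B mB; rewrite setTI; exact/Fm/mf. Qed.

Context (R : realType).

Definition restr (P : probability T R) : probability (g_sigma_algebraType F) R :=
  law P measurable_id_sub.

Lemma restrE P A : restr P A = P A. Proof. by []. Qed.

Lemma integral_restr (P : probability T R) A (g : T -> \bar R) : F A ->
  measurable_fun [set: g_sigma_algebraType F] (g : g_sigma_algebraType F -> _) ->
  (forall y, 0 <= g y) ->
  \int[restr P]_(y in A) g y = \int[P]_(x in A) g x.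
Proof.
move=> FA mg g0; rewrite /restr ge0_integral_law//.
by rewrite measurable_subE.
Qed.

Import HBNNSimple.

(** Approximate [h] from below by simple functions whose level sets lie in [F], apply the hypothesis
    on each level set, and pass to the limit by monotone convergence. This is how a function is
    later exchanged with its conditional expectation under an [F]-measurable weight. *)
Lemma integral_sub_ext (P : {measure set T -> \bar R}) (f1 f2 : T -> R) :
  (forall x, 0 <= f1 x)%R -> (forall x, 0 <= f2 x)%R ->
  measurable_fun [set: T] f1 -> measurable_fun [set: T] f2 ->
  (forall A, F A -> \int[P]_(x in A) (f1 x)%:E = \int[P]_(x in A) (f2 x)%:E) ->
  forall h : T -> \bar R,
  measurable_fun [set: g_sigma_algebraType F] (h : g_sigma_algebraType F -> _) ->
  (forall x, 0 <= h x) ->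
  \int[P]_x (h x * (f1 x)%:E) = \int[P]_x (h x * (f2 x)%:E).
Proof.
move=> f10 f20 mf1 mf2 f12 h mh h0.
pose hn := nnsfun_approx (@measurableT _ (g_sigma_algebraType F)) mh.
have hnh x : (fun n => (hn n x)%:E) @ \oo --> h x.
  by apply: (cvg_nnsfun_approx measurableT mh) => //.
have mhn n : measurable_fun [set: T] (hn n).
  by apply: measurable_sub_fun; exact: measurable_funPT.
have hnd x : nondecreasing_seq (fun n => hn n x).
  by move=> m n mn; apply/lefP; exact: nd_nnsfun_approx.
have mF A : F A -> d.-measurable A by exact: Fm.
have Fhn n r : F (hn n @^-1` [set r]).
  by have /measurable_subP := @measurable_funPT _ _ _ _ (hn n); exact.
(* Expresses the integral through the integrals of [f] over sets of [F] alone, so that [f1] and [f2]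
   give the same value. *)
have key (f : T -> R) : (forall x, 0 <= f x)%R -> measurable_fun [set: T] f ->
    \int[P]_x (h x * (f x)%:E) = limn (fun n =>
      \sum_(r \in range (hn n)) r%:E * \int[P]_(x in hn n @^-1` [set r]) (f x)%:E).
  move=> f0 mf.
  transitivity (\int[P]_x limn (fun n => (hn n x)%:E * (f x)%:E)).
    by apply: eq_integral => x _; apply/esym/cvg_lim => //; exact: cvgeZr.
  rewrite monotone_convergence//; last first.
  - by move=> x _ m n mn; rewrite lee_wpmul2r// lee_fin// hnd.
  - by move=> n x _; rewrite mule_ge0// lee_fin.
  - by move=> n; apply: emeasurable_funM; exact/measurable_EFinP.
  apply/congr_lim/funext => n.
  transitivity (\int[P]_x \sum_(r \in range (hn n))
      (r%:E * ((f x)%:E * (\1_(hn n @^-1` [set r]) x)%:E))).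
    apply: eq_integral => x _; rewrite fimfunE -fsumEFin//.
    rewrite ge0_mule_fsuml; last by move=> r; rewrite EFinM nnfun_muleindic_ge0.
    by apply: eq_fsbigr => r _; rewrite EFinM -muleA (muleC (f x)%:E).
  have me r : measurable_fun [set: T]
      (fun x => (f x)%:E * (\1_(hn n @^-1` [set r]) x)%:E).
    apply: emeasurable_funM; first exact/measurable_EFinP.
    exact/measurable_EFinP/measurable_indic/mF.
  have ge0 r x : range (hn n) r ->
      0 <= r%:E * ((f x)%:E * (\1_(hn n @^-1` [set r]) x)%:E).
    by move=> [y _ <-]; rewrite !mule_ge0// lee_fin.
  rewrite ge0_integral_fsum//; last 2 first.
  - by move=> r; exact: measurable_funeM.
  - move=> r x _; have [r0|r0] := leP 0%R r.
      by rewrite !mule_ge0// lee_fin.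
    by rewrite preimage_nnfun0// indic0 mule0 mule0.
  apply: eq_fsbigr => r; rewrite inE => -[y _ yr].
  rewrite ge0_integralZl//; last 2 first.
  - by move=> x _; rewrite mule_ge0// lee_fin.
  - by rewrite lee_fin -yr.
  congr (_ * _); rewrite [RHS]integral_mkcond; apply: eq_integral => x _.
  by rewrite patchE indicE; case: ifPn => _; rewrite (mule0, mule1).
rewrite !key//; apply/congr_lim/funext => n; apply: eq_fsbigr => r _.
by rewrite f12.
Qed.

End SubSigma.

Local Close Scope ereal_scope.

(** * The state space *)

Section State.
Context (R : realType) (D : option nat).
Implicit Types (k : coord D) (q : rat).

Definition coord_num : coord D -> nat :=
  match D return coord D -> nat with Some d => @nat_of_ord d | None => id end.

Definition coord_of_num : nat -> option (coord D) :=
  match D return nat -> option (coord D) with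
  | Some d => insub
  | None => Some
  end.

Lemma coord_numK k : coord_of_num (coord_num k) = Some k.
Proof.
by rewrite /coord_of_num /coord_num; move: k; case: D => // d k; exact: valK.
Qed.

Definition ray k q : set (state R D) := [set y | y k <= ratr q].

(* Enumerates the rays; the junk value is [setT]. *)
Definition bit (j : nat) : set (state R D) :=
  if (unpickle j : option (nat * rat)) is Some (n, q) then
    if coord_of_num n is Some k then ray k q else setT
  else setT.

Definition bit_num k q : nat := pickle (coord_num k, q).

Lemma bit_numE k q : bit (bit_num k q) = ray k q.
Proof. by rewrite /bit /bit_num pickleK coord_numK. Qed.

Lemma bitP j : bit j = setT \/ exists k q, bit j = ray k q.
Proof.
rewrite /bit; case: unpickle => [[n q]|]; last by left.
by case: coord_of_num => [k|]; [right; exists k, q|left].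
Qed.

Lemma measurable_coord k : measurable_fun [set: state R D] (fun y => y k).
Proof.
move=> _ B mB; rewrite setTI; apply: sub_sigma_algebra; exists k, B; split => //.
Qed.

Lemma measurable_ray k q : measurable (ray k q).
Proof.
have := @measurable_coord k measurableT _ (measurable_itv `]-oo, (ratr q : R)]).
by rewrite setTI; congr measurable; apply/seteqP; split => y /=; rewrite in_itv.
Qed.

Lemma measurable_bit j : measurable (bit j).
Proof. by case: (bitP j) => [->|[k [q ->]]] //; exact: measurable_ray. Qed.

Lemma measurable_state d (T : measurableType d) (f : T -> state R D) :
  (forall k, measurable_fun [set: T] (fun w => f w k)) ->
  measurable_fun [set: T] f.
Proof.
move=> mf; apply: (@measurability _ _ T (state R D) setT f (cyl_sys R D)) => //.
move=> _ [_ [k [B [mB ->]]] <-]; rewrite setTI.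
by rewrite -[X in measurable X]setTI; exact: mf.
Qed.

(** Finite intersections of enumerated rays, chosen by a predicate on indices: a generating family
    closed under intersection whose members can be read off the first [n] bits. *)
Definition bits_inter (n : nat) (s : pred nat) : set (state R D) :=
  [set y | forall i, (i < n)%N -> s i -> bit i y].

Definition bits_sys : set (set (state R D)) :=
  [set A | exists n s, A = bits_inter n s].

Lemma bits_sysI : setI_closed bits_sys.
Proof.
move=> _ _ [n [s ->]] [n' [s' ->]]; exists (maxn n n').
exists (fun i => ((i < n)%N && s i) || ((i < n')%N && s' i)).
apply/seteqP; split=> y.
  by move=> [ys ys'] i _ /orP[]/andP[]; [exact: ys|exact: ys'].
move=> ys; split=> i ni si; apply: ys.
- by rewrite (leq_trans ni)// leq_maxl.
- by rewrite ni si.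
- by rewrite (leq_trans ni)// leq_maxr.
- by rewrite ni si orbT.
Qed.

Lemma measurable_bits_inter n s : measurable (bits_inter n s).
Proof.
rewrite (_ : bits_inter n s = \bigcap_i (if (i < n)%N && s i then bit i else setT)).
  apply: bigcapT_measurable => i.
  by case: ifP => _; [exact: measurable_bit|exact: measurableT].
apply/seteqP; split=> y ys i.
  by move=> _; case: ifP => // /andP[]; exact: ys.
by move=> ni si; have := ys i I; rewrite ni si.
Qed.

Lemma bits_sys_gen : measurable = <<s bits_sys >>.
Proof.
apply/seteqP; split; last first.
  apply: smallest_sub; first exact: sigma_algebra_measurable.
  by move=> _ [n [s ->]]; exact: measurable_bits_inter.
apply: smallest_sub; first exact: smallest_sigma_algebra.
move=> _ [k [B [mB ->]]].
have sB : sigma_algebra setT [set B : set R | <<s bits_sys >> [set x | B (x k)]].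
  have [h0 hC hU] := smallest_sigma_algebra [set: state R D] bits_sys.
  split => /=; first exact: h0.
  - by move=> A sA; exact: hC.
  - move=> F mF; rewrite (_ : [set x | _] = \bigcup_i [set x | F i (x k)]) //.
    exact: hU.
have := RGenInftyO.measurableE R; rewrite -[X in _ = X -> _]/(<<s @RGenInftyO.G R >>) => RE.
suff : <<s @RGenInftyO.G R >> `<=` [set B : set R | <<s bits_sys >> [set x | B (x k)]].
  by apply; rewrite -RE.
apply: smallest_sub => // _ [r ->] /=.
(* An open half-line is the union of the closed rational rays strictly below its endpoint. *)
rewrite (_ : [set x | _] =
  \bigcup_q (if ratr q < r then ray k q else set0)); last first.
  apply/seteqP; split=> y /=; rewrite in_itv/=.
    move=> /rat_in_itvoo[q]; rewrite in_itv/= => /andP[yq qr].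
    by exists q => //; rewrite qr; exact: ltW.
  by move=> [q _]; case: ifPn => // qr yq; exact: le_lt_trans qr.
apply: (@bigcupT_measurable_rat _ (g_sigma_algebraType bits_sys)) => q.
case: ifPn => _; last exact: (@measurable0 _ (g_sigma_algebraType bits_sys)).
apply: sub_sigma_algebra; exists (bit_num k q).+1, (pred1 (bit_num k q)).
apply/seteqP; split=> y.
  by move=> yq i _ /eqP ->; rewrite bit_numE.
by move=> /(_ (bit_num k q)); rewrite bit_numE; apply => /=.
Qed.

End State.

(** * Realizing events by a random variable *)

Local Open Scope ereal_scope.

Section NullSets.
Context d (T : measurableType d) (R : realType) (P : probability T R).
Implicit Types A B : set T.

Lemma prob_fin A : measurable A -> P A \is a fin_num.
Proof. by move=> mA; exact: fin_num_measure. Qed.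

Lemma prob_lty A : measurable A -> P A < +oo.
Proof. by move=> mA; rewrite -ge0_fin_numE// prob_fin. Qed.

Lemma null_le A x : P A <= x -> x = 0 -> P A = 0.
Proof. by move=> Ax x0; apply/eqP; rewrite -measure_le0 -x0. Qed.

Lemma prob_le A B : measurable A -> measurable B -> A `<=` B -> P A <= P B.
Proof. by move=> mA mB AB; rewrite le_measure ?inE. Qed.

Lemma nullS A B : measurable A -> measurable B -> A `<=` B -> P B = 0 -> P A = 0.
Proof. by move=> mA mB AB B0; exact: (subset_measure0 mA mB AB). Qed.

Lemma prob_U2 A B : measurable A -> measurable B -> P (A `|` B) <= P A + P B.
Proof. exact: measureU2. Qed.

Lemma prob_DI A B : measurable A -> measurable B ->
  P A = P (A `\` B) + P (A `&` B).
Proof. exact: measureDI. Qed.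

Lemma prob_D A B : measurable A -> measurable B ->
  P (A `\` B) = P A - P (A `&` B).
Proof. by move=> mA mB; apply: measureD => //; exact: prob_lty. Qed.

Lemma nullU A B : measurable A -> measurable B -> P A = 0 -> P B = 0 ->
  P (A `|` B) = 0.
Proof.
by move=> mA mB A0 B0; apply: (null_le (prob_U2 mA mB)); rewrite A0 B0 adde0.
Qed.

Lemma null_bigcup (F : nat -> set T) : (forall n, measurable (F n)) ->
  (forall n, P (F n) = 0) -> P (\bigcup_n F n) = 0.
Proof.
move=> mF F0; apply/negligibleP; first exact: bigcupT_measurable.
by apply: negligible_bigcup => n; apply/negligibleP => //; exact: F0.
Qed.

Lemma null_bigcup_rat (F : rat -> set T) : (forall n, measurable (F n)) ->
  (forall n, P (F n) = 0) -> P (\bigcup_n F n) = 0.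
Proof.
move=> mF F0.
have := @null_bigcup (fun n => if unpickle n is Some q then F q else set0).
rewrite (_ : \bigcup_n _ = \bigcup_q F q).
  by apply=> n; case: unpickle => // q; rewrite measure0.
apply/seteqP; split=> x [n _]; first by case: unpickle => // q Fx; exists q.
move=> Fx; exists (pickle n); first exact: I.
by rewrite pickleK; exact: Fx.
Qed.

(** The measure [mu] may live on another space: null events of [P] are obtained by comparison with
    sets of states that decrease to the empty set. *)
Lemma null_vanish d' (S : measurableType d') (mu : probability S R)
    (A : nat -> set S) N : (forall n, measurable (A n)) ->
  nonincreasing_seq A -> \bigcap_n A n = set0 ->
  (forall n, P N <= mu (A n)) -> P N = 0.
Proof.
move=> mA niA A0 PN; apply/eqP; rewrite -measure_le0.
have <- : lim (mu (A n) @[n --> \oo]) = 0.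
  rewrite -[RHS](measure0 mu) -A0; apply: cvg_lim => //.
  apply: nonincreasing_cvg_mu => //.
    exact: (le_lt_trans (probability_le1 mu (mA 0%N)) (ltry _)).
  exact: bigcapT_measurable.
apply: lime_ge; last exact: nearW.
apply: ereal_nonincreasing_is_cvgn => m n mn.
by apply: le_measure; rewrite ?inE//; apply/subsetPset/niA.
Qed.

Lemma prob_D0 A B : measurable A -> measurable B -> P (A `\` B) = 0 ->
  P A = P (A `&` B).
Proof. by move=> mA mB AB0; rewrite (prob_DI mA mB) AB0 add0e. Qed.

Lemma prob_eq0D A B : measurable A -> measurable B ->
  P (A `\` B) = 0 -> P (B `\` A) = 0 -> P A = P B.
Proof.
by move=> mA mB AB BA; rewrite (prob_D0 mA mB AB) (prob_D0 mB mA BA) setIC.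
Qed.

End NullSets.

Section Realize.
Context (R : realType) (D : option nat) d (T : measurableType d).
Variables (P : probability T R) (mu : probability (state R D) R).
Variable E : coord D -> rat -> set T.
Hypothesis mE : forall k q, measurable (E k q).
Hypothesis PE : forall k q, P (E k q) = mu (@ray R D k q).
Hypothesis PED : forall k q q', (q <= q')%R -> P (E k q `\` E k q') = 0.

(* The k-th coordinate to be built: the least level whose event holds. *)
Let u k w : \bar R := ereal_inf [set (ratr q)%:E | q in [set q | E k q w]].

Let ultP k w c : u k w < c <-> exists2 q, E k q w & (ratr q)%:E < c.
Proof.
split.
  by move=> /ereal_inf_lt[_ [q /= Eq <-] qc]; exists q.
by move=> [q Eq]; apply: le_lt_trans; apply: ereal_inf_lbound; exists q.
Qed.

Let ultE k c : [set w | u k w < c%:E] =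
  \bigcup_q (if (ratr q < c)%R then E k q else set0).
Proof.
apply/seteqP; split => w /=.
  by move=> /ultP[q Eq]; rewrite lte_fin => qc; exists q => //; rewrite qc.
by move=> [q _]; case: ifPn => // qc Eq; apply/ultP; exists q.
Qed.

Let mult k c : measurable [set w | u k w < c%:E].
Proof. by rewrite ultE; apply: bigcupT_measurable_rat => q; case: ifP. Qed.

Let mu_ k : measurable_fun [set: T] (u k).
Proof.
apply: (measurability _ (ErealGenInftyO.measurableE R)) => _ [_ [c ->] <-].
rewrite setTI (_ : _ @^-1` _ = [set w | u k w < c%:E]); first exact: mult.
by apply/seteqP; split => w /=; rewrite in_itv.
Qed.

Let V_null k q : P ([set w | u k w < (ratr q)%:E] `\` E k q) = 0.
Proof.
rewrite ultE setDE setI_bigcupl.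
apply: null_bigcup_rat => q'; rewrite -setDE; first by case: ifP => _; apply: measurableD.
case: ifPn => [q'q|_]; last by rewrite set0D measure0.
by apply: PED; move: q'q; rewrite ltr_rat => /ltW.
Qed.

Let shift_lt (q : rat) (n : nat) : (q < q + n.+1%:R^-1)%R.
Proof. by rewrite ltrDl invr_gt0. Qed.

Let ray_le k q q' : (q <= q')%R -> @ray R D k q `<=` @ray R D k q'.
Proof. by move=> qq' y /le_trans; apply; rewrite ler_rat. Qed.

Let PED_ray k q q' : (q <= q')%R ->
  P (E k q' `\` E k q) = mu (@ray R D k q' `\` @ray R D k q).
Proof.
move=> qq'; rewrite !prob_D//; try exact: measurable_ray.
rewrite PE (setIidr (@ray_le k _ _ qq')); congr (_ - _).
by rewrite setIC -prob_D0// PED.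
Qed.

(** If [u <= q] then [u < q'] for each larger [q'], so [E k q'] holds almost surely. The excess of
    [E k q'] over [E k q] has the [mu]-mass of the strip between the two levels, which vanishes as
    [q'] decreases to [q]. *)
Let le_null k q : P ([set w | u k w <= (ratr q)%:E] `\` E k q) = 0.
Proof.
have mle : measurable [set w | u k w <= (ratr q)%:E].
  rewrite -[X in measurable X]setTI; exact: emeasurable_fun_infty_c.
pose A n := @ray R D k (q + n.+1%:R^-1)%R `\` @ray R D k q.
have mA n : measurable (A n) by apply: measurableD; exact: measurable_ray.
apply: (@null_vanish _ _ _ P _ _ mu A) => //.
- move=> m n mn; apply/subsetPset => y [yn yq]; split => //.
  apply: ray_le yn; rewrite lerD2l lef_pV2 ?posrE ?ltr0n//.
  by rewrite ler_nat.
- apply/seteqP; split=> // y yA.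
  have [_ /negP] := yA 0%N I; rewrite -ltNge => /rat_in_itvoo[r].
  rewrite in_itv/= ltr_rat => /andP[qr ry].
  (* With this [n], [q + 1/(n+1)] does not exceed [r]. *)
  pose n := Num.truncn (r - q)^-1.
  have [+ _] := yA n I; rewrite /ray /= leNgt => /negP; apply.
  apply: le_lt_trans ry; rewrite ler_rat -lerBrDl.
  rewrite -[leRHS]invrK lef_pV2 ?posrE ?invr_gt0 ?subr_gt0 ?ltr0n//.
  by apply/ltW/truncnS_gt.
- move=> n; rewrite /A -PED_ray; last exact/ltW.
  set q' := (q + _)%R.
  have qq' : (q < q')%R by exact: shift_lt.
  have mV : measurable ([set w | u k w < (ratr q')%:E] `\` E k q').
    by apply: measurableD.
  apply: (@le_trans _ _ (P (([set w | u k w < (ratr q')%:E] `\` E k q') `|`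
      (E k q' `\` E k q)))).
    apply: prob_le; [exact: measurableD|apply: measurableU => //; exact: measurableD|].
    move=> w [/= uq Eq]; have [Eq'|Eq'] := pselect (E k q' w); first by right.
    by left; split => //; rewrite (le_lt_trans uq)// lte_fin ltr_rat.
  apply: (le_trans (prob_U2 P mV (measurableD (mE k q') (mE k q)))).
  by rewrite V_null add0e.
Qed.

Let ninfty_null k : P [set w | u k w = -oo] = 0.
Proof.
have mS : measurable [set w | u k w = -oo].
  rewrite (_ : [set w | _] = [set: T] `&` u k @^-1` [set -oo]).
    by apply: mu_ => //; exact: emeasurable_set1.
  by rewrite setTI.
pose A n := @ray R D k (- n%:R)%R.
apply: (@null_vanish _ _ _ P _ _ mu A).
- by move=> n; exact: measurable_ray.
- by move=> m n mn; apply/subsetPset/ray_le; rewrite lerN2 ler_nat.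
- apply/seteqP; split=> // y yA.
  have := yA (Num.truncn (- y k)).+1 I; rewrite /A /ray /= rmorphN/= ratr_nat.
  by rewrite lerNr leNgt truncnS_gt.
move=> n; rewrite -PE.
have mV : measurable ([set w | u k w < (ratr (- n%:R))%:E] `\` E k (- n%:R)%R).
  exact: measurableD.
apply: (@le_trans _ _ (P (([set w | u k w < (ratr (- n%:R))%:E] `\`
    E k (- n%:R)%R) `|` E k (- n%:R)%R))).
  apply: prob_le => //; first exact: measurableU.
  move=> w /= uw; have [Eq'|Eq'] := pselect (E k (- n%:R)%R w); first by right.
  by left; split => //=; rewrite uw ltNyr.
apply: (le_trans (prob_U2 P mV (mE _ _))).
by rewrite V_null add0e.
Qed.

Let pinfty_null k : P [set w | u k w = +oo] = 0.
Proof.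
have mS : measurable [set w | u k w = +oo].
  rewrite (_ : [set w | _] = [set: T] `&` u k @^-1` [set +oo]).
    by apply: mu_ => //; exact: emeasurable_set1.
  by rewrite setTI.
pose A n := ~` @ray R D k n%:R.
have mA n : measurable (A n) by apply: measurableC; exact: measurable_ray.
apply: (@null_vanish _ _ _ P _ _ mu A) => //.
- by move=> m n mn; apply/subsetPset/subsetC/ray_le; rewrite ler_nat.
- apply/seteqP; split=> // y yA.
  have := yA (Num.truncn (y k)).+1 I; rewrite /A /ray /= ratr_nat.
  by apply; exact/ltW/truncnS_gt.
move=> n; rewrite /A probability_setC; last exact: measurable_ray.
rewrite -PE -probability_setC//; apply: prob_le => //; first exact: measurableC.
move=> w /= uw Ew; have : u k w <= (ratr n%:R)%:E.
  by apply: ereal_inf_lbound; exists n%:R.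
by rewrite uw leye_eq.
Qed.

(** The family [E] is only almost surely increasing in the level. Its right continuity and its
    behaviour at infinite levels are inherited from [mu], whose rays have the same probabilities and
    which charges only real vectors. *)
Lemma realize_events : exists X : T -> state R D, measurable_fun [set: T] X /\
  forall k q, P (X @^-1` @ray R D k q `\` E k q) = 0 /\
              P (E k q `\` X @^-1` @ray R D k q) = 0.
Proof.
(* [fine] sends both infinite values to 0; the events where they occur are null and are set aside
   below. *)
pose X w : state R D := fun k => fine (u k w).
have mX : measurable_fun [set: T] X.
  apply: measurable_state => k; apply: (measurableT_comp _ (mu_ k)).
  exact: fine_measurable.
exists X; split => // k q.
have mXr : measurable (X @^-1` @ray R D k q).
  by rewrite -[X in measurable X]setTI; apply: mX => //; exact: measurable_ray.
have mn : measurable [set w | u k w = -oo].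
  rewrite (_ : [set w | _] = [set: T] `&` u k @^-1` [set -oo]).
    by apply: mu_ => //; exact: emeasurable_set1.
  by rewrite setTI.
have mp : measurable [set w | u k w = +oo].
  rewrite (_ : [set w | _] = [set: T] `&` u k @^-1` [set +oo]).
    by apply: mu_ => //; exact: emeasurable_set1.
  by rewrite setTI.
have mle : measurable [set w | u k w <= (ratr q)%:E].
  rewrite -[X in measurable X]setTI; exact: emeasurable_fun_infty_c.
split.
  apply: (@nullS _ _ _ P _ ([set w | u k w = -oo] `|` ([set w | u k w = +oo] `|`
    ([set w | u k w <= (ratr q)%:E] `\` E k q)))).
  - exact: measurableD.
  - by apply: measurableU => //; apply: measurableU => //; exact: measurableD.
  - move=> w [/= Xq Eq]; move: Xq; rewrite /X /ray /=.
    case uw : (u k w) => [r| |]; [|by right; left|by left].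
    by move=> rq; right; right; split => //=; rewrite uw lee_fin.
  - apply: nullU => //; first by apply: measurableU => //; exact: measurableD.
    by apply: nullU => //; exact: measurableD.
apply: (@nullS _ _ _ P _ [set w | u k w = -oo]) => //; first exact: measurableD.
move=> w [Eq /= XNq]; apply/eqP/negPn/negP => uNoo; apply: XNq.
have : u k w <= (ratr q)%:E by apply: ereal_inf_lbound; exists q.
by rewrite /X /ray /=; case: (u k w) uNoo => [r| |].
Qed.

End Realize.

Local Close Scope ereal_scope.

(** * Uniform laws and transfer *)

Local Open Scope ereal_scope.

Section FinOf.
Context d (T : measurableType d) (R : realType).
Variables (m : {measure set T -> \bar R}) (h : fin_num_fun m).

Definition fin_fun (_ : fin_num_fun m) : set T -> \bar R := m.

HB.instance Definition _ := Measure.copy (fin_fun h) m.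

HB.instance Definition _ := Measure_isFinite.Build _ T R (fin_fun h) h.

Definition fin_of : {finite_measure set T -> \bar R} := fin_fun h.

End FinOf.

(** * Radon-Nikodym densities, and measures obtained by fixing one factor *)

Section Density.
Context d (T : measurableType d) (R : realType).

Lemma density_exists (rho : probability T R) (nu : {measure set T -> \bar R}) :
  (forall A, measurable A -> nu A <= rho A) ->
  exists f : T -> R, [/\ measurable_fun [set: T] f, forall x, (0 <= f x)%R &
    forall A, measurable A -> nu A = \int[rho]_(x in A) (f x)%:E].
Proof.
move=> nurho.
have fnu : fin_num_fun nu.
  move=> A mA; rewrite ge0_fin_numE//.
  exact: (le_lt_trans (nurho A mA) (prob_lty rho mA)).
have dom : fin_of fnu `<< rho.
  apply/null_content_dominatesP => A mA rA0; apply/eqP.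
  by rewrite eq_le measure_ge0 andbT -rA0; exact: nurho.
have [f [f0 ffin fint fE]] := radon_nikodym_sigma_finite dom.
exists (fine \o f); split.
- apply: measurableT_comp; first exact: fine_measurable.
  exact: measurable_int fint.
- by move=> x; exact: fine_ge0.
- move=> A mA; rewrite -[LHS]/(fin_of fnu A) fE//.
  by apply: eq_integral => x _; rewrite /= fineK.
Qed.

(* On the set where the Radon-Nikodym density exceeds [L] the two have the same
   integrals, so the density can be replaced by its minimum with [L]. *)
Lemma density_dominated (rho : probability T R) (nu : {measure set T -> \bar R})
    (L : T -> R) : measurable_fun [set: T] L -> (forall x, 0 <= L x)%R ->
  (forall A, measurable A -> nu A <= rho A) ->
  (forall A, measurable A -> nu A <= \int[rho]_(x in A) (L x)%:E) ->
  exists f : T -> R, [/\ measurable_fun [set: T] f,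
    forall x, (0 <= f x <= L x)%R &
    forall A, measurable A -> nu A = \int[rho]_(x in A) (f x)%:E].
Proof.
move=> mL L0 nurho nuL; have [f [mf f0 fE]] := density_exists nurho.
exists (fun x => Num.min (f x) (L x)); split.
- exact: measurable_minr.
- by move=> x; rewrite le_min f0 L0 ge_min lexx orbT.
move=> A mA; rewrite fE//.
have mN : measurable [set x | L x < f x]%R.
  by rewrite -[X in measurable X]setTI; exact: measurable_fun_ltr.
have mef : measurable_fun [set: T] (fun x => (f x)%:E) by exact/measurable_EFinP.
have meL : measurable_fun [set: T] (fun x => (L x)%:E) by exact/measurable_EFinP.
have mem : measurable_fun [set: T] (fun x => (Num.min (f x) (L x))%:E).
  by apply/measurable_EFinP; exact: measurable_minr.
have mAN : measurable (A `&` [set x | L x < f x]%R) by exact: measurableI.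
have mAC : measurable (A `\` [set x | L x < f x]%R) by exact: measurableD.
have split g : measurable_fun [set: T] g -> (forall x, 0 <= g x) ->
    \int[rho]_(x in A) g x = \int[rho]_(x in A `&` [set x | L x < f x]%R) g x +
      \int[rho]_(x in A `\` [set x | L x < f x]%R) g x.
  move=> mg g0; rewrite -ge0_integral_setU ?setUIDK//.
  - exact: measurable_funTS.
  - by rewrite disj_set2E; apply/eqP/seteqP; split => // x [[_ ?] [_]].
rewrite !split//; last by move=> x; rewrite lee_fin le_min f0 L0.
congr (_ + _); last first.
  by apply: eq_integral => x; rewrite inE => -[_ /negP]; rewrite -leNgt => /min_idPl ->.
transitivity (\int[rho]_(x in A `&` [set x | L x < f x]%R) (L x)%:E).
  apply/eqP; rewrite eq_le -{1}fE// nuL//=.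
  apply: ge0_le_integral => //; first by move=> x _; rewrite lee_fin.
  - exact: measurable_funTS.
  - exact: measurable_funTS.
  - by move=> x [_ /= /ltW]; rewrite lee_fin.
by apply: eq_integral => x; rewrite inE => -[_ /= /ltW /min_idPr ->].
Qed.

End Density.

Section Slice.
Context d d' (T : measurableType d) (S : measurableType d') (R : realType).
Variables (lam : {measure set (T * S) -> \bar R}) (B : set S) (mB : measurable B).

Definition slice_fun (_ : measurable B) (A : set T) : \bar R := lam (A `*` B).

Let slice0 : slice_fun mB set0 = 0.
Proof. by rewrite /slice_fun set0X measure0. Qed.

Let slice_ge0 A : 0 <= slice_fun mB A.
Proof. exact: measure_ge0. Qed.

Let slice_sigma : semi_sigma_additive (slice_fun mB).
Proof.
move=> F mF tF mUF; rewrite /slice_fun setX_bigcupl.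
apply: measure_semi_sigma_additive.
- by move=> n; exact: measurableX.
- apply/trivIsetP => i j _ _ ij; rewrite -setXI.
  by move/trivIsetP : tF => /(_ i j I I ij) ->; rewrite set0X.
- by rewrite -setX_bigcupl; exact: measurableX.
Qed.

HB.instance Definition _ := isMeasure.Build _ T R (slice_fun mB)
  slice0 slice_ge0 slice_sigma.

Definition slice : {measure set T -> \bar R} := slice_fun mB.

End Slice.

Section Uniform.
Context (R : realType).

(** [uniform_prob] is taken on [measurableTypeR R]; the identity carries it to the measurable
    structure that [R] has in the rest of the proof. *)
Let idR (x : measurableTypeR R) : R := x.

Let measurable_idR : measurable_fun [set: measurableTypeR R] idR.
Proof. by move=> _ B mB; rewrite setTI. Qed.

Definition unif : probability R R :=
  law (uniform_prob (@ltr01 R) : probability (measurableTypeR R) R) measurable_idR.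

Lemma unifE A : unif A = uniform_prob (@ltr01 R) A.
Proof. by []. Qed.

Lemma unif_itv (a l : R) : (0 <= a)%R -> (0 <= l)%R -> (a + l <= 1)%R ->
  unif [set x | a <= x < a + l]%R = l%:E.
Proof.
move=> a0 l0 al; rewrite unifE /uniform_prob.
rewrite (_ : [set x | _] = `[a, (a + l)%R[%classic); last first.
  by apply/seteqP; split => x /=; rewrite in_itv.
rewrite (eq_integral (cst 1)); last first.
  move=> x; rewrite inE /= in_itv /= => /andP[ax xal].
  rewrite /uniform_pdf (le_trans a0 ax)/= (ltW (lt_le_trans xal al)) subr0.
  by rewrite invr1.
rewrite integral_cst// mul1e; apply: (etrans (lebesgue_measure_itv _)).
rewrite /= lte_fin ltrDl.
case: ltP => l0'; first by rewrite -EFinD addrAC subrr add0r.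
by apply/eqP; rewrite eq_le lee_fin l0 lee_fin l0'.
Qed.

End Uniform.

(** * A variable with a prescribed joint law, built from an independent uniform variable *)

Section Transfer.
Context (R : realType) (D : option nat) dV (V : measurableType dV).
Variable lam : probability (V * state R D)%type R.

(* A word lists the values of the first events [bit j], latest first. *)
Fixpoint word_set (b : seq bool) : set (state R D) :=
  if b is c :: b' then
    word_set b' `&` (if c then bit (size b') else ~` bit (size b'))
  else setT.

Lemma measurable_word_set b : measurable (word_set b).
Proof.
elim: b => [|c b mb] //=; apply: measurableI => //.
by case: c; [|apply: measurableC]; exact: measurable_bit.
Qed.

Let rho : probability V R := law lam measurable_fst.

Let rhoE A : rho A = lam (A `*` setT).
Proof. by rewrite /rho lawE; congr (lam _); apply/seteqP; split=> -[x y] //= []. Qed.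

Let slice_le b c A : measurable A ->
  slice lam (measurable_word_set (c :: b)) A <= slice lam (measurable_word_set b) A.
Proof.
move=> mA; apply: prob_le; [exact: measurableX (measurable_word_set _)..|].
by move=> [x y] [/= ? []].
Qed.

Let slice_le_rho b A : measurable A -> slice lam (measurable_word_set b) A <= rho A.
Proof.
move=> mA; rewrite rhoE; apply: prob_le.
- exact: measurableX (measurable_word_set _).
- exact: measurableX.
- by move=> [x y] [].
Qed.

Let good b (L : V -> R) := [/\ measurable_fun [set: V] L, forall v, (0 <= L v)%R &
  forall A, measurable A ->
    lam (A `*` word_set b) = \int[rho]_(v in A) (L v)%:E].

(** The new density is bounded by the old one everywhere, not just almost everywhere, so that the
    interval of a word contains those of its extensions for every [v]. *)
Let good_true b L : good b L -> exists L', good (true :: b) L' /\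
  forall v, (L' v <= L v)%R.
Proof.
move=> [mL L0 LE].
have sL A : measurable A -> slice lam (measurable_word_set (true :: b)) A <=
    \int[rho]_(x in A) (L x)%:E.
  by move=> mA; rewrite -LE//; exact: slice_le.
have [f [mf fL fE]] := @density_dominated _ _ _ rho
  (slice lam (measurable_word_set (true :: b))) L mL L0 (@slice_le_rho _) sL.
by exists f; split; [split => // v|move=> v]; case/andP: (fL v).
Qed.

Let good_false b L L' : good b L -> good (true :: b) L' ->
  (forall v, (L' v <= L v)%R) -> good (false :: b) (fun v => L v - L' v)%R.
Proof.
move=> [mL L0 LE] [mL' L'0 LE'] L'L; split.
- exact: measurable_funB.
- by move=> v; rewrite subr_ge0.
move=> A mA.
have mX c : measurable (A `*` word_set (c :: b)).
  exact: measurableX (measurable_word_set _).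
have mXb : measurable (A `*` word_set b) by exact: measurableX (measurable_word_set _).
have split : lam (A `*` word_set b) =
    lam (A `*` word_set (false :: b)) + lam (A `*` word_set (true :: b)).
  rewrite (prob_DI lam mXb (mX true)); congr (lam _ + lam _).
    apply/seteqP; split => -[x y] /=; first by move=> [[? ?] nX]; split => //; split => // By; exact: nX.
    by move=> [? [? ?]]; split => // -[_ []].
  by apply/seteqP; split => -[x y] /=; tauto.
have : \int[rho]_(v in A) (L v)%:E = \int[rho]_(v in A) (L v - L' v)%:E +
    \int[rho]_(v in A) (L' v)%:E.
  rewrite -ge0_integralD//.
  - by apply: eq_integral => v _; rewrite -EFinD subrK.
  - by move=> v _; rewrite lee_fin subr_ge0.
  - by apply/measurable_EFinP/measurable_funTS; exact: measurable_funB.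
  - by move=> v _; rewrite lee_fin.
  - by apply/measurable_EFinP/measurable_funTS.
rewrite -LE// -LE'// split => /(congr1 (fun z => z - lam (A `*` word_set (true :: b)))).
by rewrite !addeK ?prob_fin.
Qed.

(** The default value [L] is never taken on the densities in use, by [word_len_good]; it only makes
    the recursion total. *)
Let step b (L : V -> R) : V -> R :=
  if pselect (good b L) is left h then sval (cid (good_true h)) else L.

(* [ [word_lo b v, word_lo b v + word_len b v[ ] is the interval of values of the
   uniform variable that are sent to the word [b] when [W = v]; its length is the
   conditional probability of that word. *)
Fixpoint word_len (b : seq bool) : V -> R :=
  match b with
  | [::] => cst 1%R
  | true :: b' => step b' (word_len b')
  | false :: b' => (fun v => word_len b' v - step b' (word_len b') v)%R
  end.

Fixpoint word_lo (b : seq bool) : V -> R :=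
  match b with
  | [::] => cst 0%R
  | true :: b' => word_lo b'
  | false :: b' => (fun v => word_lo b' v + word_len (true :: b') v)%R
  end.

Let word_len_good b : good b (word_len b).
Proof.
elim: b => [|c b gb].
  split => //= A mA; rewrite integral_cst//= mul1e rhoE.
  by [].
have [gt tle] : good (true :: b) (step b (word_len b)) /\
    forall v, (step b (word_len b) v <= word_len b v)%R.
  by rewrite /step; case: pselect => // h; case: (cid _).
by case: c => //=; exact: good_false.
Qed.

Let word_len_le b v : (word_len (true :: b) v <= word_len b v)%R.
Proof.
rewrite /= /step; case: pselect => [h|]; last first.
  by move=> /(_ (word_len_good b)).
by case: (cid _) => f [_ fle] /=; exact: fle.
Qed.

Let word_lo_meas b : measurable_fun [set: V] (word_lo b).
Proof.
elim: b => [|[] b mb] //=; apply: measurable_funD => //.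
by have [] := word_len_good (true :: b).
Qed.

Fixpoint path_of (v : V) (x : R) (n : nat) : seq bool :=
  if n is n'.+1 then
    let b := path_of v x n' in
    (x < word_lo b v + word_len (true :: b) v)%R :: b
  else [::].

(** Adding a letter cuts the interval of a word in two, [true] on the left, so for each length
    exactly one word has [x] in its interval, and [path_of] finds it. *)
Let path_ofP v x b : (0 <= x < 1)%R -> path_of v x (size b) = b <->
  (word_lo b v <= x < word_lo b v + word_len b v)%R.
Proof.
move=> x01; elim: b => [|c b IH] /=.
  by rewrite add0r; split.
have l0 := (let: And3 _ h _ := word_len_good (true :: b) in h v).
have ll := @word_len_le b v; rewrite /= in l0 ll.
split.
  move=> [cE bE]; move/IH: (bE); rewrite bE in cE => /andP[h1 h2].
  case: c cE => /= [h|/negbT]; first by rewrite h1 h.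
  by rewrite -leNgt => h; rewrite h/= -addrA [X in (_ + X)%R]addrC subrK.
move=> h.
have bE : path_of v x (size b) = b.
  apply/IH; case: c h => /= /andP[h1 h2].
    by rewrite h1/= (lt_le_trans h2)// lerD2l.
  rewrite (le_trans _ h1) ?lerDl//=.
  by rewrite -addrA [X in (_ + X)%R]addrC subrK in h2.
rewrite bE; congr (_ :: _).
by case: c h => /= /andP[h1 h2] //; rewrite ltNge h1.
Qed.

Let word_lo_bound b v : (0 <= word_lo b v)%R /\
  (word_lo b v + word_len b v <= 1)%R.
Proof.
elim: b => [|c b [lo hi]]; first by rewrite /= add0r.
have l0 := (let: And3 _ h _ := word_len_good (true :: b) in h v).
have ll := @word_len_le b v; rewrite /= in l0 ll.
case: c => /=; first by split => //; apply: le_trans hi; rewrite lerD2l.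
by split; [exact: addr_ge0|rewrite -addrA [X in (_ + X)%R]addrC subrK].
Qed.

Context dT (T : measurableType dT) (P : probability T R) (W : T -> V) (U : T -> R).
Hypotheses (mW : measurable_fun [set: T] W) (mU : measurable_fun [set: T] U).
Hypothesis WU : forall A B, measurable A -> measurable B ->
  P (W @^-1` A `&` U @^-1` B) = lam (A `*` setT) * unif R B.

Let mWU : measurable_fun [set: T] (fun w => (W w, U w)).
Proof. exact: measurable_fun_pair. Qed.

Let lawWU A : measurable A -> P ((fun w => (W w, U w)) @^-1` A) =
  (rho \x unif R) A.
Proof.
move=> mA; rewrite -lawE; apply: prob_eq_prod => //.
  by apply: (le_lt_trans (probability_le1 _ _)) => //; exact: ltry.
move=> B C mB mC; apply: (etrans _ (esym (product_measure1E rho (unif R) mB mC))).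
apply: (etrans _ (congr1 (fun z => z * unif R C) (esym (rhoE B)))).
by rewrite -WU.
Qed.

Let word_ev (b : seq bool) : set (V * R) :=
  [set z | word_lo b z.1 <= z.2 < word_lo b z.1 + word_len b z.1]%R.

Let m_word_ev b : measurable (word_ev b).
Proof.
have mlo : measurable_fun [set: V * R] (fun z => word_lo b z.1).
  by apply: measurableT_comp => //; exact: word_lo_meas.
have mlen : measurable_fun [set: V * R] (fun z => word_len b z.1).
  apply: measurableT_comp => //.
  by have [] := word_len_good b.
rewrite (_ : word_ev b = ([set: V * R] `&` [set z | word_lo b z.1 <= z.2]%R) `&`
   ([set: V * R] `&` [set z | z.2 < word_lo b z.1 + word_len b z.1]%R)).
  apply: measurableI.
    by apply: measurable_fun_ler => //; exact: measurable_snd.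
  by apply: measurable_fun_ltr => //; exact: measurable_funD.
rewrite !setTI; apply/seteqP; split => z /=; first by move=> /andP[].
by move=> [h1 h2]; rewrite /word_ev /= h1 h2.
Qed.

(** By Fubini: for fixed [v] the section of [word_ev b] is an interval of length [word_len b v], and
    this length is the density of the part of [lam] lying over the word. *)
Let P_word_ev A b : measurable A ->
  P ((fun w => (W w, U w)) @^-1` ((A `*` setT) `&` word_ev b)) =
  lam (A `*` word_set b).
Proof.
move=> mA; have [mL L0 ->//] := word_len_good b.
rewrite lawWU; last by apply: measurableI => //; exact: measurableX.
rewrite /product_measure1 /= [RHS]integral_mkcond; apply: eq_integral => v _.
rewrite patchE; case: ifPn => vA.
  rewrite -(@unif_itv R (word_lo b v) (word_len b v))//; last 2 first.
  - by have [] := word_lo_bound b v.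
  - by have [] := word_lo_bound b v.
  congr (unif R _); apply/seteqP; split => x; rewrite /xsection /= inE /=.
    by move=> [].
  by move=> h; split => //; split => //; rewrite -in_setE.
rewrite (_ : xsection _ _ = set0) ?measure0//.
apply/seteqP; split => // x; rewrite /xsection /= inE /= => -[[Av _] _].
by move: vA; rewrite notin_setE.
Qed.

Let U01 : P [set w | ~ (0 <= U w < 1)%R] = 0.
Proof.
have m01 : measurable [set x : R | 0 <= x < 1]%R.
  have -> : [set x : R | 0 <= x < 1]%R = `[0%R, 1%R[%classic.
    by apply/seteqP; split => x /=; rewrite in_itv.
  exact: measurable_itv.
have := @WU setT [set x : R | 0 <= x < 1]%R measurableT m01.
have := @unif_itv R 0 1 (lexx _) ler01.
rewrite add0r lexx => /(_ isT) ->; rewrite setXTT probability_setT mule1 setTI => h.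
rewrite (_ : [set w | _] = ~` (U @^-1` [set x : R | 0 <= x < 1]%R)) //.
rewrite probability_setC; last by rewrite -[X in measurable X]setTI; exact: mU.
by rewrite h subee.
Qed.

Let pth w n := path_of (W w) (U w) n.

Let m_pth n b : measurable [set w | pth w n = b].
Proof.
elim: n b => [|n IH] [|c b].
- by rewrite (_ : [set w | _] = setT) //; apply/seteqP; split.
- by rewrite (_ : [set w | _] = set0) //; apply/seteqP; split.
- by rewrite (_ : [set w | _] = set0) //; apply/seteqP; split.
have mh : measurable [set w | (U w < word_lo b (W w) + word_len (true :: b) (W w))%R = c].
  have mt : measurable [set w | U w < word_lo b (W w) + word_len (true :: b) (W w)]%R.
    rewrite -[X in measurable X]setTI; apply: measurable_fun_ltr => //.
    apply: measurable_funD.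
      exact: measurableT_comp (word_lo_meas b) mW.
    apply: (measurableT_comp _ mW); by have [] := word_len_good (true :: b).
  case: c.
    by rewrite (_ : [set w | _] = [set w | U w < word_lo b (W w) + word_len (true :: b) (W w)]%R).
  rewrite (_ : [set w | _] = ~` [set w | U w < word_lo b (W w) + word_len (true :: b) (W w)]%R).
    exact: measurableC.
  by apply/seteqP; split => w /=; [move=> ->|move/negP/negbTE].
rewrite (_ : [set w | _] = [set w | pth w n = b] `&`
   [set w | (U w < word_lo b (W w) + word_len (true :: b) (W w))%R = c]).
  exact: measurableI.
apply/seteqP; split => w /=; rewrite /pth /=.
  by move=> [<- ->].
by move=> [-> ->].
Qed.

Let P_pth A b : measurable A ->
  P (W @^-1` A `&` [set w | pth w (size b) = b]) = lam (A `*` word_set b).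
Proof.
move=> mA; rewrite -P_word_ev//.
have mWA : measurable (W @^-1` A) by rewrite -[X in measurable X]setTI; exact: mW.
have me : measurable ((fun w => (W w, U w)) @^-1` ((A `*` setT) `&` word_ev b)).
  rewrite -[X in measurable X]setTI; apply: mWU => //.
  by apply: measurableI => //; exact: measurableX.
have mN : measurable [set w | ~ (0 <= U w < 1)%R].
  rewrite (_ : [set w | _] = ~` ([set: T] `&` U @^-1` `[0%R, 1%R[%classic)).
    by apply: measurableC; exact: mU.
  by apply/seteqP; split => w /=; rewrite in_itv/=; tauto.
apply: prob_eq0D => //; first exact: measurableI.
- apply: nullS U01 => //.
    by apply: measurableD => //; exact: measurableI.
  by move=> w [[/= Aw /= bw] nb] U1; apply: nb; split => //; exact/path_ofP.
- apply: nullS U01 => //.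
    by apply: measurableD => //; exact: measurableI.
  by move=> w [[[/= Aw _] /= bw] nb] U1; apply: nb; split => //; exact/path_ofP.
Qed.

Let ev j : set T := [set w | head false (pth w j.+1)].

Let evE w m b : pth w m = b -> pth w m.+1 = `[< ev m w >] :: b.
Proof.
move=> h; rewrite /pth/= -/(pth w m) h; congr (_ :: _).
by rewrite /ev /pth /= -/(pth w m) h; apply/idP/asboolP.
Qed.

Let m_ev j : measurable (ev j).
Proof.
rewrite (_ : ev j =
  \bigcup_b (if head false b then [set w | pth w j.+1 = b] else set0)).
  apply: countable_bigcupT_measurable => [|b]; first exact: countableP.
  by case: ifP.
apply/seteqP; split => w /=.
  by rewrite /ev => h; exists (pth w j.+1) => //; rewrite h.
by move=> [b _]; case: ifP => // hb bE; rewrite -bE in hb; exact: hb.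
Qed.

Let tail_ev m n (s : pred nat) : set T :=
  [set w | forall i, (m <= i < n)%N -> s i -> ev i w].

Let tail_bit m n (s : pred nat) : set (state R D) :=
  [set y | forall i, (m <= i < n)%N -> s i -> bit i y].

Let m_tail_ev m n s : measurable (tail_ev m n s).
Proof.
rewrite (_ : tail_ev m n s =
    \bigcap_i (if (m <= i < n)%N && s i then ev i else setT)).
  by apply: bigcapT_measurable => i; case: ifP => // _; exact: m_ev.
apply/seteqP; split=> y ys i.
  by move=> _; case: ifP => // /andP[]; exact: ys.
by move=> ni si; have := ys i I; rewrite ni si.
Qed.

Let m_tail_bit m n s : measurable (tail_bit m n s).
Proof.
rewrite (_ : tail_bit m n s =
    \bigcap_i (if (m <= i < n)%N && s i then bit i else setT)).
  apply: bigcapT_measurable => i; case: ifP => // _; exact: measurable_bit.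
apply/seteqP; split=> y ys i.
  by move=> _; case: ifP => // /andP[]; exact: ys.
by move=> ni si; have := ys i I; rewrite ni si.
Qed.

Let tail_evS m n s : (m < n)%N ->
  tail_ev m n s = [set w | s m -> ev m w] `&` tail_ev m.+1 n s.
Proof.
move=> mn; apply/seteqP; split => w.
  by move=> h; split=> [sm|i /andP[mi ni]]; apply: h; rewrite ?leqnn ?mn ?ni ?(ltnW mi).
move=> [h1 h2] i /andP[+ ni] si; rewrite leq_eqVlt => /orP[/eqP mi|mi].
  by subst i; exact: h1.
by apply: h2 => //; rewrite mi.
Qed.

Let tail_bitS m n s : (m < n)%N ->
  tail_bit m n s = [set w | s m -> bit m w] `&` tail_bit m.+1 n s.
Proof.
move=> mn; apply/seteqP; split => w.
  by move=> h; split=> [sm|i /andP[mi ni]]; apply: h; rewrite ?leqnn ?mn ?ni ?(ltnW mi).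
move=> [h1 h2] i /andP[+ ni] si; rewrite leq_eqVlt => /orP[/eqP mi|mi].
  by subst i; exact: h1.
by apply: h2 => //; rewrite mi.
Qed.

(** Induction on the number [k] of letters still to be read: a constrained letter is prefixed as
    [true], a free one is split according to its two values. This passes from exact words to events
    that constrain only some bits. *)
Let P_tail A n s b k : measurable A -> (size b + k)%N = n ->
  P (W @^-1` A `&` ([set w | pth w (size b) = b] `&` tail_ev (size b) n s)) =
  lam (A `*` (word_set b `&` tail_bit (size b) n s)).
Proof.
move=> mA.
have mWA : measurable (W @^-1` A) by rewrite -[X in measurable X]setTI; exact: mW.
elim: k b => [|k IH] b bn.
  rewrite (_ : tail_ev _ _ _ = setT); last first.
    by apply/seteqP; split=> // w _ i /andP[bi ni]; move: ni; rewrite -bn addn0 ltnNge bi.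
  rewrite (_ : tail_bit _ _ _ = setT); last first.
    by apply/seteqP; split=> // w _ i /andP[bi ni]; move: ni; rewrite -bn addn0 ltnNge bi.
  by rewrite !setIT P_pth.
have bn' : (size b < n)%N by rewrite -bn -addSnnS leq_addr.
have IHc c : P (W @^-1` A `&` ([set w | pth w (size b).+1 = c :: b] `&`
      tail_ev (size b).+1 n s)) =
    lam (A `*` (word_set (c :: b) `&` tail_bit (size b).+1 n s)).
  by apply: (IH (c :: b)); rewrite /= addSnnS.
have pE c : [set w | pth w (size b).+1 = c :: b] =
    [set w | pth w (size b) = b] `&` (if c then ev (size b) else ~` ev (size b)).
  apply/seteqP; split => w /=.
    move=> h; have hb : pth w (size b) = b by move: h => [].
    split => //; move: h; rewrite (evE hb) => -[<-].
    by case: asboolP.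
  move=> [hb]; rewrite (evE hb); case: c => h; congr (_ :: _); first exact/asboolP.
  exact/negbTE/asboolPn.
rewrite tail_evS// tail_bitS//.
have [sm|sm] := boolP (s (size b)).
  rewrite (_ : [set w | _ -> ev _ w] = ev (size b)); last first.
    by apply/seteqP; split => w /=; [exact|].
  rewrite (_ : [set w | _ -> bit _ w] = bit (size b)); last first.
    by apply/seteqP; split => w /=; [exact|].
  by have := IHc true; rewrite pE /= !setIA.
rewrite (_ : [set w | _ -> ev _ w] = setT) ?setTI; last first.
  by apply/seteqP; split => w.
rewrite (_ : [set w | _ -> bit _ w] = setT) ?setTI; last first.
  by apply/seteqP; split => w.
have mX B : measurable B -> measurable (A `*` B) by move=> mB; exact: measurableX.
have mw := measurable_word_set b.
have mbit := @measurable_bit R D (size b).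
rewrite (@prob_DI _ _ _ P _ (ev (size b)))//; last first.
  by do !apply: measurableI => //.
rewrite (@prob_DI _ _ _ lam _ (setT `*` bit (size b)))//; last 2 first.
- by apply: mX; exact: measurableI.
- exact: measurableX.
congr (_ + _).
  have := IHc false; rewrite pE /= => E.
  transitivity (P (W @^-1` A `&` ([set w | pth w (size b) = b] `&`
      ~` ev (size b) `&` tail_ev (size b).+1 n s))).
    by congr (P _); apply/seteqP; split => w /=; tauto.
  rewrite E; congr (lam _); apply/seteqP; split => -[x y] /=; last by tauto.
  by move=> [? [[? nb] ?]]; split => // -[].
have := IHc true; rewrite pE /= => E.
transitivity (P (W @^-1` A `&` ([set w | pth w (size b) = b] `&`
    ev (size b) `&` tail_ev (size b).+1 n s))).
  by congr (P _); apply/seteqP; split => w /=; tauto.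
by rewrite E; congr (lam _); apply/seteqP; split => -[x y] /=; tauto.
Qed.

Let P_bits A n (s : pred nat) : measurable A ->
  P (W @^-1` A `&` [set w | forall i, (i < n)%N -> s i -> ev i w]) =
  lam (A `*` @bits_inter R D n s).
Proof.
move=> mA; have := @P_tail A n s [::] n mA erefl; rewrite /= setTI => <-.
by congr (P _); apply/seteqP; split => w [? h]; split => //; exact: h.2.
Qed.

Let P_ev1 j : P (ev j) = lam (setT `*` bit j).
Proof.
have := @P_bits setT j.+1 (pred1 j) measurableT; rewrite preimage_setT setTI => E.
transitivity (P [set w | forall i : nat, (i < j.+1)%N -> pred1 j i -> ev i w]).
  congr (P _); apply/seteqP; split => w /=; first by move=> h i _ /eqP ->.
  by apply => //=.
rewrite E; congr (lam _); apply/seteqP; split => -[x y] /= [_ h]; split => //.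
  by apply: h => /=.
by move=> i _ /eqP ->.
Qed.

Let P_ev2 j j' : P (ev j `&` ev j') = lam (setT `*` (bit j `&` bit j')).
Proof.
have := @P_bits setT (maxn j j').+1 (pred2 j j') measurableT.
rewrite preimage_setT setTI => E.
transitivity (P [set w | forall i : nat, (i < (maxn j j').+1)%N -> pred2 j j' i -> ev i w]).
  congr (P _); apply/seteqP; split => w /=; first by move=> [h h'] i _ /orP[] /eqP ->.
  by move=> h; split; apply: h => /=; rewrite ?eqxx ?orbT// ltnS ?leq_maxl ?leq_maxr.
rewrite E; congr (lam _); apply/seteqP; split => -[x y] /= [_ h]; split => //.
  by split; apply: h => /=; rewrite ?eqxx ?orbT// ltnS ?leq_maxl ?leq_maxr.
by move: h => [h h'] i _ /orP[] /eqP ->.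
Qed.

(** Jointly with [W], the events [ev j] have the law that the sets [bit j] have under [lam].
    [realize_events] turns them into a variable, and agreement on finite intersections of rays
    extends to all measurable sets. *)
Theorem transfer : exists Y : T -> state R D, measurable_fun [set: T] Y /\
  forall A B, measurable A -> measurable B ->
    P (W @^-1` A `&` Y @^-1` B) = lam (A `*` B).
Proof.
pose mu : probability (state R D) R := law lam measurable_snd.
have muE B : mu B = lam (setT `*` B).
  by rewrite lawE; congr (lam _); apply/seteqP; split => -[x y] //= [].
pose E (k : coord D) q := ev (bit_num k q).
have [|||Y [mY YE]] := @realize_events R D _ T P mu E.
- by move=> k q; exact: m_ev.
- by move=> k q; rewrite muE P_ev1 bit_numE.
- move=> k q q' qq'; rewrite /E prob_D; [|exact: m_ev..].
  rewrite P_ev2 P_ev1 !bit_numE (_ : _ `&` _ = ray k q) ?subee//.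
    by apply: prob_fin; apply: measurableX => //; exact: measurable_ray.
  by apply/setIidPl => y /= /le_trans; apply; rewrite ler_rat.
exists Y; split => // A B mA mB.
have mWA : measurable (W @^-1` A) by rewrite -[X in measurable X]setTI; exact: mW.
have mYB C : measurable C -> measurable (Y @^-1` C).
  by move=> mC; rewrite -[X in measurable X]setTI; exact: mY.
have Ybit j : P (Y @^-1` bit j `\` ev j) = 0 /\ P (ev j `\` Y @^-1` bit j) = 0.
  have [jT|[k [q jE]]] := @bitP R D j.
    have Pj : P (ev j) = 1.
      by rewrite P_ev1 jT setXTT probability_setT.
    rewrite jT preimage_setT setTD setDT measure0; split => //.
    rewrite probability_setC ?Pj ?subee//; exact: m_ev.
  (* The index [j] need not be the canonical index of its ray. Events of two indices with the same
     ray agree up to a null set, because their joint law is that of the ray with itself. *)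
  have Pj : P (ev j `\` ev (bit_num k q)) = 0 /\ P (ev (bit_num k q) `\` ev j) = 0.
    rewrite !prob_D; try exact: m_ev.
    by rewrite !P_ev2 !P_ev1 jE bit_numE setIid subee// prob_fin//; apply: measurableX => //; exact: measurable_ray.
  have [Y1 Y2] := YE k q; rewrite jE.
  have mr : measurable (Y @^-1` ray k q) by apply: mYB; exact: measurable_ray.
  have mj i : measurable (ev i) by exact: m_ev.
  split.
    apply: (@nullS _ _ _ P _ ((Y @^-1` ray k q `\` E k q) `|` (ev (bit_num k q) `\` ev j))).
    - exact: measurableD.
    - by apply: measurableU; apply: measurableD => //; exact: mj.
    - move=> w [Yw nj]; have [h|h] := pselect (E k q w); first by right.
      by left.
    - by apply: nullU => //; [apply: measurableD => //; exact: mj..|case: Pj].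
  apply: (@nullS _ _ _ P _ ((E k q `\` Y @^-1` ray k q) `|` (ev j `\` ev (bit_num k q)))).
  - exact: measurableD.
  - by apply: measurableU; apply: measurableD => //; exact: mj.
  - move=> w [Yw nj]; have [h|h] := pselect (E k q w); first by left.
    by right.
  - by apply: nullU => //; [apply: measurableD => //; exact: mj..|case: Pj].
(* [slice] fixes the second factor, so the pairs are swapped in order to fix [A] and let the set of
   states vary. *)
pose swp (z : V * state R D) := (z.2, z.1).
have mswp : measurable_fun [set: V * state R D] swp.
  by apply: measurable_fun_pair; [exact: measurable_snd|exact: measurable_fst].
have mYW : measurable_fun [set: T] (fun w => (Y w, W w)) by exact: measurable_fun_pair.
pose m1 := slice (law P mYW) mA.
pose m2 := slice (law lam mswp) mA.
have m1E C : m1 C = P (W @^-1` A `&` Y @^-1` C).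
  rewrite /m1 /= /slice_fun lawE; congr (P _).
  by apply/seteqP; split => w /= [].
have m2E C : m2 C = lam (A `*` C).
  rewrite /m2 /= /slice_fun lawE; congr (lam _).
  by apply/seteqP; split => -[v y] /= [].
have m12 C : bits_sys C -> m1 C = m2 C.
  move=> [n [s ->]]; rewrite m1E m2E -P_bits//.
  have mbi := @measurable_bits_inter R D n s.
  have mevs : measurable [set w | forall i, (i < n)%N -> s i -> ev i w].
    have -> : [set w | forall i, (i < n)%N -> s i -> ev i w] = tail_ev 0 n s by [].
    exact: m_tail_ev.
  have mbad i : measurable ((Y @^-1` bit i `\` ev i) `|` (ev i `\` Y @^-1` bit i)).
    apply: measurableU; apply: measurableD; try exact: m_ev;
    by apply: mYB; exact: measurable_bit.
  have bad0 : P (\bigcup_i ((Y @^-1` bit i `\` ev i) `|` (ev i `\` Y @^-1` bit i))) = 0.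
    apply: null_bigcup => // i; have [Y1 Y2] := Ybit i.
    apply: nullU => //; apply: measurableD; try exact: m_ev;
    by apply: mYB; exact: measurable_bit.
  apply: prob_eq0D.
  - by apply: measurableI => //; exact: mYB.
  - exact: measurableI.
  - apply: nullS bad0.
    + by apply: measurableD; apply: measurableI => //; exact: mYB.
    + exact: bigcupT_measurable.
    + move=> w [[Aw Yw] nev]; have : ~ (forall i, (i < n)%N -> s i -> ev i w).
        by move=> h; apply: nev.
      move=> /existsNP[i] /not_implyP[ni] /not_implyP[si nevi].
      by exists i => //; left; split => //; exact: Yw.
  - apply: nullS bad0.
    + by apply: measurableD; apply: measurableI => //; exact: mYB.
    + exact: bigcupT_measurable.
    + move=> w [[Aw Ew] nY]; have : ~ bits_inter n s (Y w).
        by move=> h; apply: nY.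
      move=> /existsNP[i] /not_implyP[ni] /not_implyP[si nevi].
      by exists i => //; right; split => //; exact: Ew.
rewrite -m1E -m2E; apply: (prob_eq (@bits_sys_gen R D) (@bits_sysI R D)) => //.
  apply: m12; exists 0%N, pred0; by apply/seteqP; split.
by rewrite m1E preimage_setT setIT; exact: prob_lty.
Qed.

End Transfer.

Local Close Scope ereal_scope.

(** * Independence *)

Local Open Scope ereal_scope.

Section PiIndep.
Context d (T : measurableType d) (R : realType) (P : probability T R).

(** As functions of [A] both sides are finite measures: slices at [C] of the law of [(w, w)] and of
    a product measure. Agreement on [G] therefore extends to the generated sigma-algebra. *)
Lemma indep_pi (G : set (set T)) (C : set T) : setI_closed G ->
  G `<=` measurable -> measurable C ->
  (forall A, G A -> P (A `&` C) = P A * P C) ->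
  forall A, <<s G >> A -> P (A `&` C) = P A * P C.
Proof.
move=> GI Gm mC PG A sA.
have sG : sigma_algebra setT <<s G >> by exact: smallest_sigma_algebra.
have sGm : <<s G >> `<=` measurable.
  by apply: smallest_sub => //; exact: sigma_algebra_measurable.
have mid : measurable_fun [set: T] (id : T -> g_sigma_algebraType G).
  by move=> _ B mB; rewrite setTI; exact: sGm.
have mdiag : measurable_fun [set: T] (fun w => (w : g_sigma_algebraType G, w)).
  by apply: measurable_fun_pair.
pose m1 := slice (law P mdiag) mC.
pose m2 := slice (law P mid \x P) mC.
have m1E B : m1 B = P (B `&` C) by [].
have m2E B : measurable B -> m2 B = P B * P C.
  by move=> mB; exact: (product_measure1E (law P mid) P mB mC).
have mA : measurable (A : set (g_sigma_algebraType G)) by [].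
rewrite -m1E -m2E//; apply: (@prob_eq _ (g_sigma_algebraType G) R G) => //.
- rewrite m2E ?m1E ?setTI; last exact: measurableT.
  by rewrite probability_setT mul1e.
- by rewrite m1E setTI; exact: prob_lty.
- by move=> B GB; rewrite m1E m2E ?PG//; exact: sub_sigma_algebra.
Qed.

End PiIndep.

Section Blocks.
Context d (T : measurableType d) (R : realType) (P : probability T R).
Context (I : choiceType) (Vd : I -> measure_display)
  (V : forall i, measurableType (Vd i)) (xi : forall i, T -> V i) (p : pred I).
Hypothesis mxi : forall i, p i -> measurable_fun [set: T] (xi i).
Hypothesis indep : forall (s : seq I) (B : forall i, set (V i)),
  uniq s -> all p s -> (forall i, measurable (B i)) ->
  P (\big[setI/setT]_(i <- s) (xi i @^-1` B i)) =
  \prod_(i <- s) P (xi i @^-1` B i).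

Definition sig_family (J : set I) : set (set T) :=
  <<s \bigcup_(i in J) preimage_set_system setT (xi i) measurable >>.

Definition cylinders (J : set I) : set (set T) :=
  [set C | exists (s : seq I) (B : forall i, set (V i)),
    [/\ uniq s, forall i, i \in s -> J i, forall i, measurable (B i) &
        C = \big[setI/setT]_(i <- s) (xi i @^-1` B i)]].

Lemma cylinders_sub (J : set I) : cylinders J `<=` sig_family J.
Proof.
move=> _ [s [B [_ sJ mB ->]]]; rewrite big_seq_cond.
apply: big_ind => [| |i].
- exact: (@measurableT _ (g_sigma_algebraType _)).
- exact: (@measurableI _ (g_sigma_algebraType _)).
- rewrite andbT => /sJ Ji; apply: sub_sigma_algebra; exists i => //.
  by exists (B i) => //; rewrite setTI.
Qed.

Lemma cylinder1 (J : set I) i B : J i -> measurable B -> cylinders J (xi i @^-1` B).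
Proof.
move=> Ji mB; exists [:: i].
(* The value spaces depend on the index, so [B] is transported along [i = j]; the other coordinates
   are left free. *)
exists (fun j => if pselect (i = j) is left e then eq_rect i (fun k => set (V k)) B j e else setT).
split => //.
- by move=> j; rewrite inE => /eqP ->.
- by move=> j; case: pselect => // e; subst j.
rewrite big_seq1; case: pselect => // e.
by rewrite (Prop_irrelevance e erefl).
Qed.

Lemma sig_family_gen (J : set I) : sig_family J = <<s cylinders J >>.
Proof.
apply/seteqP; split.
  apply: smallest_sub; first exact: smallest_sigma_algebra.
  move=> _ [i Ji [B mB <-]]; rewrite setTI.
  by apply: sub_sigma_algebra; exact: cylinder1.
by apply: smallest_sub; [exact: smallest_sigma_algebra|exact: cylinders_sub].
Qed.

Lemma big_setI_mem (s : seq I) (F : I -> set T) w :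
  (\big[setI/setT]_(i <- s) F i) w <-> (forall i, i \in s -> F i w).
Proof.
elim: s => [|j s IH]; first by rewrite big_nil.
rewrite big_cons; split.
  by move=> [Fj /IH h] i; rewrite inE => /orP[/eqP ->//|]; exact: h.
move=> h; split; first by apply: h; rewrite inE eqxx.
by apply/IH => i si; apply: h; rewrite inE si orbT.
Qed.

Lemma cylindersI (J : set I) : setI_closed (cylinders J).
Proof.
move=> _ _ [s [B [us sJ mB ->]]] [s' [B' [us' sJ' mB' ->]]].
exists (undup (s ++ s')), (fun i => (if i \in s then B i else setT) `&`
                          (if i \in s' then B' i else setT)); split.
- exact: undup_uniq.
- by move=> i; rewrite mem_undup mem_cat => /orP[/sJ|/sJ'].
- by move=> i; apply: measurableI; case: ifP.
apply/seteqP; split => w.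
  move=> [/big_setI_mem h /big_setI_mem h']; apply/big_setI_mem => i _ /=.
  by split; case: ifP => // si; [exact: h|exact: h'].
move=> /big_setI_mem h; split; apply/big_setI_mem => i si.
  have : i \in undup (s ++ s') by rewrite mem_undup mem_cat si.
  by move=> /h [] /=; rewrite si.
have : i \in undup (s ++ s') by rewrite mem_undup mem_cat si orbT.
by move=> /h [] /=; rewrite si.
Qed.

Lemma sig_family_meas (J : set I) : (forall i, J i -> p i) ->
  sig_family J `<=` measurable.
Proof.
move=> Jp; apply: smallest_sub; first exact: sigma_algebra_measurable.
by move=> _ [i Ji [B mB <-]]; apply: mxi => //; exact: Jp.
Qed.

(** On cylinders this is the product formula for the concatenated list of indices, without
    repetition since the blocks are disjoint. [indep_pi] then enlarges one side after the other. *)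
Lemma indep_blocks (J1 J2 : set I) : (forall i, J1 i -> p i) ->
  (forall i, J2 i -> p i) -> (forall i, J1 i -> J2 i -> False) ->
  forall A B, sig_family J1 A -> sig_family J2 B -> P (A `&` B) = P A * P B.
Proof.
move=> J1p J2p J12 A B A1 B2.
have m1 := sig_family_meas J1p; have m2 := sig_family_meas J2p.
have c1 : cylinders J1 `<=` measurable by move=> C /cylinders_sub/m1.
have c2 : cylinders J2 `<=` measurable by move=> C /cylinders_sub/m2.
apply: (indep_pi (@cylindersI J1)) => //; first exact: m2.
  move=> C1 C1J; rewrite setIC muleC.
  apply: (indep_pi (@cylindersI J2)) => //; first exact: c1.
    move=> _ [s2 [B2' [us2 sJ2 mB2 ->]]]; case: C1J => [s1 [B1 [us1 sJ1 mB1 ->]]].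
    have a1 : all p s1 by apply/allP => i /sJ1/J1p.
    have a2 : all p s2 by apply/allP => i /sJ2/J2p.
    have n12 i : i \in s2 -> (i \in s1) = false.
      by move=> i2; apply/negP => i1; exact: (J12 i (sJ1 _ i1) (sJ2 _ i2)).
    pose BB i := if i \in s1 then B1 i else B2' i.
    have := @indep (s1 ++ s2) BB; rewrite cat_uniq us1 us2 andbT/=.
    rewrite (_ : ~~ has _ _); last by apply/hasPn => i /n12 /= ->.
    rewrite !big_cat /= => /(_ isT) h.
    have E1 : \big[setI/setT]_(i <- s1) (xi i @^-1` BB i) = \big[setI/setT]_(i <- s1) (xi i @^-1` B1 i).
      by apply: eq_big_seq => i si; rewrite /BB si.
    have E2 : \big[setI/setT]_(i <- s2) (xi i @^-1` BB i) = \big[setI/setT]_(i <- s2) (xi i @^-1` B2' i).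
      by apply: eq_big_seq => i /n12 si; rewrite /BB si.
    have E3 : \prod_(i <- s1) P (xi i @^-1` BB i) = \prod_(i <- s1) P (xi i @^-1` B1 i).
      by apply: eq_big_seq => i si; rewrite /BB si.
    have E4 : \prod_(i <- s2) P (xi i @^-1` BB i) = \prod_(i <- s2) P (xi i @^-1` B2' i).
      by apply: eq_big_seq => i /n12 si; rewrite /BB si.
    rewrite setIC muleC (indep us1 a1 mB1) (indep us2 a2 mB2) -E3 -E4 -E1 -E2.
    apply: h; first by rewrite all_cat a1.
    by move=> i; rewrite /BB; case: ifP.
  by rewrite -sig_family_gen.
by rewrite -sig_family_gen.
Qed.

End Blocks.

(** * A sequence of independent uniform variables carried by a single one *)

Section Noise.
Context (R : realType).

(** Apply [transfer] with a trivial [W] in [unit] and, as target, the law of two independent uniform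
    variables regarded as a vector of dimension 2. *)
Lemma unif_split : exists s1 s2 : R -> R,
  [/\ measurable_fun [set: R] s1, measurable_fun [set: R] s2 &
    forall A B, measurable A -> measurable B ->
      unif R (s1 @^-1` A `&` s2 @^-1` B) = unif R A * unif R B].
Proof.
pose i0 : coord (Some 2%N) := (ord0 : 'I_2).
pose i1 : coord (Some 2%N) := (ord_max : 'I_2).
pose f (z : R * R) : unit * state R (Some 2%N) :=
  (tt, fun i : coord (Some 2%N) => if (i : 'I_2) == ord0 then z.1 else z.2).
have mf : measurable_fun [set: R * R] f.
  apply: measurable_fun_pair => //; apply: measurable_state => i.
  by case: eqP => _; [exact: measurable_fst|exact: measurable_snd].
have h1 : (unif R \x unif R) setT = 1.
  rewrite -setXTT; apply: (etrans (product_measure1E _ _ measurableT measurableT)).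
  by apply: (etrans (congr2 mule (probability_setT _) (probability_setT _))); rewrite mule1.
have h1' : (unif R \x unif R : {measure set _ -> \bar R}) setT = 1 by exact: h1.
pose lam : probability (unit * state R (Some 2%N))%type R := law (prob_of h1') mf.
have lamE A B : measurable A -> measurable B ->
    lam (setT `*` [set y | A (y i0) /\ B (y i1)]) = unif R A * unif R B.
  move=> mA mB; rewrite lawE.
  rewrite (_ : _ @^-1` _ = A `*` B); first exact: (product_measure1E _ _ mA mB).
  by apply/seteqP; split => -[x y] /=; [move=> [_ []]|].
have mid : measurable_fun [set: R] (id : R -> R) by [].
have mtt : measurable_fun [set: R] (fun _ : R => tt) by [].
have [|Y [mY YE]] := @transfer R (Some 2%N) _ unit lam _ R (unif R) _ _ mtt mid.
  move=> A B mA mB; have [->|[->|[->|->]]] : A = set0 \/ A = setT \/ A = setT \/ A = setT.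
  - have [Att|nAtt] := pselect (A tt); [right; left|left]; apply/seteqP; split => -[] //.
  - by rewrite preimage_set0 set0I set0X !measure0 mul0e.
  - by rewrite preimage_setT setTI setXTT probability_setT mul1e.
  - by rewrite preimage_setT setTI setXTT probability_setT mul1e.
  - by rewrite preimage_setT setTI setXTT probability_setT mul1e.
exists (fun x => Y x i0), (fun x => Y x i1); split.
- exact: (measurableT_comp (measurable_coord i0) mY).
- exact: (measurableT_comp (measurable_coord i1) mY).
move=> A B mA mB; rewrite -lamE//.
have mAB : measurable [set y : state R (Some 2%N) | A (y i0) /\ B (y i1)].
  rewrite (_ : [set y | _] = ([set: state R (Some 2%N)] `&` (fun y => y i0) @^-1` A) `&`
    ([set: state R (Some 2%N)] `&` (fun y => y i1) @^-1` B)).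
    by apply: measurableI; exact: measurable_coord.
  by rewrite !setTI.
by rewrite -YE// preimage_setT setTI.
Qed.

(** Iterate the splitting: at each round [s1] delivers a variable and [s2] a seed for the next
    round, so the n-th variable is [s1] after n applications of [s2]. *)
Lemma unif_iid : exists U : nat -> R -> R,
  (forall n, measurable_fun [set: R] (U n)) /\
  (forall n B, measurable B -> unif R (U n @^-1` B) = unif R B) /\
  (forall (s : seq nat) (B : nat -> set R), uniq s -> (forall i, measurable (B i)) ->
    unif R (\big[setI/setT]_(i <- s) (U i @^-1` B i)) =
    \prod_(i <- s) unif R (U i @^-1` B i)).
Proof.
have [s1 [s2 [ms1 ms2 s12]]] := unif_split.
have unif1 B : measurable B -> unif R (s1 @^-1` B) = unif R B.
  by move=> mB; have := s12 B setT mB measurableT; rewrite preimage_setT setIT probability_setT mule1.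
have unif2 B : measurable B -> unif R (s2 @^-1` B) = unif R B.
  by move=> mB; have := s12 setT B measurableT mB; rewrite preimage_setT setTI probability_setT mul1e.
pose r n := iter n s2.
have mr n : measurable_fun [set: R] (r n).
  elim: n => [|n IH]; first exact: measurable_id.
  exact: (measurableT_comp ms2 IH).
have unifr n B : measurable B -> unif R (r n @^-1` B) = unif R B.
  elim: n B => // n IH B mB; rewrite /r /= -[LHS]/(unif R (r n @^-1` (s2 @^-1` B))).
  by rewrite IH ?unif2// -[X in measurable X]setTI; exact: ms2.
pose U n := s1 \o r n.
have mU n : measurable_fun [set: R] (U n) by exact: measurableT_comp.
have unifU n B : measurable B -> unif R (U n @^-1` B) = unif R B.
  move=> mB; rewrite -[LHS]/(unif R (r n @^-1` (s1 @^-1` B))).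
  by rewrite unifr ?unif1// -[X in measurable X]setTI; exact: ms1.
exists U; split => //; split => //.
(* The current seed [r n] is kept in the statement: it is independent of the variables delivered so
   far, which carries the induction. *)
have prodE n (B : nat -> set R) (C : set R) : (forall i, measurable (B i)) ->
    measurable C ->
    unif R ([set x | forall i, (i < n)%N -> B i (U i x)] `&` r n @^-1` C) =
    (\prod_(i < n) unif R (B i)) * unif R C.
  move=> mB; elim: n C => [|n IH] C mC.
    rewrite big_ord0 mul1e (_ : [set x | _] = setT) ?setTI//.
    by apply/seteqP; split.
  rewrite big_ord_recr /= -muleA -s12// -IH; last first.
    by apply: measurableI; rewrite -[X in measurable X]setTI; [exact: ms1|exact: ms2].
  congr (unif R _); apply/seteqP; split => x /=.
    by move=> [h hC]; split; [move=> i ni; apply: h; exact: ltnW|split => //; exact: h].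
  move=> [h [hB hC]]; split => // i; rewrite ltnS leq_eqVlt => /orP[/eqP ->//|].
  exact: h.
move=> s B us mB; pose N := (\max_(i <- s) i).+1.
have sN i : i \in s -> (i < N)%N by move=> si; rewrite ltnS; exact: leq_bigmax_seq.
pose BB i := if i \in s then B i else setT.
have mBB i : measurable (BB i) by rewrite /BB; case: ifP.
have := prodE N BB setT mBB measurableT.
rewrite preimage_setT setIT probability_setT mule1.
rewrite (_ : [set x | _] = \big[setI/setT]_(i <- s) (U i @^-1` B i)).
  move=> ->; rewrite -(big_mkord xpredT (fun i => unif R (BB i))).
  under eq_bigr do rewrite /BB.
  rewrite (eq_bigr (fun i => if i \in s then unif R (B i) else 1)); last first.
    by move=> i _; case: ifP => // _; exact: probability_setT.
  rewrite -big_mkcond -big_filter /index_iota subn0.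
  rewrite (perm_big s); last first.
    apply: uniq_perm => //; first by rewrite filter_uniq// iota_uniq.
    move=> i; rewrite mem_filter mem_iota add0n leq0n /=.
    by have [/sN ->|//] := boolP (i \in s).
  by apply: eq_bigr => i _; rewrite unifU.
apply/seteqP; split => x /=.
  move=> h; apply/big_setI_mem => i si /=.
  by have := h i (sN i si); rewrite /BB si.
move=> /big_setI_mem h i _; rewrite /BB; case: ifP => // si; exact: h.
Qed.

End Noise.

Local Close Scope ereal_scope.

(** * Conditional probabilities and tail events *)

Local Open Scope ereal_scope.

Section Versions.
Context d (T : measurableType d) (R : realType) (P : probability T R).
Variable F : set (set T).
Hypotheses (sF : sigma_algebra setT F) (Fm : F `<=` measurable).

Lemma sub_measurable_real (f : T -> R) :
  (forall B, measurable B -> F (f @^-1` B)) -> measurable_fun [set: T] f.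
Proof. by move=> Ff _ B mB; rewrite setTI; exact/Fm/Ff. Qed.

Lemma integrable_restr (f : T -> R) : (forall B, measurable B -> F (f @^-1` B)) ->
  P.-integrable setT (EFin \o f) -> (restr sF Fm P).-integrable setT (EFin \o f).
Proof.
move=> Ff /integrableP[_ fi]; apply/integrableP.
have mf : measurable_fun [set: g_sigma_algebraType F] (EFin \o f).
  by apply/measurable_EFinP; apply/(measurable_subP sF).
split => //; rewrite integral_restr//; last exact: measurableT_comp.
by case: sF => F0 FC _; rewrite -(setD0 setT); exact: (FC _ F0).
Qed.

Lemma integral_restr_fin A (f : T -> R) : F A ->
  (forall B, measurable B -> F (f @^-1` B)) ->
  P.-integrable setT (EFin \o f) ->
  \int[restr sF Fm P]_(x in A) (f x)%:E = \int[P]_(x in A) (f x)%:E.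
Proof.
move=> FA Ff fi.
have mA : d.-measurable A by exact: Fm.
apply: (@integral_pushforward _ _ _ _ _ _ (measurable_id_sub sF Fm) P A (EFin \o f)).
- by apply/measurable_EFinP; apply/(measurable_subP sF).
- exact: integrableS fi.
- by rewrite measurable_subE.
Qed.

Lemma version_unique (f g : T -> R) :
  (forall B, measurable B -> F (f @^-1` B)) ->
  (forall B, measurable B -> F (g @^-1` B)) ->
  P.-integrable setT (EFin \o f) -> P.-integrable setT (EFin \o g) ->
  (forall A, F A -> \int[P]_(x in A) (f x)%:E = \int[P]_(x in A) (g x)%:E) ->
  {ae P, forall x, f x = g x}.
Proof.
move=> Ff Fg fi gi fg.
have : ae_eq (restr sF Fm P) setT (EFin \o f) (EFin \o g).
  apply: integral_ae_eq => //; first exact: integrable_restr.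
    by apply/measurable_EFinP; apply/(measurable_subP sF).
  by move=> E _; rewrite measurable_subE// => FE; rewrite !integral_restr_fin ?fg.
move=> [N [mN N0 subN]]; exists N; split => //.
  by apply: Fm; rewrite -(measurable_subE sF).
by move=> x nfg; apply: subN => /= /(_ I) [].
Qed.

(** The version is the density on [F] of the measure taking [B] to [P (A]&[B)]. This measure is
    dominated by [P], so the density can be capped by the constant 1. *)
Lemma version_exists A : measurable A -> exists Y : T -> R,
  (forall x, 0 <= Y x <= 1)%R /\ cond_prob_version P F A Y.
Proof.
move=> mA.
have mdiag : measurable_fun [set: T] (fun w => (w : g_sigma_algebraType F, w)).
  by apply: measurable_fun_pair => //; exact: measurable_id_sub.
pose nu := slice (law P mdiag) mA.
have nuE B : nu B = P (A `&` B).
  by rewrite /nu /= /slice_fun lawE setIC; congr (P _); apply/seteqP; split.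
have nule B : measurable (B : set (g_sigma_algebraType F)) -> nu B <= restr sF Fm P B.
  rewrite (measurable_subE sF) => /Fm mB.
  by rewrite nuE restrE; apply: prob_le => //; exact: measurableI.
have [||f [mf f01 fE]] := @density_dominated _ _ _ (restr sF Fm P) nu
    (cst 1%R) (measurable_cst _) _ nule.
- by move=> x; rewrite ler01.
- by move=> B mB; rewrite (integral_cst _ mB 1) mul1e; exact: nule.
have Ff B : measurable B -> F (f @^-1` B).
  by move: mf => /(measurable_subP sF); exact.
have mfT : measurable_fun [set: T] f by exact: sub_measurable_real.
exists f; split => //; split => //; split.
  apply: (@le_integrable _ _ _ P _ measurableT _ (EFin \o cst 1%R)).
  - exact/measurable_EFinP.
  - move=> x _ /=; rewrite lee_fin normr1 ger0_norm; by case/andP: (f01 x).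
  - exact: finite_measure_integrable_cst.
move=> B FB; rewrite -nuE fE ?measurable_subE// integral_restr//.
- exact/measurable_EFinP.
- by move=> x; rewrite lee_fin; case/andP: (f01 x).
Qed.

Lemma bounded_integrable (f : T -> R) : measurable_fun [set: T] f ->
  (forall x, 0 <= f x <= 1)%R -> P.-integrable setT (EFin \o f).
Proof.
move=> mf f01; apply: (@le_integrable _ _ _ P _ measurableT _ (EFin \o cst 1%R)).
- exact/measurable_EFinP.
- by move=> x _ /=; rewrite lee_fin normr1 ger0_norm; case/andP: (f01 x).
- exact: finite_measure_integrable_cst.
Qed.

End Versions.

Local Close Scope ereal_scope.

Section ZeroOne.
Context d (T : measurableType d) (R : realType) (P : probability T R).

Lemma kolmogorov_zero_one (G : int -> set (set T)) :
  product_type P G -> Kolmogorovian P G.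
Proof.
move=> [Vd [V [xi [mxi [ind GE]]]]] A tA.
pose p : pred int := fun m => m <= 0.
have sigE n : n <= 0 -> G n = sig_family xi [set m | m <= n] by move=> n0; rewrite GE.
have A0 : sig_family xi [set m : int | m <= 0] A.
  by rewrite -sigE//; exact: tA.
have mA : measurable A.
  by apply: (@sig_family_meas _ _ _ _ _ xi p) A0 => //.
have key C : cylinders xi [set m : int | m <= 0] C -> P (C `&` A) = (P C * P A)%E.
  move=> [s [B [us s0 mB ->]]].
  (* A time strictly before all those in [s]: the sum bounds each absolute value. *)
  pose n : int := - (\sum_(m <- s) `|m|%N)%:Z - 1.
  have ns m : m \in s -> n < m.
    move=> ms; rewrite /n.
    have : (`|m|%N <= \sum_(m <- s) `|m|%N)%N.
      by rewrite (big_rem m)//= leq_addr.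
    by move: (\sum_(m <- s) _)%N => N; lia.
  have n0 : n <= 0 by rewrite /n; lia.
  apply: (@indep_blocks _ _ _ P _ _ _ xi p _ _ [set m | m \in s] [set m | m <= n]) => //.
  - by move=> i /= ni; exact: le_trans n0.
  - by move=> i /= /ns ni; rewrite leNgt ni.
  - by apply: cylinders_sub; exists s, B; split.
  - by rewrite -sigE//; exact: tA.
have PAA : P (A `&` A) = (P A * P A)%E.
  apply: (@indep_pi _ _ _ P (cylinders xi [set m : int | m <= 0]) A) => //.
  - exact: cylindersI.
  - by move=> C /cylinders_sub; exact: (@sig_family_meas _ _ _ _ _ xi p).
  - by rewrite -sig_family_gen.
move: PAA; rewrite setIid -(fineK (prob_fin P mA)) -EFinM => -[] /eqP.
rewrite -subr_eq0 -{1}[fine _]mulr1 -mulrBr mulf_eq0 subr_eq0 => /orP[/eqP ->|/eqP <-].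
  by left.
by right.
Qed.

End ZeroOne.

(** * Events of path space and the tail of a copy of the process *)

Section PathSigma.
Context d (T : measurableType d) (R : realType) (D : option nat)
  (X : int -> T -> state R D).

(** [same_law] compares processes through events of path space, so events of the natural filtration
    are lifted there. *)
Definition path_sig (n : int) : set (set (int -> state R D)) :=
  <<s [set E | exists m B, [/\ m <= n, measurable B & E = [set w | B (w m)]]] >>.

Lemma nat_filt_path n A : nat_filt X n A ->
  exists2 E, path_sig n E & A = (fun w m => X m w) @^-1` E.
Proof.
have sP : sigma_algebra setT (path_sig n) by exact: smallest_sigma_algebra.
have sI := @sigma_algebra_preimage _ _ _ setT (fun (w : T) m => X m w) sP.
suff : nat_filt X n `<=` preimage_set_system setT (fun (w : T) m => X m w) (path_sig n).
  by move=> /[apply] -[E sE <-]; exists E => //; rewrite setTI.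
apply: smallest_sub => //.
move=> _ [m mn [B mB <-]]; exists [set w | B (w m)] => //.
by apply: sub_sigma_algebra; exists m, B.
Qed.

Lemma path_nat_filt n E : path_sig n E -> nat_filt X n ((fun w m => X m w) @^-1` E).
Proof.
have [h0 hC hU] : sigma_algebra setT (nat_filt X n) by exact: smallest_sigma_algebra.
move: E; apply: smallest_sub.
  split => /=; first exact: h0.
  - by move=> A sA; exact: hC.
  - by move=> F mF; rewrite preimage_bigcup; exact: hU.
move=> _ [m [B [mn mB ->]]]; apply: sub_sigma_algebra; exists m => //.
by exists B => //; rewrite setTI.
Qed.

Lemma path_sig_le n n' : n <= n' -> path_sig n `<=` path_sig n'.
Proof.
move=> nn'; apply: sub_sigma_algebra2 => _ [m [B [mn mB ->]]].
by exists m, B; split => //; exact: le_trans nn'.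
Qed.

Lemma path_sig_sys n : n <= 0 -> path_sig n `<=` path_sys R D.
Proof.
move=> n0; apply: sub_sigma_algebra2 => _ [m [B [mn mB ->]]].
by exists m, B; split => //; exact: le_trans n0.
Qed.

(* [limsup E_n] is measurable with respect to every tail and represents [A]. *)
Lemma tail_path A : tail_sig (nat_filt X) A ->
  exists2 E, (forall n, n <= 0 -> path_sig n E) & A = (fun w m => X m w) @^-1` E.
Proof.
move=> tA.
have /choice[E EP] : forall k : nat, exists E, path_sig (- k%:Z) E /\
    A = (fun w m => X m w) @^-1` E.
  by move=> k; have [|E ? ?] := @nat_filt_path (- k%:Z) A (tA _ _);
    [rewrite oppr_le0|exists E].
pose L := \bigcap_j \bigcup_(k in [set k | (j <= k)%N]) E k.
have LE N : L = \bigcap_j \bigcup_(k in [set k | (j + N <= k)%N]) E k.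
  apply/seteqP; split => w h j _.
    by have [k jk Ek] := h (j + N)%N I; exists k.
  have [k /= jk Ek] := h j I; exists k => //=.
  exact: leq_trans (leq_addr _ _) jk.
exists L.
  move=> n n0; rewrite (LE `|n|%N).
  apply: (@bigcapT_measurable _ (g_sigma_algebraType _)) => j.
  apply: (@bigcup_measurable _ (g_sigma_algebraType _)) => k /= jk.
  have := (EP k).1; apply: path_sig_le.
  by move: jk n0; lia.
apply/seteqP; split => w.
  move=> Aw j _; exists j => //=; have := (EP j).2.
  by move=> /(congr1 (fun S : set T => S w)) /= <-.
move=> /(_ 0%N I) [k _]; have := (EP k).2.
by move=> /(congr1 (fun S : set T => S w)) /= ->.
Qed.

End PathSigma.

Section TailTransfer.
Context d d' (T : measurableType d) (T' : measurableType d') (R : realType)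
  (D : option nat) (P : probability T R) (P' : probability T' R)
  (X : int -> T -> state R D) (X' : int -> T' -> state R D).

(** A tail event of [X] is the trace of a single path event that belongs to every [path_sig n]. Read
    on [X'], the same path event has the same probability and lies in the tail of [G]. *)
Lemma standard_Kolmogorovian_aux (G : int -> set (set T')) :
  same_law P X P' X' -> Kolmogorovian P' G ->
  (forall n, n <= 0 -> nat_filt X' n `<=` G n) -> Kolmogorovian P (nat_filt X).
Proof.
move=> XX' KG FG A /tail_path[E sE ->].
have -> : P ((fun w m => X m w) @^-1` E) = P' ((fun w m => X' m w) @^-1` E).
  by apply: XX'; apply: (path_sig_sys (lexx _)); exact: sE.
by apply: KG => n n0; apply: (FG n n0); exact: (path_nat_filt (sE n n0)).
Qed.

End TailTransfer.

Lemma standard_Kolmogorovian d (T : measurableType d) (R : realType)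
    (D : option nat) (P : probability T R) (X : int -> T -> state R D) :
  standard_filt P X -> Kolmogorovian P (nat_filt X).
Proof.
move=> [d' [T' [P' [X' [mX' [XX' [G [pG [FG _]]]]]]]]].
apply: (standard_Kolmogorovian_aux XX' _ FG); exact: kolmogorov_zero_one pG.
Qed.

Section Filtration.
Context d (T : measurableType d) (R : realType) (D : option nat).
Variable X : int -> T -> state R D.
Hypothesis mX : forall n : int, n <= 0 -> measurable_fun [set: T] (X n).

Lemma nat_filt_sigma n : sigma_algebra setT (nat_filt X n).
Proof. exact: smallest_sigma_algebra. Qed.

Lemma nat_filt_meas n : n <= 0 -> nat_filt X n `<=` measurable.
Proof.
move=> n0; apply: smallest_sub; first exact: sigma_algebra_measurable.
by move=> _ [m mn [B mB <-]]; apply: mX => //; exact: le_trans n0.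
Qed.

Lemma nat_filt_le n n' : n <= n' -> nat_filt X n `<=` nat_filt X n'.
Proof.
move=> nn'; apply: sub_sigma_algebra2 => B [m mn mB]; exists m => //.
exact: le_trans nn'.
Qed.

Lemma nat_filt_coord m n B : m <= n -> measurable B -> nat_filt X n (X m @^-1` B).
Proof.
move=> mn mB; apply: sub_sigma_algebra; exists m => //.
by exists B => //; rewrite setTI.
Qed.

Lemma tail_sigma : sigma_algebra setT (tail_sig (nat_filt X)).
Proof.
split.
- by move=> n _; have [] := nat_filt_sigma n.
- by move=> A tA n n0; have [_ h _] := nat_filt_sigma n; apply: h; exact: tA.
- by move=> F tF n n0; have [_ _ h] := nat_filt_sigma n; apply: h => i; exact: tF.
Qed.

Lemma tail_meas : tail_sig (nat_filt X) `<=` measurable.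
Proof. by move=> A tA; apply: (@nat_filt_meas 0) => //; exact: tA. Qed.

Lemma Kolmogorovian_cond_law (P : probability T R) :
  Kolmogorovian P (nat_filt X) ->
  forall n : int, n <= 0 -> forall B : set (state R D), measurable B ->
    forall Y : T -> R,
      cond_prob_version P (tail_sig (nat_filt X)) (X n @^-1` B) Y ->
      {ae P, forall w, Y w = fine (P (X n @^-1` B))}.
Proof.
move=> K n n0 B mB Y [tY [iY YE]].
have mXB : measurable (X n @^-1` B).
  by rewrite -[X in measurable X]setTI; exact: mX.
apply: (version_unique tail_sigma tail_meas tY _ iY).
- move=> C mC; have [h|h] := pselect (C (fine (P (X n @^-1` B)))).
    rewrite (_ : _ @^-1` C = setT); last by apply/seteqP; split.
    by have [h0 hC _] := tail_sigma; rewrite -(setD0 setT); exact: (hC _ h0).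
  rewrite (_ : _ @^-1` C = set0); last by apply/seteqP; split.
  by have [] := tail_sigma.
- exact: finite_measure_integrable_cst.
move=> A tA; have mA := tail_meas tA.
have PAB : P (X n @^-1` B `&` A) = (P (X n @^-1` B) * P A)%E.
  have [A0|A1] := K A tA.
    by rewrite A0 mule0; apply: nullS A0 => //; exact: measurableI.
  rewrite A1 mule1 (prob_DI P mXB mA) [X in _ = (X + _)%E](_ : _ = 0%E) ?add0e//.
  apply: (@nullS _ _ _ P _ (~` A)).
  - exact: measurableD.
  - exact: measurableC.
  - by move=> w [].
  by rewrite probability_setC// A1 subee.
rewrite YE//; apply: (etrans PAB); apply: (etrans _ (esym (integral_cst P mA _))).
by rewrite fineK ?prob_fin.
Qed.

End Filtration.

(** * Summably close sequences *)

Local Open Scope ereal_scope.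

Section Geometric.
Context (R : realType).

Definition half_pow (j : nat) : R := ((2^-1) ^+ j)%R.

Lemma half_pow_gt0 j : (0 < half_pow j)%R.
Proof. by rewrite /half_pow exprn_gt0// invr_gt0. Qed.

Lemma half_powS j : (half_pow j = 2 * half_pow j.+1)%R.
Proof. by rewrite /half_pow exprS mulrA divff ?mul1r// pnatr_eq0. Qed.

Lemma half_pow_tail j :
  \sum_(l <oo) (half_pow (j + l))%:E <= (2 * half_pow j)%:E.
Proof.
apply: lime_le.
  by apply: is_cvg_nneseries => n _ _; rewrite lee_fin ltW// half_pow_gt0.
apply: nearW => n; rewrite sumEFin lee_fin.
(* With the remainder [2 * half_pow (j + n)] added, the left-hand side does not change with [n],
   which makes the induction go through. *)
suff : (\sum_(0 <= l < n) half_pow (j + l) + 2 * half_pow (j + n) <= 2 * half_pow j)%R.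
  by apply: le_trans; rewrite lerDl mulr_ge0// ltW// half_pow_gt0.
elim: n => [|n IH]; first by rewrite big_geq// add0r addn0.
rewrite big_nat_recr//= addnS.
by have := half_powS (j + n); move: IH; lra.
Qed.

Lemma half_pow_cvg (e : R) : (0 < e)%R -> exists N, forall n, (N <= n)%N ->
  (half_pow n < e)%R.
Proof.
move=> e0; have := @cvg_geometric R 1 2^-1.
have -> : (`|2^-1 : R| < 1)%R.
  by rewrite ger0_norm ?invr_ge0// invf_lt1// ltr1n.
move=> /(_ isT) /cvgrPdist_lt/(_ e e0)[N _ h]; exists N => n Nn.
have := h n Nn; rewrite /= sub0r normrN mul1r ger0_norm//.
Qed.

End Geometric.

Section LimSup.
Context d (T : measurableType d) (R : realType) (P : probability T R).

(** An upper limit is defined at every point and ignores finitely many terms, so it is measurable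
    for the tail with no exceptional set to discard. *)
Definition limsup_fun (f : nat -> T -> R) (w : T) : R :=
  fine (limn_esup (fun j => (f j w)%:E)).

Lemma limn_esup_bounds (u : (\bar R)^nat) (j : nat) (a b : \bar R) :
  (forall l, (j <= l)%N -> a <= u l <= b) -> a <= limn_esup u <= b.
Proof.
move=> uab; rewrite limn_esup_lim.
have -> : limn (esups u) = ereal_inf (range (esups u)).
  by apply: cvg_lim => //; exact: cvg_esups_inf.
apply/andP; split.
  apply: le_ereal_inf_tmp => _ [n _ <-].
  have := uab (maxn j n) (leq_maxl _ _) => /andP[h _].
  apply: (le_trans h); apply: ereal_sup_ubound; exists (maxn j n) => //=.
  exact: leq_maxr.
apply: (@le_trans _ _ (esups u j)).
  by apply: ereal_inf_lbound; exists j.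
by apply: ge_ereal_sup => _ [l /= jl <-]; have /andP[] := uab l jl.
Qed.

Lemma limsup_fun01 (f : nat -> T -> R) w : (forall j, 0 <= f j w <= 1)%R ->
  (0 <= limsup_fun f w <= 1)%R.
Proof.
move=> f01; have := @limn_esup_bounds (fun j => (f j w)%:E) 0%N 0 1.
rewrite /limsup_fun; case: (limn_esup _) => [r| |] //= h.
- by have := h _; rewrite !lee_fin; apply=> l _; rewrite !lee_fin; exact: f01.
- by rewrite lexx ler01.
- by rewrite lexx ler01.
Qed.

Lemma limsup_fun_shift (f : nat -> T -> R) N :
  limsup_fun f = limsup_fun (fun j => f (j + N)%N).
Proof.
apply/funext => w; congr fine; rewrite !limn_esup_lim.
have E u : limn (esups u) = ereal_inf (range (esups u)).
  by apply: cvg_lim => //; exact: cvg_esups_inf.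
rewrite !E.
have S j : esups (fun j => (f (j + N)%N w)%:E) j = esups (fun j => (f j w)%:E) (j + N)%N.
  rewrite /esups /=; congr ereal_sup; apply/seteqP; split => _ [l /= jl <-].
    by exists (l + N)%N => //=; rewrite leq_add2r.
  exists (l - N)%N; first by rewrite /= leq_subRL ?(leq_trans _ jl) ?leq_addl// addnC.
  by rewrite subnK// (leq_trans _ jl)// leq_addl.
apply/eqP; rewrite eq_le; apply/andP; split.
  apply: le_ereal_inf_tmp => _ [j _ <-]; rewrite S.
  by apply: ereal_inf_lbound; exists (j + N)%N.
apply: le_ereal_inf_tmp => _ [j _ <-].
apply: (@le_trans _ _ (esups (fun j => (f j w)%:E) (j + N)%N)).
  by rewrite -S; apply: ereal_inf_lbound; exists j.
by apply: nonincreasing_esups; exact: leq_addr.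
Qed.

Lemma measurable_limsup_fun (f : nat -> T -> R) :
  (forall j, measurable_fun [set: T] (f j)) ->
  measurable_fun [set: T] (limsup_fun f).
Proof.
move=> mf; apply: measurableT_comp; first exact: fine_measurable.
apply: measurable_fun_limn_esup => j; exact/measurable_EFinP.
Qed.

(* The limsup stays within the tail sum of increments of each term. *)
Lemma limsup_fun_L1 (f : nat -> T -> R) :
  (forall j, measurable_fun [set: T] (f j)) ->
  (forall j w, 0 <= f j w <= 1)%R ->
  (forall j, \int[P]_w `|f j w - f j.+1 w|%:E <= (half_pow R j)%:E) ->
  forall j, \int[P]_w `|limsup_fun f w - f j w|%:E <= (2 * half_pow R j)%:E.
Proof.
move=> mf f01 fd j; apply: le_trans (half_pow_tail R j).
pose g l w := `|f (j + l)%N w - f (j + l).+1 w|%:E.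
have mg l : measurable_fun [set: T] (g l).
  by apply/measurable_EFinP; apply: measurableT_comp => //; exact: measurable_funB.
have g0 l w : 0 <= g l w by rewrite lee_fin.
apply: (@le_trans _ _ (\sum_(l <oo) \int[P]_w g l w)); last first.
  apply: lee_nneseries => l; last by move=> _; exact: fd.
  by move=> _ _; exact: integral_ge0.
rewrite -integral_nneseries//.
have mS : measurable_fun [set: T] (fun w => \sum_(l <oo) g l w).
  by apply: ge0_emeasurable_sum.
apply: ge0_le_integral; [by []|by move=> w _; rewrite lee_fin| |exact: mS|].
  apply/measurable_EFinP; apply: measurableT_comp => //.
  by apply: measurable_funB => //; exact: measurable_limsup_fun.
move=> w _; set S := \sum_(l <oo) _.
have S0 : 0 <= S by apply: nneseries_ge0 => l _ _; exact: g0.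
have inc l : `|f (j + l)%N w - f j w|%:E <= S.
  apply: (@le_trans _ _ (\sum_(0 <= i < l) g i w)).
    rewrite sumEFin lee_fin; elim: l => [|k IH].
      by rewrite addn0 subrr normr0 big_geq.
    rewrite addnS big_nat_recr//= (le_trans (ler_distD (f (j + k)%N w) _ _))//.
    by rewrite addrC [X in (_ <= X + _)%R]distrC lerD.
  by apply: nneseries_lim_ge => i *; exact: g0.
case SE : S S0 inc => [s| |] S0 inc; [|by rewrite leey|by []].
have {}inc l : (j <= l)%N -> (f j w - s)%:E <= (f l w)%:E <= (f j w + s)%:E.
  move=> jl; rewrite !lee_fin -ler_distl -lee_fin.
  by have := inc (l - j)%N; rewrite subnKC.
have := limn_esup_bounds inc; rewrite /limsup_fun.
case: (limn_esup _) => [r| |] /=.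
- by rewrite !lee_fin -ler_distl.
- by rewrite leye_eq andbF.
- by [].
Qed.

Definition limsup_set (F : nat -> set T) : set T :=
  \bigcap_j \bigcup_(l in [set l | (j <= l)%N]) F l.

Lemma measurable_limsup_set (F : nat -> set T) :
  (forall j, measurable (F j)) -> measurable (limsup_set F).
Proof.
by move=> mF; apply: bigcapT_measurable => j; exact: bigcup_measurable.
Qed.

Lemma limsup_setS (F F' : nat -> set T) : (forall j, F j `<=` F' j) ->
  limsup_set F `<=` limsup_set F'.
Proof. by move=> FF' w h j _; have [l jl /FF' ?] := h j I; exists l. Qed.

(** A point of [F j] outside the upper limit must leave the sequence at some later step, and a point
    of the upper limit outside [F j] must enter it at one. The probabilities of these steps are
    summed geometrically. *)
Lemma limsup_set_close (F : nat -> set T) N :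
  (forall j, measurable (F j)) ->
  (forall j, (N <= j)%N -> P (F j `\` F j.+1) + P (F j.+1 `\` F j) <= (half_pow R j)%:E) ->
  forall j, (N <= j)%N ->
    P (F j `\` limsup_set F) <= (2 * half_pow R j)%:E /\
    P (limsup_set F `\` F j) <= (2 * half_pow R j)%:E.
Proof.
move=> mF FD j Nj; have mL := measurable_limsup_set mF.
have bound (A : nat -> set T) (B : set T) : (forall l, measurable (A l)) ->
    measurable B -> (forall l, P (A l) <= (half_pow R (j + l))%:E) ->
    B `<=` \bigcup_l A l -> P B <= (2 * half_pow R j)%:E.
  move=> mA mB PA BA; apply: le_trans (half_pow_tail R j).
  apply: (le_trans (measure_sigma_subadditive _ mA mB BA)).
  by apply: lee_nneseries => [l _ _|l _]; [exact: measure_ge0|exact: PA].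
split.
- apply: (bound (fun l => F (j + l)%N `\` F (j + l).+1)).
  + by move=> l; exact: measurableD.
  + exact: measurableD.
  + move=> l; apply: le_trans (FD _ _); last exact: leq_trans (leq_addr _ _).
    by rewrite leeDl.
  + move=> w [Fj nL]; apply: contrapT => nU; apply: nL => i _.
    exists (j + i)%N; first exact: leq_addl.
    elim: i => [|i IH]; first by rewrite addn0.
    apply: contrapT => nF; apply: nU; exists i => //; split => //.
    by move: nF; rewrite addnS.
- apply: (bound (fun l => F (j + l).+1 `\` F (j + l)%N)).
  + by move=> l; exact: measurableD.
  + exact: measurableD.
  + move=> l; apply: le_trans (FD _ _); last exact: leq_trans (leq_addr _ _).
    by rewrite leeDr.
  + move=> w [Lw nF]; apply: contrapT => nU.
    have [l /= jl Fl] := Lw j I; rewrite -(subnKC jl) in Fl.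
    elim: (l - j)%N Fl => [|i IH] Fl; first by apply: nF; rewrite addn0 in Fl.
    apply: IH; apply: contrapT => nFi; apply: nU; exists i => //; split => //.
    by rewrite -addnS.
Qed.

End LimSup.

Local Close Scope ereal_scope.

(** * Reverse martingales *)

Section Bounded.
Context d (T : measurableType d) (R : realType) (P : probability T R).

Definition bounded_meas (f : T -> R) : Prop :=
  measurable_fun [set: T] f /\ exists c, forall x, `|f x| <= c.

Lemma bounded_measD f g : bounded_meas f -> bounded_meas g ->
  bounded_meas (fun x => f x + g x).
Proof.
move=> [mf [c fc]] [mg [c' gc]]; split; first exact: measurable_funD.
by exists (c + c') => x; rewrite (le_trans (ler_normD _ _))// lerD.
Qed.

Lemma bounded_measN f : bounded_meas f -> bounded_meas (fun x => - f x).
Proof.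
move=> [mf [c fc]]; split; first exact: measurableT_comp.
by exists c => x; rewrite normrN.
Qed.

Lemma bounded_measB f g : bounded_meas f -> bounded_meas g ->
  bounded_meas (fun x => f x - g x).
Proof. by move=> bf bg; apply: bounded_measD => //; exact: bounded_measN. Qed.

Lemma bounded_measM f g : bounded_meas f -> bounded_meas g ->
  bounded_meas (fun x => f x * g x).
Proof.
move=> [mf [c fc]] [mg [c' gc]]; split; first exact: measurable_funM.
by exists (c * c') => x; rewrite normrM ler_pM.
Qed.

Lemma bounded_meas_norm f : bounded_meas f -> bounded_meas (fun x => `|f x|).
Proof.
move=> [mf [c fc]]; split; first exact: measurableT_comp.
by exists c => x; rewrite normr_id.
Qed.

Lemma bounded_meas_cst c : bounded_meas (fun=> c).
Proof. by split; [exact: measurable_cst|exists `|c|]. Qed.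

Lemma bounded_meas01 (f : T -> R) : measurable_fun [set: T] f ->
  (forall x, 0 <= f x <= 1) -> bounded_meas f.
Proof.
by move=> mf f01; split => //; exists 1 => x; case/andP: (f01 x) => f0 f1; rewrite ger0_norm.
Qed.

Lemma bounded_meas_int A f : measurable A -> bounded_meas f ->
  P.-integrable A (EFin \o f).
Proof.
move=> mA [mf [c fc]]; apply: (@integrableS _ _ _ P setT) => //.
apply: (@le_integrable _ _ _ P _ measurableT _ (EFin \o cst c)).
- exact/measurable_EFinP.
- by move=> x _ /=; rewrite lee_fin (le_trans (fc x))// ler_norm.
- exact: finite_measure_integrable_cst.
Qed.

Lemma bounded_meas_fin A f : measurable A -> bounded_meas f ->
  (\int[P]_(x in A) (f x)%:E)%E = (\int[P]_(x in A) f x)%:E.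
Proof.
move=> mA bf; rewrite /Rintegral fineK//; apply: integrable_fin_num => //.
exact: bounded_meas_int.
Qed.

End Bounded.

Section ReverseMartingale.
Context d (T : measurableType d) (R : realType) (P : probability T R).
Variables (F : nat -> set (set T)) (E0 : set T) (M : nat -> T -> R).
Hypotheses (sF : forall r, sigma_algebra setT (F r))
  (Fm : forall r, F r `<=` measurable) (Fd : forall r, F r.+1 `<=` F r)
  (mE0 : measurable E0) (M01 : forall r w, 0 <= M r w <= 1)
  (FM : forall r B, measurable B -> F r (M r @^-1` B))
  (ME : forall r A, F r A -> (\int[P]_(w in A) (M r w)%:E = P (E0 `&` A))%E)
  (tail_cond : forall Y, cond_prob_version P [set A | forall r, F r A] E0 Y ->
     {ae P, forall w, Y w = fine (P E0)}).

Let p : R := fine (P E0).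

Let FT r : F r setT.
Proof. by have [h0 hC _] := sF r; rewrite -(setD0 setT); exact: (hC _ h0). Qed.

Let Fle r r' : (r <= r')%N -> F r' `<=` F r.
Proof.
move=> rr'; rewrite -(subnKC rr'); elim: (r' - r)%N => [|k IH]; first by rewrite addn0.
by rewrite addnS => A /Fd/IH.
Qed.

Let mM r : measurable_fun [set: T] (M r).
Proof. by apply: (sub_measurable_real (@Fm r)); exact: FM. Qed.

Let bM r : bounded_meas (M r).
Proof. by apply: bounded_meas01. Qed.

Let Ex (f : T -> R) : R := \int[P]_w f w.

Let ExD f g : bounded_meas f -> bounded_meas g ->
  Ex (fun w => f w + g w) = Ex f + Ex g.
Proof. by move=> bf bg; rewrite /Ex RintegralD//; exact: bounded_meas_int. Qed.

Let ExB f g : bounded_meas f -> bounded_meas g ->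
  Ex (fun w => f w - g w) = Ex f - Ex g.
Proof. by move=> bf bg; rewrite /Ex RintegralB//; exact: bounded_meas_int. Qed.

Let ExZ c f : bounded_meas f -> Ex (fun w => c * f w) = c * Ex f.
Proof. by move=> bf; rewrite /Ex RintegralZl//; exact: bounded_meas_int. Qed.

Let Ex_cst c : Ex (fun=> c) = c.
Proof.
apply: (etrans (Rintegral_cst _ measurableT c)).
by rewrite (congr1 fine (probability_setT P)) mulr1.
Qed.

Let Ex_le f g : bounded_meas f -> bounded_meas g -> (forall w, f w <= g w) ->
  Ex f <= Ex g.
Proof.
by move=> bf bg fg; apply: le_Rintegral => //; exact: bounded_meas_int.
Qed.

Let ExE f : bounded_meas f -> (\int[P]_w (f w)%:E)%E = (Ex f)%:E.
Proof. by move=> bf; rewrite (bounded_meas_fin P measurableT bf). Qed.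

Let Ex_eq f g : f =1 g -> Ex f = Ex g.
Proof. by move=> fg; apply: eq_Rintegral => w _. Qed.

Let ExM r : Ex (M r) = p.
Proof. by rewrite /Ex /Rintegral ME// setIT. Qed.

Let V r := Ex (fun w => M r w * M r w).

(** [M r] and [M r'] have the same integrals over the sets of [F r'], and the weight [M r'] is
    measurable for [F r']. This is the orthogonality of martingale increments. *)
Let cross r r' : (r <= r')%N -> Ex (fun w => M r' w * M r w) = V r'.
Proof.
move=> rr'; rewrite /V /Ex /Rintegral; congr fine.
have := @integral_sub_ext _ _ _ (sF r') (@Fm r') _ P (M r) (M r') _ _ (mM r) (mM r') _
  (fun w => (M r' w)%:E).
apply.
- by move=> w; case/andP: (M01 r w).
- by move=> w; case/andP: (M01 r' w).
- by move=> A FA; rewrite !ME//; exact: Fle FA.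
- by apply/measurable_EFinP; apply/measurable_subP => // B mB; exact: FM.
- by move=> w; rewrite lee_fin; case/andP: (M01 r' w).
Qed.

Let diff2 r r' : (r <= r')%N ->
  Ex (fun w => (M r w - M r' w) * (M r w - M r' w)) = V r - V r'.
Proof.
move=> rr'.
have b1 := bounded_measM (bM r) (bM r).
have b2 := bounded_measM (bM r') (bM r).
have b3 := bounded_measM (bM r') (bM r').
transitivity (Ex (fun w => (M r w * M r w - 2 * (M r' w * M r w)) + M r' w * M r' w)).
  by apply: Ex_eq => w; ring.
rewrite ExD//; last by apply: bounded_measB => //; apply: bounded_measM => //; exact: bounded_meas_cst.
rewrite ExB//; last by apply: bounded_measM => //; exact: bounded_meas_cst.
by rewrite ExZ// (cross rr') -/(V r) -/(V r'); ring.
Qed.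

Let W r := Ex (fun w => (M r w - p) * (M r w - p)).

Let WE r : W r = V r - p * p.
Proof.
have b1 := bounded_measM (bM r) (bM r).
have bp := @bounded_meas_cst _ T R (p * p).
transitivity (Ex (fun w => (M r w * M r w - (2 * p) * M r w) + p * p)).
  by apply: Ex_eq => w; ring.
have b2 : bounded_meas (fun w => (2 * p) * M r w).
  by apply: bounded_measM => //; exact: bounded_meas_cst.
rewrite ExD//; last exact: bounded_measB.
by rewrite ExB// ExZ// ExM Ex_cst -/(V r); ring.
Qed.

Let V_noninc r r' : (r <= r')%N -> V r' <= V r.
Proof.
move=> rr'; rewrite -subr_ge0 -diff2//; apply: Rintegral_ge0 => w _.
by rewrite -expr2 sqr_ge0.
Qed.

Let V_ge0 r : 0 <= V r.
Proof. by apply: Rintegral_ge0 => w _; rewrite -expr2 sqr_ge0. Qed.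

Let V_cauchy e : 0 < e -> exists r, forall r', (r <= r')%N -> V r - V r' <= e.
Proof.
move=> e0; pose S := range V.
have hS : has_inf S.
  by split; [exists (V 0%N), 0%N|exists 0 => _ [r _ <-]; exact: V_ge0].
have [_ [r _ <-] rS] := inf_adherent e0 hS.
exists r => r' rr'.
have : inf S <= V r' by apply: ge_inf; [exact: hS.2|exists r'].
by move: rS; lra.
Qed.

(** The pointwise inequality [|f| <= f^2 / (2c) + c / 2] plays the part of Cauchy-Schwarz in passing
    from second moments to L1. *)
Let amgm (c : R) f : 0 < c -> bounded_meas f ->
  Ex (fun w => `|f w|) <= c^-1 / 2 * Ex (fun w => f w * f w) + c / 2.
Proof.
move=> c0 bf; have b2 := bounded_measM bf bf.
rewrite -[X in _ + X]Ex_cst -ExZ// -ExD; last 2 first.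
- by apply: bounded_measM => //; exact: bounded_meas_cst.
- exact: bounded_meas_cst.
apply: Ex_le.
- exact: bounded_meas_norm.
- apply: bounded_measD; last exact: bounded_meas_cst.
  by apply: bounded_measM => //; exact: bounded_meas_cst.
move=> w; rewrite -[X in _ <= _ * X + _]expr2 -real_normK ?num_real//.
set a := `|f w|.
have : 0 <= c^-1 * ((a - c) ^+ 2) by rewrite mulr_ge0 ?invr_ge0 ?sqr_ge0// ltW.
move=> h; rewrite -(@ler_pM2l _ 2)//.
have -> : 2 * (c^-1 / 2 * a ^+ 2 + c / 2) = c^-1 * (a - c) ^+ 2 + 2 * a.
  by field; rewrite gt_eqF.
by rewrite lerDr.
Qed.

(** The gap is the square of [half_pow j], so that [amgm] with weight [half_pow j] bounds the L1
    increments along the subsequence by [half_pow j]. *)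
Let subseq : exists r : nat -> nat, (forall j, (j <= r j)%N) /\
  (forall j, (r j <= r j.+1)%N) /\
  forall j r', (r j <= r')%N -> V (r j) - V r' <= half_pow R j * half_pow R j.
Proof.
have /choice[N NP] : forall j, exists r, forall r', (r <= r')%N ->
    V r - V r' <= half_pow R j * half_pow R j.
  by move=> j; apply: V_cauchy; rewrite mulr_gt0// half_pow_gt0.
(* Partial sums make the indices nondecreasing and above every threshold; the added [j] makes them
   tend to infinity. *)
exists (fun j => (\sum_(i < j.+1) N i + j)%N); split; first by move=> j; rewrite leq_addl.
split=> [j|j r' jr'].
  by rewrite [in leqRHS]big_ord_recr /= -addnA leq_add2l addnS leqW// leq_addl.
have Nj : (N j <= \sum_(i < j.+1) N i + j)%N.
  by rewrite big_ord_recr /= -addnA addnCA leq_addr.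
apply: le_trans (NP j r' (leq_trans Nj jr')).
by rewrite lerD2r V_noninc.
Qed.

(** Second moments decrease with [r], hence are Cauchy, and increments along a subsequence are
    summable in L1. Its upper limit is a tail-measurable version of the conditional probability of
    [E0], which by assumption is the constant [p]. Monotonicity of the variance extends the
    convergence to the full sequence. *)
Lemma reverse_martingale (e : R) : 0 < e -> exists r0, forall r, (r0 <= r)%N ->
  (\int[P]_w `|M r w - p|%:E <= e%:E)%E.
Proof.
move=> e0; have [r [jr [rS rV]]] := subseq.
have r_le i j : (i <= j)%N -> (r i <= r j)%N.
  move=> ij; rewrite -(subnKC ij); elim: (j - i)%N => [|k IH]; first by rewrite addn0.
  by rewrite addnS (leq_trans IH).
pose f j := M (r j).
have fd j : (\int[P]_w `|f j w - f j.+1 w|%:E <= (half_pow R j)%:E)%E.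
  have bd : bounded_meas (fun w => f j w - f j.+1 w).
    exact: (bounded_measB (bM _) (bM _)).
  rewrite ExE; last exact: bounded_meas_norm.
  rewrite lee_fin; apply: (le_trans (amgm (half_pow_gt0 R j) bd)).
  rewrite diff2//.
  have h0 := half_pow_gt0 R j.
  have h := rV j _ (rS j).
  apply: (@le_trans _ _ ((half_pow R j)^-1 / 2 * (half_pow R j * half_pow R j) + half_pow R j / 2)).
    by rewrite lerD2r ler_wpM2l// divr_ge0// invr_ge0 ltW.
  have -> : (half_pow R j)^-1 / 2 * (half_pow R j * half_pow R j) = half_pow R j / 2.
    by field; rewrite gt_eqF.
  by lra.
pose Y := limsup_fun f.
have mf j : measurable_fun [set: T] (f j) by exact: mM.
have f01 j w : 0 <= f j w <= 1 by exact: M01.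
have mY : measurable_fun [set: T] Y by exact: measurable_limsup_fun.
have Y01 w : 0 <= Y w <= 1 by apply: limsup_fun01.
have bY : bounded_meas Y by exact: bounded_meas01.
have Yf j := limsup_fun_L1 mf f01 fd j.
have tY : cond_prob_version P [set A | forall r, F r A] E0 Y.
  split; [|split].
  - move=> B mB N; rewrite /Y (limsup_fun_shift f N).
    have : measurable_fun [set: g_sigma_algebraType (F N)] (limsup_fun (fun j => f (j + N)%N)).
      apply: (@measurable_limsup_fun _ (g_sigma_algebraType (F N)) R) => j.
      apply/measurable_subP => // C mC; apply: (@Fle N (r (j + N)%N)).
        by rewrite (leq_trans _ (jr _))// leq_addl.
      exact: FM.
    by move=> /(measurable_subP (sF N)); exact.
  - exact: bounded_meas_int.
  - move=> A FA; have mA : measurable A by exact: (Fm (FA 0%N)).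
    rewrite (bounded_meas_fin P mA bY) -[RHS]fineK; last by apply: prob_fin; exact: measurableI.
    (* If the two numbers differed, their distance would be a fixed positive gap. But [Y] is
       arbitrarily close in L1 to [f N], whose integral over [A] is already the right one. *)
    congr (_%:E); apply/eqP/negPn/negP => nEq.
    pose a := (\int[P]_(x in A) Y x)%R; pose b := fine (P (E0 `&` A)).
    have ab0 : 0 < `|a - b| by rewrite normr_gt0 subr_eq0; exact: nEq.
    have [N hN] := half_pow_cvg (divr_gt0 ab0 (ltr0Sn R 1)).
    have := hN N (leqnn _); rewrite ltNge => /negP; apply.
    have -> : b = \int[P]_(x in A) f N x by rewrite /Rintegral ME.
    rewrite -RintegralB//; [|exact: (bounded_meas_int P mA bY)|exact: (bounded_meas_int P mA (bM (r N)))].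
    have bYf : bounded_meas (fun w => Y w - f N w) by exact: (bounded_measB bY (bM _)).
    have := Yf N; rewrite ExE; last exact: bounded_meas_norm.
    rewrite lee_fin => h.
    suff : `|\int[P]_(x in A) (Y x - f N x)| <= Ex (fun w => `|Y w - f N w|) by lra.
    apply: (le_trans (le_normr_Rintegral mA (bounded_meas_int P mA bYf))).
    have bn := bounded_meas_norm bYf.
    rewrite -lee_fin -(bounded_meas_fin P mA bn) -ExE//.
    apply: ge0_subset_integral => //.
    + by case: bn => mn _; exact/measurable_EFinP.
have Yp := tail_cond tY.
have WN j : W (r j) <= 2 * half_pow R j.
  have bp : bounded_meas (fun w => M (r j) w - p).
    by apply: bounded_measB => //; exact: bounded_meas_cst.
  (* [M] and [p] lie in [0, 1], so the square of their difference is at most its absolute value. *)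
  apply: (@le_trans _ _ (Ex (fun w => `|M (r j) w - p|))).
    apply: Ex_le; [exact: bounded_measM|exact: bounded_meas_norm|move=> w].
    have p01 : 0 <= p <= 1.
      by rewrite fine_ge0//= -lee_fin fineK ?prob_fin// probability_le1.
    have m1 : `|M (r j) w - p| <= 1.
      by have := M01 (r j) w; move: p01; rewrite ler_norml; lra.
    rewrite -expr2 -real_normK ?num_real// expr2 -[leRHS]mulr1.
    by rewrite ler_wpM2l.
  rewrite -lee_fin -ExE; last exact: bounded_meas_norm.
  apply: le_trans (Yf j); rewrite le_eqVlt; apply/orP; left; apply/eqP.
  apply: ge0_ae_eq_integral => //.
  - by case: (bounded_meas_norm bp) => mn _; exact/measurable_EFinP.
  - by case: (bounded_meas_norm (bounded_measB bY (bM (r j)))) => mn _; exact/measurable_EFinP.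
  - by apply: filterS Yp => w /= Yw _; rewrite -/Y Yw distrC.
(* By [amgm] with weight [e], a variance of at most [e * e] gives an L1 distance of at most [e];
   since the variance is nonincreasing, one index settles all later ones. *)
have [N hN] : exists N, W (r N) <= e * e.
  have [N hN] := half_pow_cvg (divr_gt0 (mulr_gt0 e0 e0) (ltr0Sn R 1)).
  exists N; apply: (le_trans (WN N)); have := hN N (leqnn _).
  by move=> h; apply/ltW; move: h; lra.
exists (r N) => r' rr'.
have bp : bounded_meas (fun w => M r' w - p).
  by apply: bounded_measB => //; exact: bounded_meas_cst.
rewrite ExE; last exact: bounded_meas_norm.
rewrite lee_fin; apply: (le_trans (amgm e0 bp)); rewrite -/(W r').
have h : W r' <= e * e.
  by apply: le_trans hN; rewrite !WE lerD2r V_noninc.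
apply: (@le_trans _ _ (e^-1 / 2 * (e * e) + e / 2)).
  by rewrite lerD2r ler_wpM2l// divr_ge0// invr_ge0 ltW.
have -> : e^-1 / 2 * (e * e) = e / 2 by field; rewrite gt_eqF.
by lra.
Qed.

End ReverseMartingale.

(** * Markov steps *)

Local Open Scope ereal_scope.

Section Step.
Context d d1 d2 (T : measurableType d) (S1 : measurableType d1)
  (S2 : measurableType d2) (R : realType) (P : probability T R).

(* The law of [y] given [G] is [Q x]. *)
Definition markov_step (G : set (set T)) (x : T -> S1) (y : T -> S2)
    (Q : R.-pker S1 ~> S2) : Prop :=
  forall A B, G A -> measurable B ->
    P (A `&` y @^-1` B) = \int[P]_(w in A) Q (x w) B.

Variables (G : set (set T)) (x : T -> S1) (y : T -> S2) (Q : R.-pker S1 ~> S2).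
Hypotheses (sG : sigma_algebra setT G) (Gm : G `<=` measurable)
  (Gx : forall B, measurable B -> G (x @^-1` B))
  (my : measurable_fun [set: T] y) (xyQ : markov_step G x y Q).

Let mx : measurable_fun [set: g_sigma_algebraType G] (x : g_sigma_algebraType G -> S1).
Proof. exact/measurable_subP. Qed.

Let my' : measurable_fun [set: T] (fun w => (w : g_sigma_algebraType G, y w)).
Proof. by apply: measurable_fun_pair => //; exact: measurable_id_sub. Qed.

Lemma step_joint E : measurable E ->
  law P my' E = mixture (restr sG Gm P) (kpre mx Q) E.
Proof.
apply: prob_eq_prod => //.
  by apply: (le_lt_trans (probability_le1 (law P my') measurableT)); exact: ltry.
move=> A B mA mB; apply: (etrans _ (esym (mixture_prod _ _ mA mB))).
have GA : G A by rewrite -(measurable_subE sG).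
rewrite -[LHS]/(P (A `&` y @^-1` B)) xyQ//.
rewrite -(@integral_restr _ _ _ sG Gm R P A (fun w => Q (x w) B))//.
exact: measurableT_comp (measurable_kernel Q B mB) mx.
Qed.

Lemma step_integral (F : g_sigma_algebraType G * S2 -> \bar R) :
  measurable_fun setT F -> (forall z, 0 <= F z) ->
  \int[P]_w F (w : g_sigma_algebraType G, y w) = \int[P]_w \int[Q (x w)]_z F (w, z).
Proof.
move=> mF F0.
transitivity (\int[law P my']_z F z).
  by rewrite ge0_integral_law// preimage_setT.
rewrite (eq_measure_integral (mixture (restr sG Gm P) (kpre mx Q))); last first.
  by move=> A mA _; exact: step_joint.
rewrite integral_mixture// integral_restr//.
- by rewrite -(measurable_subE sG).
- exact: (@measurable_fun_integral_finite_kernel _ _ (g_sigma_algebraType G) _ R F (kpre mx Q)).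
- by move=> w; exact: integral_ge0.
Qed.

Lemma step_fun A (f : S2 -> \bar R) : G A -> measurable_fun setT f ->
  (forall z, 0 <= f z) ->
  \int[P]_(w in A) f (y w) = \int[P]_(w in A) \int[Q (x w)]_z f z.
Proof.
move=> GA mf f0.
have mA : measurable (A : set (g_sigma_algebraType G)) by rewrite measurable_subE.
pose F (z : g_sigma_algebraType G * S2) := (\1_A z.1)%:E * f z.2.
have mF : measurable_fun setT F.
  apply: emeasurable_funM.
    apply/measurable_EFinP; apply: (measurableT_comp (measurable_indic mA)).
    exact: measurable_fst.
  exact: measurableT_comp mf measurable_snd.
have F0 z : 0 <= F z by rewrite mule_ge0// lee_fin.
rewrite [LHS]integral_mkcond [RHS]integral_mkcond.
transitivity (\int[P]_w F (w : g_sigma_algebraType G, y w)).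
  apply: eq_integral => w _; rewrite patchE /F /= indicE.
  by case: ifP; rewrite (mul1e, mul0e).
rewrite step_integral//; apply: eq_integral => w _; rewrite patchE /F /= indicE.
case: ifP => _; first by under eq_integral do rewrite mul1e.
by under eq_integral do rewrite mul0e; rewrite integral0.
Qed.

End Step.

(** * Probabilities of trajectories computed from the kernels *)

Section Backward.
Context (R : realType) d (S : measurableType d).
Variables (Q : nat -> R.-pker S ~> S) (B : nat -> set S).
Hypothesis mB : forall t, measurable (B t).

(* The probability, from a given state at time [-t], of meeting [B] at each of the
   times [-t, ..., 0]. *)
Fixpoint backward (t : nat) : S -> \bar R :=
  if t is t'.+1 then
    fun x => (\1_(B t'.+1) x)%:E * \int[Q t' x]_y backward t' y
  else fun x => (\1_(B 0%N) x)%:E.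

Lemma backward_meas t : measurable_fun [set: S] (backward t) /\
  forall x, 0 <= backward t x <= 1.
Proof.
elim: t => [|t [mt t01]] /=.
  split; first exact/measurable_EFinP/measurable_indic.
  by move=> x; rewrite !lee_fin indicE; case: (_ \in _); rewrite ?lexx ?ler01.
have h x : 0 <= \int[Q t x]_y backward t y <= 1.
  apply/andP; split; first by apply: integral_ge0 => y _; case/andP: (t01 y).
  rewrite -[leRHS](@prob_kernel _ _ _ _ _ (Q t) x) -[leRHS]mul1e -integral_cst//.
  by apply: ge0_le_integral => // y _; case/andP: (t01 y).
split.
  apply: emeasurable_funM; first exact/measurable_EFinP/measurable_indic.
  apply: measurable_fun_integral_kernel => //.
    by move=> U mU; exact: measurable_kernel.
  by move=> y; case/andP: (t01 y).
move=> x; rewrite indicE; case: (_ \in _); first by rewrite mul1e.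
by rewrite mul0e lexx lee_fin ler01.
Qed.

Context dT (T : measurableType dT) (P : probability T R).
Variables (Z : nat -> T -> S) (G : nat -> set (set T)) (N : nat).
Hypotheses (sG : forall t, sigma_algebra setT (G t))
  (Gm : forall t, G t `<=` measurable) (Gd : forall t, G t.+1 `<=` G t)
  (GZ : forall t C, (t <= N)%N -> measurable C -> G t (Z t @^-1` C))
  (ZQ : forall t, (t < N)%N -> markov_step P (G t.+1) (Z t.+1) (Z t) (Q t)).

(** Peel off the earliest time: [A] together with the constraint there is an event of [G t.+1],
    hence of [G t], so the induction hypothesis applies and one Markov step remains. The bound [N]
    admits copies that exist only from some time on. *)
Lemma backward_prob t A : (t <= N)%N -> G t A ->
  P (A `&` [set w | forall s, (s <= t)%N -> B s (Z s w)]) =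
  \int[P]_(w in A) backward t (Z t w).
Proof.
elim: t A => [|t IH] A tN GA.
  have mZ : measurable (Z 0%N @^-1` B 0%N) by apply: (@Gm 0%N); exact: GZ.
  have mA : measurable A by exact: (Gm GA).
  rewrite /= (_ : [set w | _] = Z 0%N @^-1` B 0%N); last first.
    by apply/seteqP; split => w /=; [exact|move=> h s; rewrite leqn0 => /eqP ->].
  rewrite setIC -integral_indic//.
have tN' : (t <= N)%N by exact: ltnW.
have GA' : G t.+1 (A `&` Z t.+1 @^-1` B t.+1).
  have [_ _ _] := sG t.+1.
  rewrite -(measurable_subE (sG t.+1)).
  apply: (@measurableI _ (g_sigma_algebraType (G t.+1))); rewrite measurable_subE//.
  exact: GZ.
have [mt t01] := backward_meas t.
transitivity (P ((A `&` Z t.+1 @^-1` B t.+1) `&`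
    [set w | forall s, (s <= t)%N -> B s (Z s w)])).
  congr (P _); apply/seteqP; split => w /=.
    move=> [Aw h]; split; first by split => //; exact: h.
    by move=> s st; apply: h; exact: leqW.
  move=> [[Aw Bw] h]; split => // s; rewrite leq_eqVlt => /orP[/eqP -> //|].
  by rewrite ltnS; exact: h.
rewrite IH//; last exact: Gd.
rewrite (@step_fun _ _ _ _ _ _ _ _ _ _ _ _ (sG t.+1) (@Gm t.+1) _ _ (ZQ _))//.
- rewrite integral_mkcondr; apply: eq_integral => w _.
  rewrite patchE /= indicE.
  rewrite (_ : (w \in Z t.+1 @^-1` B t.+1) = (Z t.+1 w \in B t.+1)); last first.
    by apply/idP/idP; rewrite !inE.
  by case: ifP; rewrite (mul1e, mul0e).
- by move=> C mC; exact: GZ.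
- move=> _ C mC; rewrite setTI; apply: (@Gm t); exact: GZ.
- by move=> z; case/andP: (t01 z).
Qed.

End Backward.

(** * The support carries the whole law *)

Section Support.
Context (R : realType) (D : option nat).

(** A countable base of the product topology: a finite list of rational intervals constrains the
    coordinates numbered below its length. *)
Definition box (l : seq (rat * rat)) : set (state R D) :=
  [set y | forall k : coord D, (coord_num k < size l)%N ->
     (ratr (nth (0%R, 0%R) l (coord_num k)).1 < y k <
      ratr (nth (0%R, 0%R) l (coord_num k)).2)%R].

Lemma measurable_box l : measurable (box l).
Proof.
pose I i : set (state R D) := if coord_of_num D i is Some k then
  (if (i < size l)%N then [set y : state R D | (ratr (nth (0%R, 0%R) l i).1 < y k <
      ratr (nth (0%R, 0%R) l i).2)%R] else setT) else setT.
rewrite (_ : box l = \bigcap_i I i).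
  apply: bigcapT_measurable => i; rewrite /I.
  case: coord_of_num => // k; case: ifP => // _.
  have := @measurable_coord R D k measurableT _ (measurable_itv
    `](ratr (nth (0%R, 0%R) l i).1 : R), (ratr (nth (0%R, 0%R) l i).2 : R)[).
  by rewrite setTI; congr measurable; apply/seteqP; split => y /=; rewrite in_itv.
apply/seteqP; split => y.
  move=> h i _; rewrite /I; case E : coord_of_num => [k|] //; case: ifP => // il /=.
  have ki : coord_num k = i.
    clear -E; move: k E; rewrite /coord_of_num /coord_num; case: D => [n|] k.
      by case: insubP => // u _ <- [<-].
    by move=> [->].
  by rewrite -ki; apply: h; rewrite ki.
by move=> h k kl; have := h (coord_num k) Logic.I; rewrite /I coord_numK kl.
Qed.

(** The sets [C n], which bound the first [n] coordinates to within [1/(n+1)], generate a filter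
    that converges to [x] because it does so in each coordinate. Hence [U] contains some [C n],
    which contains a rational box around [x]. *)
Lemma open_box (U : set {ptws coord D -> R}) (x : {ptws coord D -> R}) :
  open U -> U x -> exists l, box l x /\ box l `<=` U.
Proof.
move=> oU Ux.
pose C n : set {ptws coord D -> R} := [set y | forall k : coord D,
  (coord_num k < n)%N -> (`|x k - y k| < n.+1%:R^-1)%R].
pose F : set_system {ptws coord D -> R} := [set A | exists n, C n `<=` A].
have CC n m : (n <= m)%N -> C m `<=` C n.
  move=> nm y h k kn; apply: lt_le_trans (h k (leq_trans kn nm)) _.
  by rewrite lef_pV2 ?posrE ?ltr0n// ler_nat ltnS.
have FF : Filter F.
  split.
  - by exists 0%N.
  - move=> A B [n nA] [m mB]; exists (maxn n m) => y Cy; split.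
      by apply: nA; apply: CC Cy; exact: leq_maxl.
    by apply: mB; apply: CC Cy; exact: leq_maxr.
  - by move=> A B AB [n nA]; exists n; exact: subset_trans AB.
have Fx : F --> x.
  apply/cvg_sup => k A; rewrite nbhsE => -[B [[W openW WB] Bx] BA].
  have Wx : W (x k) by move: Bx; rewrite -WB.
  have /nbhs_ballP[e /= e0 eW] : nbhs (x k : R) W by exact: open_nbhs_nbhs.
  exists (maxn (coord_num k).+1 (Num.truncn e^-1)).+1 => y Cy.
  apply: BA; rewrite -WB /=; apply: eW; rewrite /ball /=.
  apply: lt_le_trans (Cy k _) _; first by rewrite ltnS (leq_trans _ (leq_maxl _ _)).
  rewrite -[leRHS]invrK lef_pV2 ?posrE ?ltr0n ?invr_gt0//.
  apply: (le_trans (ltW (truncnS_gt _))); rewrite ler_nat.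
  by rewrite ltnS (leq_trans (leq_maxr (coord_num k).+1 _))// leqnSn.
have [n CU] : F U by apply: Fx; exact: open_nbhs_nbhs.
have /choice[a aP] : forall k : coord D, exists ab : rat * rat,
    (x k - n.+1%:R^-1 < ratr ab.1 < x k)%R /\ (x k < ratr ab.2 < x k + n.+1%:R^-1)%R.
  move=> k; have n0 : (0 < n.+1%:R^-1 :> R)%R by rewrite invr_gt0 ltr0n.
  have [q] : exists q, ratr q \in `]x k - n.+1%:R^-1, x k[%R.
    by apply: rat_in_itvoo; rewrite ltrBlDr ltrDl.
  have [q'] : exists q, ratr q \in `]x k, x k + n.+1%:R^-1[%R.
    by apply: rat_in_itvoo; rewrite ltrDl.
  by rewrite !in_itv /= => h' h; exists (q, q').
pose l := mkseq (fun i => if coord_of_num D i is Some k then a k else (0%R, 0%R)) n.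
have lE k : (coord_num k < n)%N -> nth (0%R, 0%R) l (coord_num k) = a k.
  by move=> kn; rewrite nth_mkseq// coord_numK.
exists l; split.
  move=> k; rewrite size_mkseq => kn; rewrite lE//.
  by have [/andP[_ ->] /andP[->]] := aP k.
move=> y; rewrite /box /= size_mkseq => yl; apply: CU => k kn.
have := yl k kn; rewrite lE//; have [/andP[h1 h2] /andP[h3 h4]] := aP k.
move=> /andP[h5 h6]; rewrite ltr_distl.
apply/andP; split; first by rewrite ltrBlDr (lt_trans h6).
by rewrite -ltrBlDr (lt_trans h1).
Qed.

Lemma measurable_open (U : set {ptws coord D -> R}) : open U ->
  measurable (U : set (state R D)).
Proof.
move=> oU; rewrite (_ : U = \bigcup_l (if pselect (box l `<=` U) then box l else set0)).
  apply: countable_bigcupT_measurable => [|l]; first exact: countableP.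
  by case: pselect => [?|?]; [exact: measurable_box|exact: measurable0].
apply/seteqP; split => y.
  by move=> /(open_box oU)[l [yl lU]]; exists l => //; case: pselect.
by move=> [l _]; case: pselect => // lU; exact: lU.
Qed.

Context d (T : measurableType d) (P : probability T R) (X : T -> state R D).
Hypothesis mX : measurable_fun [set: T] X.

(** Outside the support a point lies in a null box, and there are countably many boxes. Couplings
    given only for states of the support can thus be used almost surely. *)
Lemma support_full : exists N : set (state R D),
  [/\ measurable N, P (X @^-1` N) = 0 & forall x, ~ N x -> law_support P X x].
Proof.
have mXC C : measurable C -> measurable (X @^-1` C).
  by move=> mC; rewrite -[X in measurable X]setTI; exact: mX.
pose B l : set (state R D) := if pselect (P (X @^-1` box l) = 0) then box l else set0.
have mB l : measurable (B l) by rewrite /B; case: pselect => [?|?]; [exact: measurable_box|exact: measurable0].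
exists (\bigcup_l B l); split.
- by apply: countable_bigcupT_measurable => //; exact: countableP.
- pose B' n := if unpickle n is Some l then B l else set0.
  rewrite (_ : \bigcup_l B l = \bigcup_n B' n).
    rewrite preimage_bigcup; apply: null_bigcup => n.
      by apply: mXC; rewrite /B'; case: unpickle.
    rewrite /B'; case: unpickle => [l|]; last by rewrite preimage_set0 measure0.
    by rewrite /B; case: pselect => [//|?]; rewrite preimage_set0 measure0.
  apply/seteqP; split => y [n _].
    by move=> Bn; exists (pickle n); [exact: Logic.I|rewrite /B' pickleK].
  by rewrite /B'; case: unpickle => // l Bl; exists l.
move=> x nN U oU Ux; rewrite lt0e; apply/andP; split; last exact: measure_ge0.
apply/eqP => U0; have [l [lx lU]] := open_box oU Ux.
apply: nN; exists l => //; rewrite /B; case: pselect => // nl; exfalso; apply: nl.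
apply: nullS U0; [exact: mXC _ (measurable_box l)|exact: (mXC _ (measurable_open oU))|].
by move=> w; exact: lU.
Qed.

End Support.

Lemma sig_of_sigma d dv (T : measurableType d) (V : measurableType dv) (X : T -> V) :
  sigma_algebra setT (sig_of X).
Proof. by apply: sigma_algebra_preimage; exact: sigma_algebra_measurable. Qed.

Lemma sig_of_meas d dv (T : measurableType d) (V : measurableType dv) (X : T -> V) :
  measurable_fun [set: T] X -> sig_of X `<=` measurable.
Proof. by move=> mX _ [B mB <-]; exact: mX. Qed.

(** From here on times are counted backwards by natural numbers, so a larger index is an earlier
    time. *)
Definition neg_time (t : nat) : int := (- (t%:Z))%R.

Lemma neg_time_le0 t : (neg_time t <= 0)%R.
Proof. by rewrite /neg_time oppr_le0. Qed.

Lemma neg_timeS t : (neg_time t.+1 + 1)%R = neg_time t.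
Proof. by rewrite /neg_time; lia. Qed.

Lemma neg_timeS_lt0 t : (neg_time t.+1 < 0)%R.
Proof. by rewrite /neg_time; lia. Qed.

Lemma neg_time_le s t : (s <= t)%N -> (neg_time t <= neg_time s)%R.
Proof. by rewrite /neg_time; lia. Qed.

Lemma neg_timeK (n : int) : (n <= 0)%R -> neg_time `|n|%N = n.
Proof. by rewrite /neg_time; lia. Qed.

Section MarkovX.
Context (R : realType) (D : option nat) d (T : measurableType d)
  (P : probability T R) (X : int -> T -> state R D).
Hypothesis mX : forall n : int, (n <= 0)%R -> measurable_fun [set: T] (X n).

(** With all conditional probabilities taken given [X n], that of the intersection is the product of
    [Q] and that of [A]. Since [Q (X n)] is a function of [X n], the conditional probability of [A]
    may be exchanged for the indicator of [A] under the integral. *)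
Lemma markov_step_of_cond_indep (n : int) (Q : R.-pker state R D ~> state R D) :
  (n < 0)%R -> cond_indep P (sig_of (X (n + 1)%R)) (nat_filt X n) (sig_of (X n)) ->
  transition_version P X n Q ->
  markov_step P (nat_filt X n) (X n) (X (n + 1)%R) Q.
Proof.
move=> n0 ci tv A B FA mB.
have mXn : measurable_fun [set: T] (X n) by apply: mX; exact: ltW.
have mXn1 : measurable_fun [set: T] (X (n + 1)%R) by apply: mX; lia.
have sS := sig_of_sigma (X n); have Sm := sig_of_meas mXn.
have mA : measurable A by apply: (@nat_filt_meas _ _ _ _ X mX n) => //; exact: ltW.
have mXB : measurable (X (n + 1)%R @^-1` B).
  by rewrite -[X in measurable X]setTI; exact: mXn1.
have mXBA : measurable (X (n + 1)%R @^-1` B `&` A) by exact: measurableI.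
have vA := tv B mB.
have [YB [YB01 vB]] := version_exists P sS Sm mA.
have [YAB [YAB01 vAB]] := version_exists P sS Sm mXBA.
have SXB : sig_of (X (n + 1)%R) (X (n + 1)%R @^-1` B).
  by exists B => //; rewrite setTI.
have ae := ci _ _ SXB FA _ _ _ vA vB vAB.
have ST : sig_of (X n) setT by exists setT => //; rewrite setTI preimage_setT.
have mYB : measurable_fun [set: T] YB by apply: (sub_measurable_real Sm); case: vB.
have mYA : measurable_fun [set: T] (fun w => fine (Q (X n w) B)).
  by apply: (sub_measurable_real Sm); case: vA.
have mYAB : measurable_fun [set: T] YAB by apply: (sub_measurable_real Sm); case: vAB.
have Q0 w : (0 <= fine (Q (X n w) B))%R by exact: fine_ge0.
have QE w : (fine (Q (X n w) B))%:E = Q (X n w) B.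
  rewrite fineK// ge0_fin_numE// (@le_lt_trans _ _ 1) ?ltry//.
  by rewrite -(@prob_kernel _ _ _ _ _ Q (X n w)) le_measure ?inE.
transitivity (\int[P]_w (YAB w)%:E).
  by have [_ [_ ->//]] := vAB; rewrite setIT setIC.
transitivity (\int[P]_w ((fine (Q (X n w) B))%:E * (YB w)%:E)).
  apply: ge0_ae_eq_integral => //.
  - exact/measurable_EFinP.
  - by apply: emeasurable_funM; exact/measurable_EFinP.
  - by move=> w _; rewrite lee_fin; case/andP: (YAB01 w).
  - by move=> w _; rewrite mule_ge0// lee_fin; case/andP: (YB01 w).
  - by apply: filterS ae => w /= -> _; rewrite EFinM.
rewrite (@integral_sub_ext _ _ _ sS Sm R P YB \1_A); last first.
- by move=> w; rewrite lee_fin.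
- apply/measurable_EFinP; apply/(measurable_subP sS); by case: vA.
- move=> C SC; have [_ [_ ->//]] := vB.
  by rewrite integral_indic//; exact: Sm.
- exact: measurable_indic.
- exact: mYB.
- by move=> w; rewrite indicE.
- by move=> w; case/andP: (YB01 w).
rewrite [RHS]integral_mkcond; apply: eq_integral => w _.
by rewrite patchE QE indicE; case: ifP; rewrite (mule1, mule0).
Qed.

Variable Q : nat -> R.-pker state R D ~> state R D.
Hypothesis XQ : forall t, markov_step P (nat_filt X (neg_time t.+1))
  (X (neg_time t.+1)) (X (neg_time t)) (Q t).
Hypothesis tail_law : forall n : int, (n <= 0)%R ->
  forall B : set (state R D), measurable B -> forall Y : T -> R,
  cond_prob_version P (tail_sig (nat_filt X)) (X n @^-1` B) Y ->
  {ae P, forall w, Y w = fine (P (X n @^-1` B))}.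

(* The conditional probability of [X_{-s} \in B] given the state at time [-t]. *)
Definition hit_prob (s : nat) (B : set (state R D)) : nat -> state R D -> \bar R :=
  backward Q (fun t => if t == s then B else setT).

Let m_hit (s : nat) (B : set (state R D)) : measurable B ->
  forall t, measurable (if t == s then B else [set: state R D]).
Proof. by move=> mB t; case: ifP. Qed.

Lemma hit_prob_meas s B t : measurable B ->
  measurable_fun setT (hit_prob s B t).
Proof. by move=> mB; have [] := backward_meas Q (m_hit s mB) t. Qed.

Lemma hit_prob01 s B t x : measurable B -> 0 <= hit_prob s B t x <= 1.
Proof. by move=> mB; have [_ h] := backward_meas Q (m_hit s mB) t; exact: h. Qed.

Lemma hit_prob_fineK s B t x : measurable B ->
  (fine (hit_prob s B t x))%:E = hit_prob s B t x.
Proof.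
move=> mB; have /andP[h0 h1] := hit_prob01 s t x mB.
by rewrite fineK// ge0_fin_numE// (le_lt_trans h1)// ltry.
Qed.

(** By the Markov property [hit_prob] evaluated along the process is the conditional probability of
    [X (neg_time s) \in B] given a more and more remote past, a reverse martingale; the hypothesis
    on the tail identifies its limit. *)
Lemma hit_prob_cvg (s : nat) (B : set (state R D)) (e : R) : measurable B ->
  (0 < e)%R -> exists r0, forall r, (r0 <= r)%N ->
  \int[P]_w `|fine (hit_prob s B r (X (neg_time r) w)) -
              fine (P (X (neg_time s) @^-1` B))|%:E <= e%:E.
Proof.
move=> mB e0.
have mXt t : measurable_fun [set: T] (X (neg_time t)) by apply: mX; exact: neg_time_le0.
(* The shift by [s] starts the martingale at time [-s]: for [t < s] the recursion meets only [setT]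
   and says nothing about that time. *)
pose F t := nat_filt X (neg_time (t + s)%N).
pose M t w := fine (hit_prob s B (t + s)%N (X (neg_time (t + s)%N) w)).
have tailE : [set A | forall r, F r A] = tail_sig (nat_filt X).
  apply/seteqP; split => A h.
    move=> n n0; apply: (@nat_filt_le _ _ _ _ X _ _ _ _ (h `|n|%N)).
    by rewrite /neg_time; lia.
  by move=> r; apply: h; exact: neg_time_le0.
have [||||||||r0 hr0] := @reverse_martingale _ T R P F (X (neg_time s) @^-1` B) M _ _ _ _ _ _ _ _ e e0.
- by move=> r; exact: nat_filt_sigma.
- by move=> r; apply: nat_filt_meas => //; exact: neg_time_le0.
- by move=> r; apply: nat_filt_le; apply: neg_time_le; rewrite addSn.
- by rewrite -[X in measurable X]setTI; exact: mXt.
- move=> r w; have /andP[h0 h1] := hit_prob01 s (r + s)%N (X (neg_time (r + s)%N) w) mB.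
  by rewrite -!lee_fin hit_prob_fineK// h0.
- move=> r C mC; apply: (@nat_filt_coord _ _ _ _ X (neg_time (r + s)%N) _
     ((fine \o hit_prob s B (r + s)%N) @^-1` C)) => //.
  rewrite -[X in measurable X]setTI.
  by apply: (measurableT_comp (@fine_measurable R setT measurableT) (hit_prob_meas _ _ mB)).
- move=> r A FA; under eq_integral do rewrite /M hit_prob_fineK//.
  rewrite -(@backward_prob _ _ _ Q _ (m_hit s mB) _ T P (fun t => X (neg_time t))
    (fun t => nat_filt X (neg_time t)) (r + s)%N)//.
  + rewrite setIC; congr (P (_ `&` _)); apply/seteqP; split => w /=.
      by move=> /(_ s (leq_addl _ _)); rewrite eqxx.
    by move=> Bw t _; case: eqP => [->|].
  + by move=> t; exact: nat_filt_sigma.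
  + by move=> t; apply: nat_filt_meas => //; exact: neg_time_le0.
  + by move=> t; apply: nat_filt_le; exact: neg_time_le.
  + by move=> t C _ mC; exact: nat_filt_coord.
- by move=> Y; rewrite tailE; apply: tail_law => //; exact: neg_time_le0.
exists (r0 + s)%N => r rs; have := hr0 (r - s)%N; rewrite /M subnK.
  by apply; rewrite leq_subRL ?(leq_trans _ rs) ?leq_addl// addnC.
by rewrite (leq_trans _ rs)// leq_addl.
Qed.

End MarkovX.

(** * Markov steps driven by a fresh uniform variable *)

Section TransferSub.
Context (R : realType) (D : option nat) d (T : measurableType d)
  (P : probability T R).
Variables (H H' : set (set T)) (U : T -> R).
Hypotheses (sH : sigma_algebra setT H) (sH' : sigma_algebra setT H')
  (HH' : H `<=` H') (H'm : H' `<=` measurable)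
  (H'U : forall B, measurable B -> H' (U @^-1` B))
  (indU : forall A B, H A -> measurable B ->
     P (A `&` U @^-1` B) = P A * unif R B).

(** [transfer] is run on the space equipped with [H'] alone, so the variable it yields is measurable
    for [H']. *)
Lemma transfer_sub dV (V : measurableType dV) (W : T -> V)
    (lam : probability (V * state R D)%type R) :
  (forall B, measurable B -> H (W @^-1` B)) ->
  (forall A, measurable A -> P (W @^-1` A) = lam (A `*` setT)) ->
  exists Y : T -> state R D, (forall B, measurable B -> H' (Y @^-1` B)) /\
    forall A B, measurable A -> measurable B ->
      P (W @^-1` A `&` Y @^-1` B) = lam (A `*` B).
Proof.
move=> HW WE.
have mW : measurable_fun [set: g_sigma_algebraType H'] (W : g_sigma_algebraType H' -> V).
  by apply/measurable_subP => // B mB; exact/HH'/HW.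
have mU : measurable_fun [set: g_sigma_algebraType H'] (U : g_sigma_algebraType H' -> R).
  by apply/measurable_subP.
have [|Y [mY YE]] := @transfer R D _ V lam _ (g_sigma_algebraType H')
    (restr sH' H'm P) W U mW mU.
  by move=> A B mA mB; rewrite restrE indU ?WE//; exact: HW.
exists Y; split; first exact/measurable_subP.
exact: YE.
Qed.

Variable G : set (set T).
Hypotheses (sG : sigma_algebra setT G) (GH : G `<=` H).

Let Gm : G `<=` measurable. Proof. by move=> A /GH/HH'/H'm. Qed.

(** The conditioning variable is the identity into the space equipped with [G], not [x]: this gives
    the law of [y] given all of [G]. *)
Lemma step_free d1 (S1 : measurableType d1) (x : T -> S1)
    (Q : R.-pker S1 ~> state R D) :
  (forall B, measurable B -> G (x @^-1` B)) ->
  exists y : T -> state R D, (forall B, measurable B -> H' (y @^-1` B)) /\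
    markov_step P G x y Q.
Proof.
move=> Gx.
have mx : measurable_fun [set: g_sigma_algebraType G] (x : g_sigma_algebraType G -> S1).
  by apply/measurable_subP.
have [||y [H'y yE]] := @transfer_sub _ (g_sigma_algebraType G) id
    (mixture (restr sG Gm P) (kpre mx Q)).
- by move=> B; rewrite measurable_subE// => /GH.
- move=> A mA; rewrite mixture_prod//.
  under eq_integral do rewrite kpreE (@prob_kernel _ _ _ _ _ Q).
  by rewrite integral_cst// mul1e.
exists y; split => // A B GA mB.
have mA : measurable (A : set (g_sigma_algebraType G)) by rewrite measurable_subE.
rewrite -[A in LHS]/(id @^-1` A) yE// mixture_prod// integral_restr//.
exact: measurableT_comp (measurable_kernel Q B mB) mx.
Qed.

(** Here [y] is already built. The triple [(w, y, y')], with [w] seen through [G], must follow the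
    mixture by [C]; the assumption on [y] says that [(w, y)] has the right marginal, so only [y']
    has to be drawn, given that pair. *)
Lemma step_couple (x x' y : T -> state R D)
    (C : R.-pker (state R D * state R D)%type ~> (state R D * state R D)%type) :
  (forall B, measurable B -> G (x @^-1` B)) ->
  (forall B, measurable B -> G (x' @^-1` B)) ->
  (forall B, measurable B -> H (y @^-1` B)) ->
  (forall A B, G A -> measurable B ->
    P (A `&` y @^-1` B) = \int[P]_(w in A) C (x w, x' w) (B `*` setT)) ->
  exists y' : T -> state R D, (forall B, measurable B -> H' (y' @^-1` B)) /\
    markov_step P G (fun w => (x w, x' w)) (fun w => (y w, y' w)) C.
Proof.
move=> Gx Gx' Hy xyC.
have mxx : measurable_fun [set: g_sigma_algebraType G]
    ((fun w => (x w, x' w)) : g_sigma_algebraType G -> (state R D * state R D)%type).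
  by apply: measurable_fun_pair; apply/measurable_subP.
pose lam0 := mixture (restr sG Gm P) (kpre mxx C).
pose reass (z : g_sigma_algebraType G * (state R D * state R D)) :
  (g_sigma_algebraType G * state R D) * state R D := ((z.1, z.2.1), z.2.2).
have mreass : measurable_fun setT reass.
  apply: measurable_fun_pair.
    apply: measurable_fun_pair => //.
    exact: measurableT_comp measurable_fst measurable_snd.
  exact: measurableT_comp measurable_snd measurable_snd.
pose lam := law lam0 mreass.
have lam0E A E : G A -> measurable E ->
    lam0 (A `*` E) = \int[P]_(w in A) C (x w, x' w) E.
  move=> GA mE.
  have mA : measurable (A : set (g_sigma_algebraType G)) by rewrite measurable_subE.
  rewrite /lam0 mixture_prod// integral_restr//.
  exact: measurableT_comp (measurable_kernel C E mE) mxx.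
pose W w : g_sigma_algebraType G * state R D := (w, y w).
have mWH : measurable_fun [set: g_sigma_algebraType H] (W : g_sigma_algebraType H -> _).
  apply: measurable_fun_pair; last exact/measurable_subP.
  by apply/measurable_subP => // B; rewrite measurable_subE// => /GH.
have HW B : measurable B -> H (W @^-1` B) by move/measurable_subP : mWH; apply.
have Hm : H `<=` measurable by move=> A /HH'/H'm.
have mWT : measurable_fun [set: T] W by move=> _ B mB; rewrite setTI; exact/Hm/HW.
have WE A : measurable A -> P (W @^-1` A) = lam (A `*` setT).
  move=> mA; rewrite -(lawE P mWT).
  transitivity (law lam measurable_fst A); last first.
    by rewrite lawE; congr (lam _); apply/seteqP; split => -[? ?] //= [].
  apply: prob_eq_prod => //.
    by apply: (le_lt_trans (probability_le1 (law P mWT) measurableT)); exact: ltry.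
  move=> B C' mB mC'; have GB : G B by rewrite -(measurable_subE sG).
  rewrite -[LHS]/(P (B `&` y @^-1` C')) xyC// -lam0E//; last exact: measurableX.
  rewrite -[RHS]/(lam0 (reass @^-1` (fst @^-1` (B `*` C')))); congr (lam0 _).
  by apply/seteqP; split => -[w [z z']] /=; [move=> [? []]|move=> []].
have [y' [H'y' y'E]] := transfer_sub HW WE.
exists y'; split => // A E GA mE.
have my' : measurable_fun [set: T] y'.
  by move=> _ B mB; rewrite setTI; exact/H'm/H'y'.
have mWy : measurable_fun [set: T] (fun w => (W w, y' w)) by exact: measurable_fun_pair.
have lawWy B : measurable B -> law P mWy B = lam B.
  apply: prob_eq_prod => //.
    by apply: (le_lt_trans (probability_le1 (law P mWy) measurableT)); exact: ltry.
have mA : measurable (A : set (g_sigma_algebraType G)) by rewrite measurable_subE.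
pose B : set ((g_sigma_algebraType G * state R D) * state R D) :=
  [set z | A z.1.1 /\ E (z.1.2, z.2)].
have mB : measurable B.
  pose f1 (z : (g_sigma_algebraType G * state R D) * state R D) := z.1.1.
  pose f2 (z : (g_sigma_algebraType G * state R D) * state R D) := (z.1.2, z.2).
  have mf1 : measurable_fun setT f1 by exact: measurableT_comp measurable_fst measurable_fst.
  have mf2 : measurable_fun setT f2.
    apply: measurable_fun_pair => //.
    exact: measurableT_comp measurable_snd measurable_fst.
  rewrite (_ : B = (setT `&` f1 @^-1` A) `&` (setT `&` f2 @^-1` E)).
    by apply: measurableI; [exact: mf1|exact: mf2].
  by rewrite !setTI.
rewrite -lam0E//.
transitivity (law P mWy B); first by [].
rewrite lawWy// -[LHS]/(lam0 (reass @^-1` B)); congr (lam0 _).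
by apply/seteqP; split => -[w [z z']] /=.
Qed.

End TransferSub.

Local Close Scope ereal_scope.

(** * Limits of random variables with a common law *)

Local Open Scope ereal_scope.

Section SetLimit.
Context d (T : measurableType d) (R : realType) (P : probability T R).
Implicit Types (F : nat -> set T) (A B E : set T).

(** Convergence in probability of indicators. *)
Definition set_lim F E : Prop := forall e : R, (0 < e)%R ->
  exists n, forall K, (n <= K)%N -> P (F K `+` E) <= e%:E.

Lemma measurable_setY A B : measurable A -> measurable B -> measurable (A `+` B).
Proof. by move=> mA mB; apply: measurableU; exact: measurableD. Qed.

Lemma prob_setY_le A B E : measurable A -> measurable B -> measurable E ->
  P (A `&` B) <= P (A `&` E) + P (B `+` E).
Proof.
move=> mA mB mE; apply: le_trans (prob_U2 P _ (measurable_setY mB mE)).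
  apply: prob_le; [exact: measurableI| |].
    by apply: measurableU; [exact: measurableI|exact: measurable_setY].
  move=> w [Aw Bw]; have [Ew|Ew] := pselect (E w); first by left.
  by right; left.
exact: measurableI.
Qed.

Lemma set_limC F E : set_lim F E -> set_lim (fun K => ~` F K) (~` E).
Proof.
move=> FE e /FE[n h]; exists n => K /h; congr (P _ <= _).
by apply/seteqP; split => w /=; have [?|?] := pselect (F K w);
  have [?|?] := pselect (E w); tauto.
Qed.

Lemma set_limI F F' E E' : (forall K, measurable (F K)) -> (forall K, measurable (F' K)) ->
  measurable E -> measurable E' -> set_lim F E -> set_lim F' E' ->
  set_lim (fun K => F K `&` F' K) (E `&` E').
Proof.
move=> mF mF' mE mE' FE FE' e e0.
have e20 : (0 < e / 2)%R by rewrite divr_gt0.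
have [n h] := FE _ e20; have [n' h'] := FE' _ e20; exists (maxn n n') => K Kn.
rewrite [in leRHS](splitr e) EFinD.
apply: (le_trans _ (leeD (h K (leq_trans (leq_maxl _ _) Kn)) (h' K (leq_trans (leq_maxr _ _) Kn)))).
have mY := measurable_setY (mF K) mE; have mY' := measurable_setY (mF' K) mE'.
apply: le_trans (prob_U2 P mY mY'); apply: prob_le.
- by apply: measurable_setY; exact: measurableI.
- exact: measurableU.
- by move=> w /=; have [?|?] := pselect (F K w); have [?|?] := pselect (E w);
    have [?|?] := pselect (F' K w); have [?|?] := pselect (E' w); tauto.
Qed.

Lemma set_lim_prob F E (c : \bar R) : (forall K, measurable (F K)) -> measurable E ->
  set_lim F E -> (forall K, P (F K) = c) -> P E = c.
Proof.
move=> mF mE FE Fc; apply/eqP; rewrite eq_le; apply/andP; split.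
  apply/lee_addgt0Pr => e /FE[n h]; rewrite -(Fc n).
  apply: (le_trans _ (leeD (lexx _) (h n (leqnn n)))).
  have := prob_setY_le measurableT mE (mF n); rewrite !setTI setYC; exact.
apply/lee_addgt0Pr => e /FE[n h]; rewrite -(Fc n).
apply: (le_trans _ (leeD (lexx _) (h n (leqnn n)))).
by have := prob_setY_le measurableT (mF n) mE; rewrite !setTI; exact.
Qed.

Lemma set_lim_null F E E' : (forall K, measurable (F K)) -> measurable E -> measurable E' ->
  P (E `\` E') = 0 -> P (E' `\` E) = 0 -> set_lim F E -> set_lim F E'.
Proof.
move=> mF mE mE' EE' E'E FE e /FE[n h]; exists n => K /h; apply: le_trans.
have mY := measurable_setY (mF K) mE; have mN := measurable_setY mE mE'.
have N0 : P (E `+` E') = 0.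
  by apply: nullU; [exact: measurableD|exact: measurableD| |].
apply: (@le_trans _ _ (P ((F K `+` E) `|` (E `+` E')))).
  apply: prob_le; [exact: measurable_setY|exact: measurableU|].
  by move=> w /=; have [?|?] := pselect (F K w); have [?|?] := pselect (E w);
    have [?|?] := pselect (E' w); tauto.
by apply: (le_trans (prob_U2 P mY mN)); rewrite N0 adde0.
Qed.

Lemma prob_vanish (F : nat -> set T) : (forall n, measurable (F n)) ->
  nonincreasing_seq F -> \bigcap_n F n = set0 ->
  forall e : R, (0 < e)%R -> exists n, P (F n) <= e%:E.
Proof.
move=> mF niF F0 e e0; apply: contrapT => h.
have : P (F n) @[n --> \oo] --> P (\bigcap_n F n).
  apply: nonincreasing_cvg_mu => //; last exact: bigcapT_measurable.
  by rewrite prob_lty.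
rewrite F0 measure0 => F0'.
have : (e%:E <= 0)%E.
  rewrite -(cvg_lim _ F0')//; apply: lime_ge; first by apply/cvg_ex; exists 0.
  by apply: nearW => n; rewrite leNgt; apply/negP => ln; apply: h; exists n; exact: ltW.
by rewrite lee_fin leNgt e0.
Qed.

Lemma set_lim_shift (F : nat -> set T) E m :
  set_lim F E -> set_lim (fun K => F (K + m)%N) E.
Proof.
move=> FE e /FE[n h]; exists n => K nK; apply: h.
by rewrite (leq_trans nK)// leq_addr.
Qed.

End SetLimit.

Section LawLimit.
Context (R : realType) (D : option nat) d (T : measurableType d)
  (P : probability T R) (mu : probability (state R D) R).
Variable V : nat -> T -> state R D.
Hypotheses (mV : forall K, measurable_fun [set: T] (V K))
  (Vmu : forall K B, measurable B -> P (V K @^-1` B) = mu B)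
  (Vc : forall k q, exists n, forall K, (n <= K)%N ->
    P (V K @^-1` @ray R D k q `\` V K.+1 @^-1` @ray R D k q) +
    P (V K.+1 @^-1` @ray R D k q `\` V K @^-1` @ray R D k q) <= (half_pow R K)%:E).

Let mVB K B : measurable B -> measurable (V K @^-1` B).
Proof. by move=> mB; rewrite -[X in measurable X]setTI; exact: mV. Qed.

Let E k q := limsup_set (fun K => V K @^-1` @ray R D k q).

Let mE k q : measurable (E k q).
Proof. by apply: measurable_limsup_set => K; apply: mVB; exact: measurable_ray. Qed.

Let E_lim k q : set_lim P (fun K => V K @^-1` @ray R D k q) (E k q).
Proof.
move=> e e0; have [n hn] := Vc k q.
have mr K : measurable (V K @^-1` @ray R D k q) by apply: mVB; exact: measurable_ray.
have e40 : (0 < e / 4)%R by rewrite divr_gt0.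
have [m hm] := @half_pow_cvg R _ e40.
exists (maxn n m) => K Kn.
have [h1 h2] := limsup_set_close mr hn (leq_trans (leq_maxl _ _) Kn).
have := hm K (leq_trans (leq_maxr _ _) Kn) => hK.
apply: (le_trans (prob_U2 P (measurableD (mr K) (mE k q)) (measurableD (mE k q) (mr K)))).
apply: (le_trans (leeD h1 h2)); rewrite -EFinD lee_fin; lra.
Qed.

(** Convergence on rays passes to finite intersections, then to all measurable sets by a Dynkin
    argument. For a countable disjoint union, truncation costs the [mu]-mass of the remainder, the
    same for every [V K] and for the limit since all have law [mu]. *)
Lemma law_limit : exists X : T -> state R D,
  [/\ measurable_fun [set: T] X, forall B, measurable B -> P (X @^-1` B) = mu B &
    forall B, measurable B -> set_lim P (fun K => V K @^-1` B) (X @^-1` B)].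
Proof.
have mr k q := @measurable_ray R D k q.
have PE k q : P (E k q) = mu (@ray R D k q).
  apply: (set_lim_prob (fun K => mVB K (mr k q))) (E_lim k q) _ => // K; exact: Vmu.
have PED k q q' : (q <= q')%R -> P (E k q `\` E k q') = 0.
  move=> qq'; rewrite (_ : _ `\` _ = set0) ?measure0//.
  apply/seteqP; split => w //= [h]; apply; move: h; apply: limsup_setS => K y.
  by rewrite /ray /= => /le_trans; apply; rewrite ler_rat.
have [X [mX XE]] := realize_events mE PE PED.
have mXB B : measurable B -> measurable (X @^-1` B).
  by move=> mB; rewrite -[X in measurable X]setTI; exact: mX.
have Xr k q : set_lim P (fun K => V K @^-1` @ray R D k q) (X @^-1` @ray R D k q).
  have [h h'] := XE k q.
  exact: (set_lim_null (fun K => mVB K (mr k q)) (mE k q) (mXB _ (mr k q)) h' h (E_lim k q)).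
have XT : set_lim P (fun K => V K @^-1` setT) (X @^-1` setT).
  by move=> e e0; exists 0%N => K _; rewrite !preimage_setT setYK measure0 lee_fin ltW.
have Xb n s : set_lim P (fun K => V K @^-1` @bits_inter R D n s) (X @^-1` @bits_inter R D n s).
  elim: n => [|n IH].
    by rewrite (_ : @bits_inter R D 0 s = setT)//; apply/seteqP; split.
  pose b := if s n then @bit R D n else setT.
  have mb : measurable b by rewrite /b; case: ifP => // _; exact: measurable_bit.
  have -> : @bits_inter R D n.+1 s = @bits_inter R D n s `&` b.
    apply/seteqP; split => y.
      move=> h; split; first by move=> i ni; apply: h; exact: leqW.
      by rewrite /b; case: ifP => // sn; exact: h.
    move=> [h bn] i; rewrite ltnS leq_eqVlt => /orP[/eqP -> sn|]; last exact: h.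
    by move: bn; rewrite /b sn.
  apply: (set_limI _ _ _ _ IH); try by move=> *; first [apply: mVB|apply: mXB];
    first [exact: measurable_bits_inter|exact: mb].
  rewrite /b; case: ifP => // _.
  by case: (@bitP R D n) => [->//|[k [q ->]]]; exact: Xr.
have Xmu B : measurable B -> P (X @^-1` B) = mu B.
  move=> mB; rewrite -[LHS]/(law P mX B).
  apply: (prob_eq (bits_sys_gen R D) (@bits_sysI R D)) => //.
  - exact: (etrans (@probability_setT _ _ _ (law P mX)) (esym (@probability_setT _ _ _ mu))).
  - by apply: (le_lt_trans (probability_le1 (law P mX) measurableT)); exact: ltry.
  move=> _ [n [s ->]]; have mbi := @measurable_bits_inter R D n s.
  exact: (set_lim_prob (fun K => mVB K mbi) (mXB _ mbi) (Xb n s) (fun K => Vmu K mbi)).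
exists X; split => // B mB.
have : <<s @bits_sys R D >> B by rewrite -(bits_sys_gen R D).
move: B {mB}; apply: (dynkin_induction (bits_sys_gen R D) (@bits_sysI R D)) => //.
- by move=> _ [n [s ->]]; exact: Xb.
- by move=> S mS; exact: set_limC.
move=> F mF tF IH e e0.
have mUF : measurable (\bigcup_k F k) by exact: bigcupT_measurable.
pose W n := \bigcup_(k in [set k | (k < n)%N]) F k.
have mW n : measurable (W n) by apply: bigcup_measurable.
have W_lim n : set_lim P (fun K => V K @^-1` W n) (X @^-1` W n).
  elim: n => [|n IHn].
    rewrite (_ : W 0%N = set0); last by apply/seteqP; split => // y [].
    by move=> e' e'0; exists 0%N => K _; rewrite !preimage_set0 setYK measure0 lee_fin ltW.
  have -> : W n.+1 = ~` (~` W n `&` ~` F n).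
    rewrite -setCU setCK; apply/seteqP; split => y.
      move=> [k /=]; rewrite ltnS leq_eqVlt => /orP[/eqP -> Fy|kn Fy]; first by right.
      by left; exists k.
    by move=> [[k /= kn Fy]|Fy]; [exists k => //=; exact: ltnW|exists n => /=].
  have mC (S : set (state R D)) : measurable S -> measurable (~` S) by exact: measurableC.
  have := set_limC (set_limI (fun K => mVB K (mC _ (mW n))) (fun K => mVB K (mC _ (mF n)))
    (mXB _ (mC _ (mW n))) (mXB _ (mC _ (mF n))) (set_limC IHn) (set_limC (IH n))).
  exact.
have e40 : (0 < e / 4)%R by rewrite divr_gt0.
have mUW n : measurable (\bigcup_k F k `\` W n) by exact: measurableD.
have [n hn] : exists n, mu (\bigcup_k F k `\` W n) <= (e / 4)%:E.
  apply: (@prob_vanish _ _ _ mu _ mUW _ _ _ e40).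
    move=> i j ij; apply/subsetPset; apply: setDS => y [k /= ki Fy].
    by exists k => //=; exact: leq_trans ij.
  apply/seteqP; split => // y h.
  have [[k _ Fy] _] := h 0%N Logic.I.
  by have [_] := h k.+1 Logic.I; apply; exists k => /=.
have [m hm] := W_lim n _ (divr_gt0 e40 (ltr0n _ 1)).
rewrite divr1 in hm.
exists m => K /hm hK.
have mY : measurable (V K @^-1` W n `+` X @^-1` W n).
  by apply: measurable_setY; [exact: mVB|exact: mXB].
have mVU := mVB K (mUW n); have mXU := mXB _ (mUW n).
apply: (@le_trans _ _ (P ((V K @^-1` (\bigcup_k F k `\` W n)) `|`
   ((X @^-1` (\bigcup_k F k `\` W n)) `|` (V K @^-1` W n `+` X @^-1` W n))))).
  apply: prob_le.
  - by apply: measurable_setY; [exact: mVB|exact: mXB].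
  - by apply: measurableU => //; exact: measurableU.
  - have WF : W n `<=` \bigcup_k F k by move=> y [k _ Fy]; exists k.
    move=> w /=; have := @WF (V K w); have := @WF (X w).
    have [?|?] := pselect (W n (V K w)); have [?|?] := pselect (W n (X w)); tauto.
apply: (le_trans (prob_U2 P mVU (measurableU _ _ mXU mY))).
apply: (le_trans (leeD (lexx _) (prob_U2 P mXU mY))).
apply: (@le_trans _ _ ((e / 4)%:E + ((e / 4)%:E + (e / 4)%:E))).
  apply: leeD; first by rewrite Vmu.
  by apply: leeD => //; rewrite Xmu.
by rewrite -!EFinD lee_fin; lra.
Qed.

End LawLimit.

(** For [z <= n] the sum counts the positive integers not exceeding [z], so it is the integer part
    of [z]. *)
Lemma level_sum (R : realType) (n : nat) (z : R) : (0 <= z)%R ->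
  (\sum_(i < n) ((i.+1%:R <= z)%R : nat)%:R <= z)%R /\
  ((z <= n%:R)%R -> (z <= \sum_(i < n) ((i.+1%:R <= z)%R : nat)%:R + 1)%R).
Proof.
move=> z0; have le_n m : (\sum_(i < m) ((i.+1%:R <= z)%R : nat)%:R <= m%:R :> R)%R.
  rewrite -[X in (_ <= X%:R)%R]card_ord -sum1_card natr_sum; apply: ler_sum => i _.
  by rewrite ler_nat; case: (_ <= _)%R.
elim: n => [|n [IH1 IH2]]; first by rewrite big_ord0; split => // zn; rewrite add0r (le_trans zn).
rewrite big_ord_recr /=; have [nz|zn] := leP n.+1%:R%R z.
  split => [|zn']; first by apply: le_trans nz; rewrite -natr1; exact: lerD (le_n n) (lexx _).
  rewrite (le_trans zn')//.
  have -> : (\sum_(i < n) ((i.+1%:R <= z)%R : nat)%:R = n%:R :> R)%R.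
    rewrite -[RHS]/(n%:R)%R -[X in _ = X%:R%R]card_ord -sum1_card natr_sum.
    by apply: eq_bigr => i _; rewrite (le_trans _ nz)// ler_nat; exact: leqW.
  by rewrite natr1 lerDl.
rewrite addr0; split => // _.
have [zn'|nz] := leP z n%:R%R; first exact: IH2.
have -> : (\sum_(i < n) ((i.+1%:R <= z)%R : nat)%:R = n%:R :> R)%R.
  rewrite -[X in _ = X%:R%R]card_ord -sum1_card natr_sum.
  by apply: eq_bigr => i _; rewrite (le_trans _ (ltW nz))// ler_nat.
by rewrite natr1 ltW.
Qed.

(** * Passing to the limit in integrals and Markov steps *)

Section IntegralLimit.
Context d dS (T : measurableType d) (S : measurableType dS) (R : realType)
  (P : probability T R).

(** Layer-cake discretisation: [f] exceeds the average of the indicators of its [N.+1] level sets by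
    at most [1/(N+1)], and averaging the hypothesis over the levels costs [e]. *)
Lemma integral_level (A : set T) (V X : T -> S) (f : S -> R) (N : nat) (e : R) :
  measurable A -> measurable_fun [set: T] V -> measurable_fun [set: T] X ->
  measurable_fun [set: S] f -> (forall x, 0 <= f x <= 1)%R ->
  (forall i : 'I_N.+1, let B := [set x | (i.+1%:R <= f x * N.+1%:R)%R] in
     P (A `&` V @^-1` B) <= P (A `&` X @^-1` B) + e%:E) ->
  \int[P]_(w in A) (f (V w))%:E <= \int[P]_(w in A) (f (X w))%:E + (N.+1%:R^-1 + e)%:E.
Proof.
move=> mA mV mX mf f01 VX.
pose B (i : nat) : set S := [set x | (i.+1%:R <= f x * N.+1%:R)%R].
have mB i : measurable (B i).
  rewrite /B -[X in measurable X]setTI; apply: measurable_fun_ler => //.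
  exact: measurable_funM.
pose a : R := (N.+1%:R^-1)%R.
have a0 : (0 < a)%R by rewrite invr_gt0 ltr0n.
pose s x : R := (\sum_(i < N.+1) a * \1_(B i) x)%R.
have sE x : (s x = a * \sum_(i < N.+1) ((i.+1%:R <= f x * N.+1%:R)%R : nat)%:R)%R.
  rewrite /s mulr_sumr; apply: eq_bigr => i _; congr (_ * _)%R.
  by rewrite indicE; congr (_%:R)%R; congr nat_of_bool; apply/idP/idP; rewrite inE.
have fN x : (0 <= f x * N.+1%:R)%R by rewrite mulr_ge0//; case/andP: (f01 x).
have sf x : (s x <= f x)%R.
  rewrite sE mulrC ler_pdivrMr ?ltr0n//.
  by have [] := level_sum N.+1 (fN x).
have fs x : (f x <= s x + a)%R.
  rewrite sE -{2}(mulr1 a) -mulrDr mulrC ler_pdivlMr ?ltr0n//.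
  have [_] := level_sum N.+1 (fN x); apply.
  by rewrite -{2}(mul1r N.+1%:R%R) ler_wpM2r//; case/andP: (f01 x).
have ms : measurable_fun [set: S] s.
  apply: measurable_sum => i; apply: measurable_funM => //.
have s0 x : (0 <= s x)%R by apply: sumr_ge0 => i _; rewrite mulr_ge0// ltW.
have sint (Y : T -> S) : measurable_fun [set: T] Y ->
    \int[P]_(w in A) (s (Y w))%:E = \sum_(i < N.+1) a%:E * P (A `&` Y @^-1` B i).
  move=> mY; under eq_integral do rewrite /s -sumEFin.
  rewrite ge0_integral_sum//; last 2 first.
  - move=> i; apply/measurable_EFinP/measurable_funTS.
    apply: (@measurableT_comp _ _ _ _ _ _ (fun x => a * \1_(B i) x)%R) => //.
    by apply: measurable_funM => //; exact: measurable_indic.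
  - by move=> i w _; rewrite lee_fin mulr_ge0// ltW.
  apply: eq_bigr => i _; under eq_integral do rewrite EFinM.
  have mYB : measurable (Y @^-1` B i) by rewrite -[X in measurable X]setTI; exact: mY.
  rewrite ge0_integralZl//; last 2 first.
  - by apply/measurable_EFinP/measurable_funTS; apply: (measurableT_comp (measurable_indic (mB i))).
  - by rewrite lee_fin ltW.
  congr (_ * _); rewrite setIC -integral_indic//.
have mc (Y : T -> S) (g : S -> R) : measurable_fun [set: T] Y -> measurable_fun [set: S] g ->
    measurable_fun A (fun w => (g (Y w))%:E).
  by move=> mY mg; apply/measurable_EFinP/measurable_funTS; exact: measurableT_comp.
have PA0 : P A <= 1 by exact: probability_le1.
apply: (@le_trans _ _ (\int[P]_(w in A) (s (V w))%:E + a%:E)).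
  apply: (@le_trans _ _ (\int[P]_(w in A) ((s (V w))%:E + a%:E))).
    apply: ge0_le_integral => //.
    + by move=> w _; rewrite lee_fin; case/andP: (f01 (V w)).
    + exact: mc.
    + by apply: emeasurable_funD => //; exact: mc.
    + by move=> w _; rewrite -EFinD lee_fin.
  rewrite ge0_integralD//; last 3 first.
  - by move=> w _; rewrite lee_fin.
  - exact: mc.
  - by move=> w _; rewrite lee_fin ltW.
  rewrite leeD2l// integral_cst// -[leRHS]mule1 lee_pmul2l//.
rewrite [(N.+1%:R^-1 + e)%R]addrC EFinD addeA; apply: leeD => //.
apply: (@le_trans _ _ (\int[P]_(w in A) (s (X w))%:E + e%:E)); last first.
  rewrite leeD2r//; apply: ge0_le_integral => //; try exact: mc.
  - by move=> w _; rewrite lee_fin.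
  - by move=> w _; rewrite lee_fin.
rewrite !sint//.
apply: (@le_trans _ _ (\sum_(i < N.+1) a%:E * (P (A `&` X @^-1` B i) + e%:E))).
  by apply: lee_sum => i _; rewrite lee_pmul2l ?lte_fin//; exact: VX.
under eq_bigr do rewrite muleDr// ?fin_num_adde_defl// -EFinM.
rewrite big_split/= sumEFin sumr_const card_ord leeD2l// lee_fin.
by rewrite -mulr_natl mulrA divff ?mul1r// pnatr_eq0.
Qed.

Lemma integral_lim (A : set T) (V : nat -> T -> S) (X : T -> S) (f : S -> R) :
  measurable A -> (forall K, measurable_fun [set: T] (V K)) -> measurable_fun [set: T] X ->
  measurable_fun [set: S] f -> (forall x, 0 <= f x <= 1)%R ->
  (forall B, measurable B -> set_lim P (fun K => V K @^-1` B) (X @^-1` B)) ->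
  forall e : R, (0 < e)%R -> exists n, forall K, (n <= K)%N ->
    \int[P]_(w in A) (f (V K w))%:E <= \int[P]_(w in A) (f (X w))%:E + e%:E /\
    \int[P]_(w in A) (f (X w))%:E <= \int[P]_(w in A) (f (V K w))%:E + e%:E.
Proof.
move=> mA mV mX mf f01 VX e e0.
have e20 : (0 < e / 2)%R by rewrite divr_gt0.
(* Half of [e] pays for the discretisation, the other half for the symmetric differences of the
   level sets. *)
pose N := Num.truncn (e / 2)^-1.
have Ne : (N.+1%:R^-1 + e / 2 <= e)%R.
  rewrite [leRHS](splitr e) lerD2r -[leRHS]invrK lef_pV2 ?posrE ?ltr0n ?invr_gt0//.
  exact: (ltW (truncnS_gt _)).
pose B (i : nat) : set S := [set x | (i.+1%:R <= f x * N.+1%:R)%R].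
have mB i : measurable (B i).
  rewrite /B -[X in measurable X]setTI; apply: measurable_fun_ler => //.
  exact: measurable_funM.
have /choice[n hn] : forall i, exists n, forall K, (n <= K)%N ->
    P (V K @^-1` B i `+` X @^-1` B i) <= (e / 2)%:E by move=> i; exact: VX.
have mVB i K : measurable (V K @^-1` B i).
  by rewrite -[X in measurable X]setTI; exact: mV.
have mXB i : measurable (X @^-1` B i) by rewrite -[X in measurable X]setTI; exact: mX.
exists (\max_(i < N.+1) n i) => K Kn.
have key i : (i < N.+1)%N -> P (V K @^-1` B i `+` X @^-1` B i) <= (e / 2)%:E.
  move=> iN; apply: hn; apply: leq_trans Kn.
  exact: (leq_bigmax (F := fun i : 'I_N.+1 => n i) (Ordinal iN)).
split.
  apply: le_trans (integral_level (N := N) (e := (e / 2)%R) mA (mV K) mX mf f01 _) _.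
    move=> i; apply: (le_trans (prob_setY_le P mA (mVB i K) (mXB i))).
    by rewrite leeD2l//; exact: key.
  by rewrite leeD2l// lee_fin.
apply: le_trans (integral_level (N := N) (e := (e / 2)%R) mA mX (mV K) mf f01 _) _.
  move=> i; apply: (le_trans (prob_setY_le P mA (mXB i) (mVB i K))).
  by rewrite leeD2l// setYC; exact: key.
by rewrite leeD2l// lee_fin.
Qed.

(** The kernel is merely measurable, so convergence of [V] on every measurable set is used, through
    the level sets of the map taking [x] to [Q x B]. *)
Lemma markov_step_lim dS' (S' : measurableType dS') (G : set (set T))
    (V : nat -> T -> S) (W : nat -> T -> S') (X : T -> S) (Y : T -> S')
    (Q : R.-pker S ~> S') (n0 : nat) :
  G `<=` measurable -> (forall K, measurable_fun [set: T] (V K)) ->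
  (forall K, measurable_fun [set: T] (W K)) ->
  measurable_fun [set: T] X -> measurable_fun [set: T] Y ->
  (forall B, measurable B -> set_lim P (fun K => V K @^-1` B) (X @^-1` B)) ->
  (forall B, measurable B -> set_lim P (fun K => W K @^-1` B) (Y @^-1` B)) ->
  (forall K, (n0 <= K)%N -> markov_step P G (V K) (W K) Q) ->
  markov_step P G X Y Q.
Proof.
move=> Gm mV mW mX mY VX WY VW A B GA mB.
have mA := Gm _ GA.
have mWB K : measurable (W K @^-1` B).
  by rewrite -[X in measurable X]setTI; exact: mW.
have mYB : measurable (Y @^-1` B) by rewrite -[X in measurable X]setTI; exact: mY.
have mQ : measurable_fun [set: S] (fun x => Q x B) by exact: measurable_kernel.
have Q01 x : 0 <= Q x B <= 1.
  rewrite measure_ge0 -[leRHS](@prob_kernel _ _ _ _ _ Q x).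
  by apply: le_measure; rewrite ?inE.
pose f x := fine (Q x B).
have fE x : (f x)%:E = Q x B.
  by have /andP[h0 h1] := Q01 x; rewrite fineK// ge0_fin_numE// (le_lt_trans h1)// ltry.
have mf : measurable_fun [set: S] f by exact: measurableT_comp.
have f01 x : (0 <= f x <= 1)%R by rewrite -!lee_fin fE.
have intE (Z : T -> S) : \int[P]_(w in A) Q (Z w) B = \int[P]_(w in A) (f (Z w))%:E.
  by apply: eq_integral => w _; rewrite fE.
rewrite intE; apply/eqP; rewrite eq_le; apply/andP; split; apply/lee_addgt0Pr => e e0.
  have e20 : (0 < e / 2)%R by rewrite divr_gt0.
  have [n1 h1] := integral_lim mA mV mX mf f01 VX e20.
  have [n2 h2] := WY B mB _ e20.
  pose K := maxn n0 (maxn n1 n2).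
  have [h1' _] := h1 K (leq_trans (leq_maxl n1 n2) (leq_maxr _ _)).
  have h2' := h2 K (leq_trans (leq_maxr n1 n2) (leq_maxr _ _)).
  apply: (le_trans (prob_setY_le P mA mYB (mWB K))).
  rewrite (VW K (leq_maxl _ _))// intE setYC.
  apply: (le_trans (leeD h1' h2')).
  by rewrite -addeA -EFinD -splitr.
have e20 : (0 < e / 2)%R by rewrite divr_gt0.
have [n1 h1] := integral_lim mA mV mX mf f01 VX e20.
have [n2 h2] := WY B mB _ e20.
pose K := maxn n0 (maxn n1 n2).
have [_ h1'] := h1 K (leq_trans (leq_maxl n1 n2) (leq_maxr _ _)).
have h2' := h2 K (leq_trans (leq_maxr n1 n2) (leq_maxr _ _)).
apply: (le_trans h1'); rewrite -intE -(VW K (leq_maxl _ _))//.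
apply: (le_trans (leeD (prob_setY_le P mA (mWB K) mYB) (lexx _))).
by rewrite -addeA leeD2l// [in leRHS](splitr e) EFinD leeD2r.
Qed.

End IntegralLimit.

Local Close Scope ereal_scope.

(** * Coupled approximations *)

Local Open Scope ereal_scope.

Section Gap.
Context d (T : measurableType d) (R : realType) (P : probability T R).

(* If [E] and [E'] are a.s. ordered by inclusion on [A] and on its complement, the
   probability of their symmetric difference is read off two differences of
   probabilities. *)
Lemma gap_le (A E E' : set T) (h : T -> \bar R) :
  measurable A -> measurable E -> measurable E' ->
  measurable_fun [set: T] h -> (forall w, 0 <= h w) ->
  P (A `&` E' `\` E) = 0 -> P (~` A `&` E `\` E') = 0 ->
  P (A `&` E) <= P (A `&` E') + \int[P]_(w in A) h w ->
  P (~` A `&` E') <= P (~` A `&` E) + \int[P]_(w in ~` A) h w ->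
  P (E `\` E') + P (E' `\` E) <= \int[P]_w h w.
Proof.
have half B F F' : measurable B -> measurable F -> measurable F' ->
    P (B `&` F' `\` F) = 0 -> P (~` B `&` F `\` F') = 0 ->
    P (B `&` F) <= P (B `&` F') + \int[P]_(w in B) h w ->
    P (F `\` F') <= \int[P]_(w in B) h w.
  move=> mB mF mF' B1 B2 B3.
  have mBF : measurable (B `&` F) by exact: measurableI.
  have mBF' : measurable (B `&` F') by exact: measurableI.
  have mCF : measurable (~` B `&` F) by apply: measurableI => //; exact: measurableC.
  have mD1 : measurable (B `&` F `\` F') by exact: measurableD.
  have mD2 : measurable (~` B `&` F `\` F') by exact: measurableD.
  apply: (@le_trans _ _ (P (B `&` F `\` F'))).
    apply: (@le_trans _ _ (P ((B `&` F `\` F') `|` (~` B `&` F `\` F')))).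
      apply: prob_le; [exact: measurableD|exact: measurableU|].
      by move=> w [Fw F'w]; have [Bw|Bw] := pselect (B w); [left|right].
    by apply: (le_trans (prob_U2 P mD1 mD2)); rewrite B2 adde0.
  have : P (B `&` F') + P (B `&` F `\` F') <= P (B `&` F') + \int[P]_(w in B) h w.
    apply: le_trans B3; rewrite (prob_DI P mBF mF') addeC leeD2l//.
    rewrite (prob_DI P mBF' mF) B1 add0e; apply: prob_le; try exact: measurableI.
    by move=> w [[Bw F'w] Fw].
  by rewrite leeD2lE// prob_fin.
move=> mA mE mE' mh h0 A1 A2 A3 A4.
have mCA := measurableC mA.
have -> : \int[P]_w h w = \int[P]_(w in A) h w + \int[P]_(w in ~` A) h w.
  rewrite -ge0_integral_setU//; last exact/disj_setPCl.
    by rewrite setUv.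
  by rewrite setUv.
apply: leeD; first exact: half.
by apply: half => //; rewrite setCK.
Qed.

Lemma integral_gap (A : set T) (f g : T -> \bar R) (p : R) : measurable A ->
  measurable_fun [set: T] f -> measurable_fun [set: T] g ->
  (forall w, 0 <= f w <= 1) -> (forall w, 0 <= g w <= 1) ->
  \int[P]_(w in A) f w <= \int[P]_(w in A) g w +
    \int[P]_(w in A) (`|fine (f w) - p|%:E + `|fine (g w) - p|%:E).
Proof.
move=> mA mf mg f01 g01.
have fine01 (x : \bar R) : 0 <= x <= 1 -> x = (fine x)%:E.
  by case: x => [r| |]//= /andP[].
have mfine (k : T -> \bar R) : measurable_fun [set: T] k ->
    measurable_fun A (fun w => `|fine (k w) - p|%:E).
  move=> mk; apply/measurable_EFinP/measurable_funTS.
  apply: measurableT_comp => //; apply: measurable_funB => //.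
  exact: measurableT_comp.
have mfA := measurable_funTS (D := A) mf; have mgA := measurable_funTS (D := A) mg.
rewrite -ge0_integralD//.
- apply: ge0_le_integral => //.
  + by move=> w _; case/andP: (f01 w).
  + by apply: emeasurable_funD => //; apply: emeasurable_funD; exact: mfine.
  + move=> w _; rewrite {1}(fine01 _ (f01 w)) {1}(fine01 _ (g01 w)) -!EFinD lee_fin.
    have := ler_norm (fine (f w) - p); have := ler_norm (p - fine (g w)).
    by rewrite (distrC p); lra.
- by move=> w _; case/andP: (g01 w).
- by move=> w _; rewrite -EFinD lee_fin addr_ge0.
- by apply: emeasurable_funD; exact: mfine.
Qed.

End Gap.

(** * Stages of the construction and their limit *)

Section Process.
Context (R : realType) (D : option nat) d (T : measurableType d)
  (P : probability T R).
Variables (H : nat -> nat -> set (set T)) (G : nat -> set (set T))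
  (U : nat -> nat -> T -> R).
Hypotheses (sH : forall t K, sigma_algebra setT (H t K))
  (sG : forall t, sigma_algebra setT (G t))
  (HH : forall t K, H t K `<=` H t K.+1) (HG : forall t K, H t K `<=` G t)
  (GH : forall t K, G t.+1 `<=` H t K) (Gm : forall t, G t `<=` measurable)
  (HU : forall t K B, measurable B -> H t K.+1 (U t K @^-1` B))
  (indU : forall t K A B, H t K A -> measurable B ->
     P (A `&` U t K @^-1` B) = P A * unif R B).
Variables (mu : nat -> probability (state R D) R)
  (Q : nat -> R.-pker state R D ~> state R D)
  (C : nat -> R.-pker (state R D * state R D)%type ~> (state R D * state R D)%type)
  (N : nat -> set (state R D)).
Hypotheses (muQ : forall t B, measurable B -> mu t B = \int[mu t.+1]_x Q t x B)
  (mN : forall t, measurable (N t)) (muN : forall t, mu t (N t) = 0)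
  (CQ : forall t x x' B, ~ N t.+1 x -> ~ N t.+1 x' -> measurable B ->
     C t (x, x') (B `*` setT) = Q t x B /\ C t (x, x') (setT `*` B) = Q t x' B).

Implicit Types Z : nat -> T -> state R D.

(* A copy of the process on the times [-s < -t <= 0], with [H t K] the noise it may
   use at time [-t]. *)
Definition stage_inv (s K : nat) Z : Prop :=
  forall t, (t < s)%N ->
    [/\ forall B, measurable B -> H t K (Z t @^-1` B),
        forall B, measurable B -> P (Z t @^-1` B) = mu t B &
        ((t.+1 < s)%N -> markov_step P (G t.+1) (Z t.+1) (Z t) (Q t))].

Definition stage_coupled (s : nat) Z Z' : Prop :=
  forall t, (t.+1 < s)%N ->
    markov_step P (G t.+1) (fun w => (Z t.+1 w, Z' t.+1 w))
      (fun w => (Z t w, Z' t w)) (C t).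

Let Hm t K : H t K `<=` measurable. Proof. by move=> A /HG /Gm. Qed.

Let GT t : G t setT.
Proof. by rewrite -(measurable_subE (sG t)); exact: measurableT. Qed.

Lemma step_law t (x y : T -> state R D) :
  measurable_fun [set: T] x ->
  (forall B, measurable B -> P (x @^-1` B) = mu t.+1 B) ->
  markov_step P (G t.+1) x y (Q t) ->
  forall B, measurable B -> P (y @^-1` B) = mu t B.
Proof.
move=> mx xmu xyQ B mB.
rewrite -[y @^-1` B]setTI xyQ// muQ//.
transitivity (\int[law P mx]_x Q t x B); last first.
  by apply: eq_measure_integral => A mA _; exact: xmu.
rewrite ge0_integral_law// ?preimage_setT//.
exact: measurable_kernel.
Qed.

(** Built from time [-(s' - 1)] forwards, with [i] counting the times already treated. Each value
    draws on the variable [U t K], independent of the past noise and of the value of [Z] at that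
    time. *)
Lemma stage_extend s s' K Z : (s <= s')%N -> stage_inv s K Z ->
  exists Z', stage_inv s' K.+1 Z' /\ stage_coupled s Z Z'.
Proof.
move=> ss' ZI.
suff /(_ s' (leqnn _))[Z' hZ'] : forall i, (i <= s')%N -> exists Z',
    forall t, (s' - i <= t)%N -> (t < s')%N ->
    [/\ forall B, measurable B -> H t K.+1 (Z' t @^-1` B),
        forall B, measurable B -> P (Z' t @^-1` B) = mu t B,
        ((t.+1 < s')%N -> markov_step P (G t.+1) (Z' t.+1) (Z' t) (Q t)) &
        ((t.+1 < s)%N -> markov_step P (G t.+1) (fun w => (Z t.+1 w, Z' t.+1 w))
          (fun w => (Z t w, Z' t w)) (C t))].
  exists Z'; split => t ts.
    by have [] := hZ' t _ ts; rewrite ?subnn.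
  have ts' : (t < s')%N by rewrite (leq_trans _ ss')// ltnW.
  by have [] := hZ' t _ ts'; rewrite ?subnn// => _ _ _; exact.
elim=> [|i IH] is'.
  by exists Z => t; rewrite subn0 => h1 h2; have := leq_ltn_trans h1 h2; rewrite ltnn.
have [Z' hZ'] := IH (ltnW is').
pose m := (s' - i.+1)%N.
have mS : m.+1 = (s' - i)%N by rewrite /m; lia.
suff [y [Hy yl yQ yC]] : exists y : T -> state R D,
    [/\ forall B, measurable B -> H m K.+1 (y @^-1` B),
        forall B, measurable B -> P (y @^-1` B) = mu m B,
        ((m.+1 < s')%N -> markov_step P (G m.+1) (Z' m.+1) y (Q m)) &
        ((m.+1 < s)%N -> markov_step P (G m.+1) (fun w => (Z m.+1 w, Z' m.+1 w))
          (fun w => (Z m w, y w)) (C m))].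
  exists (fun t => if t == m then y else Z' t) => t mt ts.
  have [->|tm] := eqVneq t m.
    by rewrite (_ : (m.+1 == m) = false); [split|lia].
  have -> : (t.+1 == m) = false by rewrite -/m in mt; lia.
  by apply: hZ' => //; rewrite -mS; rewrite -/m in mt; lia.
have cst_meas B : G m.+1 ((fun=> point : state R D) @^-1` B).
  have [h|h] := pselect (B point).
    by rewrite (_ : _ @^-1` _ = setT)//; apply/seteqP; split.
  rewrite (_ : _ @^-1` _ = set0).
    by rewrite -(measurable_subE (sG m.+1)); exact: measurable0.
  by apply/seteqP; split.
(* The starting value: a constant kernel draws it from [mu m], independently of all earlier
   noise. *)
have [mlt|s'm] := ltnP m.+1 s'; last first.
  have [y [Hy yQ]] := step_free (sH m K.+1) (@HH m K) (@Hm m K.+1)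
    (@HU m K) (@indU m K) (sG m.+1) (@GH m K) (kcst _ (mu m)) (fun B _ => cst_meas B).
  exists y; split => //.
  - move=> B mB; rewrite -[y @^-1` B]setTI yQ//.
    under eq_integral do rewrite /=.
    rewrite integral_cst// [X in _ * X](_ : _ = 1) ?mule1//.
    exact: (@probability_setT _ _ _ P).
  - by move=> ms; exfalso; move: s'm ms ss'; clear; lia.
have [Hx' xl' _ _] : [/\ _, _, _ & _] := hZ' m.+1 ltac:(by rewrite -mS) mlt.
have Gx' B : measurable B -> G m.+1 (Z' m.+1 @^-1` B) by move=> mB; exact/HG/Hx'.
have mx' : measurable_fun [set: T] (Z' m.+1).
  by move=> _ B mB; rewrite setTI; exact/Gm/Gx'.
(* At time [-(m + 1)] the older stage has not started: the new one moves freely by [Q]. *)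
have [ms|sm] := ltnP m.+1 s; last first.
  have [y [Hy yQ]] := step_free (sH m K.+1) (@HH m K) (@Hm m K.+1)
    (@HU m K) (@indU m K) (sG m.+1) (@GH m K) (Q m) Gx'.
  exists y; split => //; first exact: step_law mx' xl' yQ.
have [Hx xl _] := ZI _ ms.
have [Hy yl yQ] := ZI _ (ltnW ms).
have Gx B : measurable B -> G m.+1 (Z m.+1 @^-1` B) by move=> mB; exact/HG/Hx.
have mx : measurable_fun [set: T] (Z m.+1).
  by move=> _ B mB; rewrite setTI; exact/Gm/Gx.
have aeN : {ae P, forall w, ~ N m.+1 (Z m.+1 w) /\ ~ N m.+1 (Z' m.+1 w)}.
  exists ((Z m.+1 @^-1` N m.+1) `|` (Z' m.+1 @^-1` N m.+1)); split.
  - by apply: measurableU; apply: (@Gm m.+1); [exact: Gx|exact: Gx'].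
  - apply: nullU.
    + by apply: (@Gm m.+1); exact: Gx.
    + by apply: (@Gm m.+1); exact: Gx'.
    + exact: etrans (xl _ (mN _)) (muN _).
    + exact: etrans (xl' _ (mN _)) (muN _).
  - by move=> w /= /not_andP[] /contrapT; [left|right].
have mxx : measurable_fun setT (fun w => (Z m.+1 w, Z' m.+1 w)) by exact: measurable_fun_pair.
have mC A E : measurable A -> measurable E ->
    measurable_fun A (fun w => C m (Z m.+1 w, Z' m.+1 w) E).
  move=> mA mE; apply: measurable_funTS.
  exact: (measurableT_comp (measurable_kernel (C m) E mE) mxx).
have [|y' [Hy' yC]] := step_couple (sH m K) (sH m K.+1) (@HH m K) (@Hm m K.+1)
    (@HU m K) (@indU m K) (sG m.+1) (@GH m K) (C := C m) Gx Gx' Hy.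
  move=> A B GA mB; rewrite yQ//.
  have mA : measurable A by exact: (Gm GA).
  apply: ge0_ae_eq_integral => //.
  - apply: measurable_funTS; exact: measurableT_comp (measurable_kernel (Q m) B mB) mx.
  - by apply: mC => //; exact: measurableX.
  - by apply: filterS aeN => w [h h'] _; have [->] := CQ h h' mB.
have yQ' : markov_step P (G m.+1) (Z' m.+1) y' (Q m).
  move=> A B GA mB.
  have mA : measurable A by exact: (Gm GA).
  transitivity (\int[P]_(w in A) C m (Z m.+1 w, Z' m.+1 w) (setT `*` B)).
    rewrite -yC//; last exact: measurableX.
    by congr (P (_ `&` _)); apply/seteqP; split => w //= [].
  apply: ge0_ae_eq_integral => //.
  - by apply: mC => //; exact: measurableX.
  - apply: measurable_funTS; exact: measurableT_comp (measurable_kernel (Q m) B mB) mx'.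
  - by apply: filterS aeN => w [h h'] _; have [_ ->] := CQ h h' mB.
exists y'; split => //; exact: step_law mx' xl' yQ'.
Qed.

Hypothesis CO : forall t x x' (k : coord D), ~ N t.+1 x -> ~ N t.+1 x' ->
  ((x k <= x' k)%R -> C t (x, x') [set y | (y.2 k < y.1 k)%R] = 0) /\
  ((x' k <= x k)%R -> C t (x, x') [set y | (y.1 k < y.2 k)%R] = 0).

Section Coupled.
Variables (s s' K K' : nat) (Z Z' : nat -> T -> state R D).
Hypotheses (ss' : (s <= s')%N) (ZI : stage_inv s K Z) (ZI' : stage_inv s' K' Z')
  (ZZ' : stage_coupled s Z Z').

Let GZ t B : (t < s)%N -> measurable B -> G t (Z t @^-1` B).
Proof. by move=> ts mB; apply: (@HG t K); have [h _ _] := ZI ts; exact: h. Qed.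

Let GZ' t B : (t < s)%N -> measurable B -> G t (Z' t @^-1` B).
Proof.
move=> ts mB; apply: (@HG t K').
by have [h _ _] := ZI' (leq_trans ts ss'); exact: h.
Qed.

Let mZ t : (t < s)%N -> measurable_fun [set: T] (Z t).
Proof. by move=> ts _ B mB; rewrite setTI; apply: (@Gm t); exact: GZ. Qed.

Let mZ' t : (t < s)%N -> measurable_fun [set: T] (Z' t).
Proof. by move=> ts _ B mB; rewrite setTI; apply: (@Gm t); exact: GZ'. Qed.

Let ZZ t w := (Z t w, Z' t w).

Let GZZ t E : (t < s)%N -> measurable E -> G t (ZZ t @^-1` E).
Proof.
move=> ts mE.
have : measurable_fun [set: g_sigma_algebraType (G t)]
    (ZZ t : g_sigma_algebraType (G t) -> (state R D * state R D)%type).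
  by apply: measurable_fun_pair; apply/measurable_subP => // B; [exact: GZ|exact: GZ'].
by move/measurable_subP; apply.
Qed.

(** One coupled step preserves [L] almost surely, since both copies avoid the null set [N]; leaving
    [L] between times [-r] and [-t] would require a bad step among finitely many. *)
Lemma coupled_rel (L : set (state R D * state R D)) : measurable L ->
  (forall t x x', ~ N t.+1 x -> ~ N t.+1 x' -> L (x, x') -> C t (x, x') (~` L) = 0) ->
  forall r t, (r < s)%N -> (t <= r)%N -> P (ZZ r @^-1` L `&` ZZ t @^-1` (~` L)) = 0.
Proof.
move=> mL CL r t rs.
have mP t' E : (t' < s)%N -> measurable E -> measurable (ZZ t' @^-1` E).
  by move=> ts mE; apply: (@Gm t'); exact: GZZ.
have mCL := measurableC mL.
have step t' : (t'.+1 < s)%N -> P (ZZ t'.+1 @^-1` L `&` ZZ t' @^-1` (~` L)) = 0.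
  move=> ts; rewrite (ZZ' ts)//; last exact: GZZ.
  have aeN : {ae P, forall w, ~ N t'.+1 (Z t'.+1 w) /\ ~ N t'.+1 (Z' t'.+1 w)}.
    have [_ xl _] := ZI ts; have [_ xl' _] := ZI' (leq_trans ts ss').
    have mX := @mZ t'.+1 ts measurableT _ (mN t'.+1).
    have mX' := @mZ' t'.+1 ts measurableT _ (mN t'.+1).
    rewrite setTI in mX; rewrite setTI in mX'.
    exists ((Z t'.+1 @^-1` N t'.+1) `|` (Z' t'.+1 @^-1` N t'.+1)); split.
    - exact: measurableU.
    - apply: nullU => //.
      + exact: etrans (xl _ (mN _)) (muN _).
      + exact: etrans (xl' _ (mN _)) (muN _).
    - by move=> w /= /not_andP[] /contrapT; [left|right].
  have mLt := mP t'.+1 L ts mL.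
  rewrite (@ge0_ae_eq_integral _ _ _ P _ _ (cst 0)) ?integral0//.
  - apply: measurable_funTS.
    apply: (measurableT_comp (measurable_kernel (C t') _ mCL)).
    by apply: measurable_fun_pair; [exact: mZ|exact: mZ'].
  - by apply: filterS aeN => w [h h'] Lw; exact: CL.
move=> tr; rewrite -(subKn tr); elim: (r - t)%N => [|i IH].
  rewrite subn0 (_ : _ `&` _ = set0) ?measure0//.
  by apply/seteqP; split => w //= [].
have [ir|ri] := ltnP i r; last first.
  by rewrite (_ : r - i.+1 = r - i)%N//; lia.
have ts : ((r - i.+1).+1 < s)%N by lia.
have tS : ((r - i.+1).+1 = r - i)%N by lia.
have := step _ ts; rewrite tS => st.
apply: (nullS _ _ _ (nullU _ _ IH st)).
- by apply: measurableI; apply: mP => //; lia.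
- by apply: measurableU; apply: measurableI; apply: mP => //; lia.
- move=> w [Lr Lt]; have [h|h] := pselect ((ZZ (r - i)%N @^-1` L) w); first by right.
  by left.
- by apply: measurableI; apply: mP => //; lia.
- by apply: measurableI; apply: mP => //; lia.
Qed.

(** Where [Z r k <= Z' r k] the order persists, so at time [-t] the event that [Z'] is below the
    level is almost surely contained in that for [Z]; on the complement the inclusion is reversed.
    [gap_le] reduces the claim to conditional probabilities given time [-r], each compared with [p];
    both copies have law [mu r], hence the factor 2. *)
Lemma coupled_close (t r : nat) (k : coord D) (q : rat) (p : R) : (t <= r)%N -> (r < s)%N ->
  P (Z t @^-1` @ray R D k q `\` Z' t @^-1` @ray R D k q) +
  P (Z' t @^-1` @ray R D k q `\` Z t @^-1` @ray R D k q) <=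
  2%:E * \int[mu r]_x `|fine (hit_prob Q t (@ray R D k q) r x) - p|%:E.
Proof.
move=> tr rs.
have ts : (t < s)%N by exact: leq_ltn_trans tr rs.
have mk1 : measurable_fun [set: state R D * state R D] (fun y => y.1 k).
  exact: measurableT_comp (measurable_coord k) measurable_fst.
have mk2 : measurable_fun [set: state R D * state R D] (fun y => y.2 k).
  exact: measurableT_comp (measurable_coord k) measurable_snd.
pose L1 : set (state R D * state R D) := [set y | (y.1 k <= y.2 k)%R].
pose L2 : set (state R D * state R D) := [set y | (y.2 k <= y.1 k)%R].
have mL1 : measurable L1.
  by rewrite /L1 -[X in measurable X]setTI; exact: measurable_fun_ler.
have mL2 : measurable L2.
  by rewrite /L2 -[X in measurable X]setTI; exact: measurable_fun_ler.
have C1 : ~` L1 = [set y | (y.2 k < y.1 k)%R].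
  by apply/seteqP; split => y /=; rewrite ltNge => /negP.
have C2 : ~` L2 = [set y | (y.1 k < y.2 k)%R].
  by apply/seteqP; split => y /=; rewrite ltNge => /negP.
have n1 := coupled_rel mL1 (fun t x x' h h' l => ltac:(
  rewrite C1; exact: (proj1 (@CO t x x' k h h') l))) rs tr.
have n2 := coupled_rel mL2 (fun t x x' h h' l => ltac:(
  rewrite C2; exact: (proj2 (@CO t x x' k h h') l))) rs tr.
have mray := @measurable_ray R D k q.
set B := @ray R D k q in mray *.
have mP t' E : (t' < s)%N -> measurable E -> measurable (ZZ t' @^-1` E).
  by move=> ts' mE; apply: (@Gm t'); exact: GZZ.
have GA : G r (ZZ r @^-1` L1) by exact: GZZ.
have GCA : G r (~` (ZZ r @^-1` L1)).
  by rewrite preimage_setC; apply: GZZ => //; exact: measurableC.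
have mE : measurable (Z t @^-1` B) by apply: (@Gm t); exact: GZ.
have mE' : measurable (Z' t @^-1` B) by apply: (@Gm t); exact: GZ'.
pose g x := hit_prob Q t B r x.
have mg : measurable_fun setT g by exact: hit_prob_meas.
have g01 x : 0 <= g x <= 1 by exact: hit_prob01.
have Gd t' : G t'.+1 `<=` G t' by move=> A /(@GH t' 0%N) /(@HG t' 0%N).
have hitE (Y : nat -> T -> state R D) A :
    (forall t' E, (t' <= r)%N -> measurable E -> G t' (Y t' @^-1` E)) ->
    (forall t', (t' < r)%N -> markov_step P (G t'.+1) (Y t'.+1) (Y t') (Q t')) ->
    G r A -> P (A `&` Y t @^-1` B) = \int[P]_(w in A) g (Y r w).
  move=> GY YQ GrA.
  have mB t' : measurable (if t' == t then B else [set: state R D]) by case: ifP.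
  rewrite -(backward_prob mB sG Gm Gd GY YQ)//.
    congr (P (_ `&` _)); apply/seteqP; split => w /=.
      by move=> Bw s0 _; case: eqP => [->|].
    by move=> /(_ t tr); rewrite eqxx.
have ZE A : G r A -> P (A `&` Z t @^-1` B) = \int[P]_(w in A) g (Z r w).
  apply: hitE => [t' E t'r|t' t'r]; first by apply: GZ; exact: leq_ltn_trans rs.
  by have [_ _] := ZI (ltn_trans t'r rs); apply; exact: leq_ltn_trans rs.
have ZE' A : G r A -> P (A `&` Z' t @^-1` B) = \int[P]_(w in A) g (Z' r w).
  apply: hitE => [t' E t'r|t' t'r]; first by apply: GZ'; exact: leq_ltn_trans rs.
  have [_ _] := ZI' (leq_trans (ltn_trans t'r rs) ss'); apply.
  by rewrite (leq_trans _ ss')//; exact: leq_ltn_trans rs.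
pose h w := `|fine (g (Z r w)) - p|%:E + `|fine (g (Z' r w)) - p|%:E.
have mgp : measurable_fun [set: state R D] (fun x => `|fine (g x) - p|%:E).
  apply/measurable_EFinP; apply: measurableT_comp => //.
  by apply: measurable_funB => //; exact: measurableT_comp.
have mh1 : measurable_fun [set: T] (fun w => `|fine (g (Z r w)) - p|%:E).
  exact: measurableT_comp mgp (mZ rs).
have mh2 : measurable_fun [set: T] (fun w => `|fine (g (Z' r w)) - p|%:E).
  exact: measurableT_comp mgp (mZ' rs).
apply: (@le_trans _ _ (\int[P]_w h w)); last first.
  rewrite ge0_integralD//.
  have intE (Y : T -> state R D) (mY : measurable_fun [set: T] Y) :
      (forall E, measurable E -> P (Y @^-1` E) = mu r E) ->
      \int[P]_w `|fine (g (Y w)) - p|%:E = \int[mu r]_x `|fine (g x) - p|%:E.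
    move=> YE; rewrite -[setT]/(Y @^-1` setT).
    rewrite -(@ge0_integral_law _ _ _ _ _ P _ mY _ (fun x => `|fine (g x) - p|%:E))//.
    by apply: eq_measure_integral => E mE0 _; exact: YE.
  have [_ zl _] := ZI rs; have [_ zl' _] := ZI' (leq_trans rs ss').
  by rewrite (intE _ (mZ rs) zl) (intE _ (mZ' rs) zl') mule_natl mule2n.
apply: (@gap_le _ _ _ _ (ZZ r @^-1` L1)) => //.
- by apply: (@Gm r).
- exact: emeasurable_funD.
- by move=> w; rewrite /h -EFinD lee_fin addr_ge0.
- apply: nullS n1.
  + by apply: measurableD => //; apply: measurableI => //; exact: (@Gm r).
  + by apply: measurableI; apply: mP => //; exact: measurableC.
  + move=> w [[/= l zq'] zq]; split => //=; apply/negP.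
    by rewrite -ltNge ltNge; apply/negP => zz; apply: zq; exact: le_trans zz zq'.
- apply: nullS n2.
  + by apply: measurableD => //; apply: measurableI => //; exact: (@Gm r).
  + by apply: measurableI; apply: mP => //; exact: measurableC.
  + move=> w [[/= l zq'] zq]; split => /=.
      by rewrite /L2 /= leNgt; apply/negP => lt; apply: l; exact: ltW.
    by move=> zz; apply: zq; exact: le_trans zz zq'.
- rewrite ZE// ZE'//; apply: integral_gap => //; first exact: (Gm GA).
  + exact: measurableT_comp mg (mZ rs).
  + exact: measurableT_comp mg (mZ' rs).
- rewrite ZE// ZE'//.
  (* On the complement the two copies exchange roles, and so do the two terms of [h]. *)
  under [X in _ <= _ + X]eq_integral do rewrite /h addeC.
  apply: integral_gap => //; first exact: (Gm GCA).
  + exact: measurableT_comp mg (mZ' rs).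
  + exact: measurableT_comp mg (mZ rs).
Qed.

End Coupled.

Hypothesis hit_cvg : forall s (B : set (state R D)) (e : R), measurable B -> (0 < e)%R ->
  exists r0, forall r, (r0 <= r)%N ->
    \int[mu r]_x `|fine (hit_prob Q s B r x) - fine (mu s B)|%:E <= e%:E.

Let inv := stage_inv.
Let cpl := stage_coupled.

(** Stage [K] starts at time [-(tau K - 1)]. Only times and rays with index at most [K] are asked
    for, finitely many thresholds, so one start suits them all. *)
Let tau_exists : exists tau : nat -> nat, [/\ forall K, (K < tau K)%N,
  forall K, (tau K <= tau K.+1)%N &
  forall K s j, (s <= K)%N -> (j <= K)%N ->
    2%:E * \int[mu (tau K).-1]_x `|fine (hit_prob Q s (@bit R D j) (tau K).-1 x) -
      fine (mu s (@bit R D j))|%:E <= (half_pow R K)%:E].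
Proof.
have /choice[n hn] : forall z : nat * nat * nat, exists r0, forall r, (r0 <= r)%N ->
    \int[mu r]_x `|fine (hit_prob Q z.1.1 (@bit R D z.1.2) r x) -
      fine (mu z.1.1 (@bit R D z.1.2))|%:E <= (half_pow R z.2.+1)%:E.
  by move=> z; apply: hit_cvg; [exact: measurable_bit|exact: half_pow_gt0].
pose rho K := (\max_(s < K.+1) \max_(j < K.+1) n (s : nat, j : nat, K))%N.
pose tau K := (\sum_(i < K.+1) rho i + K.+1)%N.
exists tau; split.
- by move=> K; rewrite /tau; lia.
- by move=> K; rewrite /tau (big_ord_recr K.+1)/=; lia.
move=> K s j sK jK.
have le_n : (n (s, j, K) <= (tau K).-1)%N.
  apply: (@leq_trans (rho K)); last by rewrite /tau big_ord_recr/=; lia.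
  have sK' : (s < K.+1)%N by []. have jK' : (j < K.+1)%N by [].
  apply: leq_trans (leq_bigmax (F := fun s : 'I_K.+1 =>
    \max_(j < K.+1) n (s : nat, j : nat, K)) (Ordinal sK')).
  exact: (leq_bigmax (F := fun j : 'I_K.+1 => n (s, j : nat, K)) (Ordinal jK')).
(* The thresholds were chosen for [half_pow K.+1], which absorbs the factor 2. *)
rewrite half_powS EFinM; apply: lee_wpmul2l => //.
by have := hn (s, j, K) _ le_n.
Qed.

(** At time [-t] the limit is taken over the stages [K + t], all of which have started by then. *)
Lemma process_exists : exists X : nat -> T -> state R D,
  [/\ forall t B, measurable B -> G t (X t @^-1` B),
      forall t B, measurable B -> P (X t @^-1` B) = mu t B &
      forall t, markov_step P (G t.+1) (X t.+1) (X t) (Q t)].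
Proof.
have [tau [tau_gt tau_le tauP]] := tau_exists.
have ext s s' K Z : (s <= s')%N -> inv s K Z -> exists Z', inv s' K.+1 Z' /\ cpl s Z Z'.
  exact: stage_extend.
(* The first stage extends an empty one, for which the invariant is vacuous. *)
have [Z0 [Z0I _]] : exists Z', inv (tau 0%N) 1%N Z' /\ cpl 0%N (fun _ _ => point) Z'.
  exact: ext.
have /choice[nxt hnxt] : forall KZ : nat * (nat -> T -> state R D), exists Z',
    inv (tau KZ.1) KZ.1.+1 KZ.2 -> inv (tau KZ.1.+1) KZ.1.+2 Z' /\ cpl (tau KZ.1) KZ.2 Z'.
  move=> [K Z]; have [h|h] := pselect (inv (tau K) K.+1 Z); last by exists Z.
  by have [Z' hZ'] := ext _ _ _ _ (tau_le K) h; exists Z'.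
pose Zs := fix Zs K := if K is K'.+1 then nxt (K', Zs K') else Z0.
have ZI K : inv (tau K) K.+1 (Zs K).
  by elim: K => [//|K IH]; have [] := hnxt (K, Zs K) IH.
have ZC K : cpl (tau K) (Zs K) (Zs K.+1) by have [] := hnxt (K, Zs K) (ZI K).
have ltau K t : (t < tau (K + t))%N by apply: leq_ltn_trans (tau_gt _); exact: leq_addl.
have GZ K t B : measurable B -> G t (Zs (K + t)%N t @^-1` B).
  by move=> mB; have [h _ _] := ZI _ _ (ltau K t); exact/HG/h.
have half_le K t : ((half_pow R (K + t))%:E <= (half_pow R K)%:E).
  rewrite lee_fin; elim: t => [|t IH]; first by rewrite addn0.
  by rewrite addnS (le_trans _ IH)// (half_powS R (K + t)) mulr_natl mulr2n lerDr ltW// half_pow_gt0.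
have /choice[X hX] : forall t, exists Xt : T -> state R D,
    [/\ forall B, measurable B -> G t (Xt @^-1` B),
        forall B, measurable B -> P (Xt @^-1` B) = mu t B &
        forall B, measurable B -> set_lim P (fun K => Zs (K + t)%N t @^-1` B) (Xt @^-1` B)].
  move=> t.
  (* The limit is taken on the space equipped with [G t], so that it stays measurable for the noise
     up to time [-t]. *)
  have [|||Xt [mXt Xtmu Xtlim]] := @law_limit R D _ (g_sigma_algebraType (G t))
      (restr (sG t) (@Gm t) P) (mu t) (fun K => Zs (K + t)%N t).
  - by move=> K; apply/measurable_subP => // B; exact: GZ.
  - by move=> K B mB; rewrite restrE; have [_ + _] := ZI _ _ (ltau K t); apply.
  - move=> k q; exists (bit_num k q) => K jK; rewrite !restrE addSn.
    apply: le_trans (half_le K t).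
    have := tauP (K + t)%N t (bit_num k q) (leq_addl _ _) (leq_trans jK (leq_addr _ _)).
    rewrite bit_numE; apply: le_trans.
    have tau1 : ((tau (K + t)).-1 < tau (K + t))%N.
      by rewrite prednK//; exact: leq_ltn_trans (tau_gt (K + t)%N).
    apply: (coupled_close (tau_le _) (ZI _) (ZI _) (ZC _)) => //.
    by rewrite -ltnS prednK//; exact: leq_ltn_trans (tau_gt (K + t)%N).
  exists Xt; split => //.
  by apply/measurable_subP.
exists X; split => [t|t|t]; try by have [] := hX t.
have mG s (Y : T -> state R D) : (forall B, measurable B -> G s (Y @^-1` B)) ->
    measurable_fun [set: T] Y.
  by move=> h _ B mB; rewrite setTI; exact/(@Gm s)/h.
have [h1 _ l1] := hX t.+1; have [h0 _ l0] := hX t.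
(* Both values must come from the same stage [K + t + 1], hence the shift by one in the limit at
   time [-t]. *)
apply: (@markov_step_lim _ _ _ _ _ _ _ _ _ (fun K => Zs (K + t.+1)%N t.+1)
   (fun K => Zs (K + t.+1)%N t) _ _ _ 0%N) => //.
- by move=> K; apply: mG => B; exact: GZ.
- by move=> K; apply: (mG t) => B mB; rewrite addnS -addSn; exact: GZ.
- exact: mG h1.
- exact: mG h0.
- move=> B mB; have := set_lim_shift 1 (l0 B mB).
  by under eq_fun do rewrite -addnA add1n.
by move=> K _; have [_ _] := ZI _ t (ltn_trans (ltnSn t) (ltau K t.+1)); apply.
Qed.

End Process.

Local Close Scope ereal_scope.

(** * Conditional independence *)

Local Open Scope ereal_scope.

Section CondIndep.
Context d d1 d2 (T : measurableType d) (S1 : measurableType d1)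
  (S2 : measurableType d2) (R : realType) (P : probability T R).
Variables (F G : set (set T)) (x : T -> S1) (y : T -> S2) (Q : R.-pker S1 ~> S2).
Hypotheses (sF : sigma_algebra setT F) (sG : sigma_algebra setT G)
  (FG : F `<=` G) (Gm : G `<=` measurable)
  (Fx : forall B, measurable B -> F (x @^-1` B))
  (my : measurable_fun [set: T] y) (xyQ : markov_step P G x y Q).

Let Fm : F `<=` measurable. Proof. by move=> A /FG/Gm. Qed.

Let FI A B : F A -> F B -> F (A `&` B).
Proof.
rewrite -(measurable_subE sF); exact: (@measurableI _ (g_sigma_algebraType F)).
Qed.

Let GI A B : G A -> G B -> G (A `&` B).
Proof.
rewrite -(measurable_subE sG); exact: (@measurableI _ (g_sigma_algebraType G)).
Qed.

Let FT : F setT.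
Proof. rewrite -(measurable_subE sF); exact: measurableT. Qed.

Definition step_rect : set (set T) :=
  [set A | exists A1 B, [/\ F A1, measurable B & A = A1 `&` y @^-1` B]].

Lemma step_rectI : setI_closed step_rect.
Proof.
move=> _ _ [A [B [FA mB ->]]] [A' [B' [FA' mB' ->]]].
exists (A `&` A'), (B `&` B'); split; [exact: FI|exact: measurableI|].
by rewrite preimage_setI; apply/seteqP; split => w /= [[? ?] [? ?]].
Qed.

Let myB B : measurable B -> measurable (y @^-1` B).
Proof. by move=> mB; rewrite -[X in measurable X]setTI; exact: my. Qed.

Let rect_meas : <<s step_rect >> `<=` measurable.
Proof.
apply: smallest_sub; first exact: sigma_algebra_measurable.
by move=> _ [A [B [FA mB ->]]]; apply: measurableI; [exact: Fm|exact: myB].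
Qed.

Let Q01 z B : measurable B -> 0 <= Q z B <= 1.
Proof.
move=> mB; rewrite measure_ge0 -[leRHS](@prob_kernel _ _ _ _ _ Q z).
by apply: le_measure; rewrite ?inE.
Qed.

Let QE z B : measurable B -> (fine (Q z B))%:E = Q z B.
Proof.
move=> mB; have /andP[h0 h1] := Q01 z mB.
by rewrite fineK// ge0_fin_numE// (le_lt_trans h1)// ltry.
Qed.

Let FQ B : measurable B -> forall E, measurable E ->
  F ((fun w => fine (Q (x w) B)) @^-1` E).
Proof.
move=> mB E mE; apply: (@Fx ((fun z => fine (Q z B)) @^-1` E)).
rewrite -[X in measurable X]setTI.
by apply: measurableT_comp => //; exact: measurable_kernel.
Qed.

Let step_weight (h : T -> \bar R) B :
  measurable_fun [set: g_sigma_algebraType G] (h : g_sigma_algebraType G -> \bar R) ->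
  (forall w, 0 <= h w) -> measurable B ->
  \int[P]_w (h w * (\1_(y @^-1` B) w)%:E) = \int[P]_w (h w * (fine (Q (x w) B))%:E).
Proof.
move=> mh h0 mB; apply: (@integral_sub_ext _ _ _ sG Gm) => //.
- by apply: measurable_indic; exact: myB.
- by apply: (sub_measurable_real Gm) => E mE; exact/FG/FQ.
- move=> A GA; transitivity (P (A `&` y @^-1` B)).
    by rewrite setIC integral_indic//; [exact: (Gm GA)|exact: myB].
  by rewrite xyQ//; apply: eq_integral => w _; rewrite QE.
Qed.

Section Version.
Variables (B : set T) (YB : T -> R).
Hypotheses (GB : G B) (YB01 : forall w, (0 <= YB w <= 1)%R)
  (vB : cond_prob_version P F B YB).

Let mB : measurable B. Proof. exact: Gm GB. Qed.

Let mYB : measurable_fun [set: T] YB.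
Proof. by apply: (sub_measurable_real Fm); case: vB. Qed.

Let YB0 w : 0 <= (YB w)%:E. Proof. by rewrite lee_fin; case/andP: (YB01 w). Qed.

(** The Markov step replaces the indicator of [y \in B'] by [Q (x w) B'], which is [F]-measurable;
    this allows the indicator of [B] to be replaced by [YB], after which the step is undone. *)
Lemma step_version_rect A : step_rect A -> P (A `&` B) = \int[P]_(w in A) (YB w)%:E.
Proof.
move=> [A1 [B' [FA1 mB' ->]]].
have mA1 : measurable A1 by exact: Fm.
have mF1 : measurable_fun [set: g_sigma_algebraType F]
    ((fun w => (\1_A1 w * fine (Q (x w) B'))%:E) : g_sigma_algebraType F -> \bar R).
  apply/measurable_EFinP; apply: measurable_funM.
    by apply: measurable_indic; rewrite (measurable_subE sF).
  by apply/(measurable_subP sF); exact: FQ.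
have Q0 w : (0 <= fine (Q (x w) B'))%R by apply: fine_ge0; case/andP: (Q01 (x w) mB').
transitivity (\int[P]_w ((\1_A1 w * fine (Q (x w) B'))%:E * (\1_B w)%:E)).
  transitivity (\int[P]_w ((\1_(A1 `&` B) w)%:E * (fine (Q (x w) B'))%:E)).
    rewrite setIAC xyQ//; last by apply: GI => //; exact: FG.
    rewrite integral_mkcond; apply: eq_integral => w _.
    by rewrite patchE indicE QE//; case: ifP => _; rewrite (mul1e, mul0e).
  apply: eq_integral => w _; rewrite -!EFinM !indicE in_setI; congr (_%:E).
  by case: (w \in A1); case: (w \in B); rewrite /= ?(mul1r, mul0r, mulr0, mulr1).
rewrite (@integral_sub_ext _ _ _ sF Fm _ _ \1_B YB)//; last first.
- move=> S FS; have [_ [_ ->//]] := vB.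
  by rewrite integral_indic//; exact: (Fm FS).
transitivity (\int[P]_w (((\1_A1 w)%:E * (YB w)%:E) * (fine (Q (x w) B'))%:E)).
  by apply: eq_integral => w _; rewrite EFinM muleAC.
rewrite -step_weight//.
- rewrite [RHS]integral_mkcond; apply: eq_integral => w _.
  rewrite patchE !indicE in_setI.
  by case: (w \in A1); case: (w \in y @^-1` B'); rewrite /= ?(mul1e, mul0e, mule0, mule1).
- apply: emeasurable_funM; apply/measurable_EFinP.
    by apply: measurable_indic; rewrite (measurable_subE sG); exact: FG.
  by apply/(measurable_subP sG) => E mE; apply: FG; case: vB => h _; exact: h.
- by move=> w; rewrite mule_ge0.
Qed.

(** Thus [YB], conditional probability of [B] given [F], has the right integrals over the larger
    sigma-algebra generated by [F] and [y]. *)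
Lemma step_version A : <<s step_rect >> A -> P (A `&` B) = \int[P]_(w in A) (YB w)%:E.
Proof.
pose T1 := g_sigma_algebraType step_rect.
have mT1 : @measurable _ T1 = <<s step_rect >> by [].
have YBfin E : measurable E -> \int[P]_(w in E) (YB w)%:E \is a fin_num.
  move=> mE; rewrite ge0_fin_numE; last exact: integral_ge0.
  apply: (@le_lt_trans _ _ (\int[P]_(w in E) (cst 1) w)).
    apply: ge0_le_integral => //; first exact/measurable_EFinP/measurable_funTS.
    by move=> w _; rewrite lee_fin; case/andP: (YB01 w).
  by rewrite integral_cst// mul1e prob_lty.
have rectT : step_rect setT.
  by exists setT, setT; split => //; rewrite preimage_setT setIT.
move: A; apply: (@dynkin_induction _ T1 step_rect _ mT1 step_rectI).
- exact: step_version_rect.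
- exact: step_version_rect.
- move=> A /rect_meas mA IH.
  have mCA := measurableC mA.
  have e1 : P B = P (A `&` B) + P (~` A `&` B).
    by rewrite (prob_DI P mB mA) addeC !(setIC B) setDE (setIC B).
  have e2 : P B = \int[P]_(w in A) (YB w)%:E + \int[P]_(w in ~` A) (YB w)%:E.
    rewrite -[B in LHS]setTI (step_version_rect rectT) -ge0_integral_setU//.
    + by rewrite setUv.
    + by rewrite setUv; exact/measurable_EFinP.
    + exact/disj_setPCl.
  have fin : P (A `&` B) \is a fin_num by apply: prob_fin; exact: measurableI.
  transitivity (P B - P (A `&` B)); first by rewrite e1 [X in X - _]addeC addeK.
  by rewrite e2 -IH [X in X - _]addeC addeK.
- move=> E mE tE IH.
  have mE' n : d.-measurable (E n : set T) by apply: rect_meas; exact: mE.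
  rewrite setI_bigcupl.
  have mEB n : d.-measurable ((E n : set T) `&` B) by exact: measurableI.
  have tEB : trivIset setT (fun n => E n `&` B) by exact: trivIset_setIr.
  transitivity (\sum_(n <oo) P (E n `&` B)).
    by rewrite measure_bigcup//; apply: eq_eseriesl => n; rewrite in_setT.
  rewrite ge0_integral_bigcup//; last exact/measurable_EFinP/measurable_funTS.
  by apply: eq_eseriesr => n _; rewrite -IH.
Qed.

End Version.

(** The next sigma-algebra is generated by [F] and [y]. By [step_version], [B] may be exchanged for
    [YB] on its events; as [YB] is [F]-measurable, a second conditioning on [F] exchanges [A] for
    [YA]. *)
Lemma cond_indep_of_step : cond_indep P <<s step_rect >> G F.
Proof.
move=> A B rA GB YA YB YAB vA vB vAB.
have mA : measurable A by exact: rect_meas.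
have mB : measurable B by exact: Gm.
(* The given versions are arbitrary; replacing them by versions with values in [0, 1] makes products
   and integrals harmless. *)
have same E Y : measurable E -> cond_prob_version P F E Y -> exists Y0 : T -> R,
    [/\ forall w, (0 <= Y0 w <= 1)%R, cond_prob_version P F E Y0 & {ae P, forall w, Y w = Y0 w}].
  move=> mE vY; have [Y0 [Y001 vY0]] := version_exists P sF Fm mE.
  exists Y0; split => //; case: vY => [h1 [h2 h3]]; case: vY0 => [g1 [g2 g3]].
  by apply: (version_unique sF Fm) => // S FS; rewrite h3// g3.
have [YA0 [YA01 vA0 aeA]] := same A YA mA vA.
have [YB0 [YB01 vB0 aeB]] := same B YB mB vB.
suff aeAB : {ae P, forall w, YAB w = (YA0 w * YB0 w)%R}.
  by apply: filterS3 aeA aeB aeAB => w -> ->.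
have [FYA [_ intA]] := vA0; have [FYB [_ intB]] := vB0; have [FYAB [iAB intAB]] := vAB.
have F_real (f : T -> R) : (forall E, measurable E -> F (f @^-1` E)) ->
    measurable_fun [set: g_sigma_algebraType F] (f : g_sigma_algebraType F -> R).
  by move=> h; exact/(measurable_subP sF).
have mYA := sub_measurable_real Fm FYA; have mYB := sub_measurable_real Fm FYB.
apply: (version_unique sF Fm) => //.
- by apply/(measurable_subP sF); apply: measurable_funM; exact: F_real.
- apply: bounded_integrable; first exact: measurable_funM.
  move=> w; have /andP[a0 a1] := YA01 w; have /andP[b0 b1] := YB01 w.
  by rewrite mulr_ge0//= mulr_ile1.
move=> C FC; have mC : measurable C by exact: Fm.
rewrite intAB//.
have rAC : <<s step_rect >> (A `&` C).
  apply: (@measurableI _ (g_sigma_algebraType step_rect)) => //.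
  apply: sub_sigma_algebra; exists C, setT; split => //.
  by rewrite preimage_setT setIT.
rewrite setIAC (step_version GB YB01 vB0 rAC).
pose h w : \bar R := (\1_C w)%:E * (YB0 w)%:E.
have mh : measurable_fun [set: g_sigma_algebraType F] (h : g_sigma_algebraType F -> \bar R).
  apply: emeasurable_funM; apply/measurable_EFinP; last exact: F_real.
  by apply: measurable_indic; rewrite (measurable_subE sF).
transitivity (\int[P]_w (h w * (\1_A w)%:E)).
  rewrite integral_mkcond; apply: eq_integral => w _.
  rewrite patchE /h !indicE in_setI.
  by case: (w \in A); case: (w \in C); rewrite /= ?(mul1e, mul0e, mule0, mule1).
rewrite (@integral_sub_ext _ _ _ sF Fm _ _ \1_A YA0)//; last first.
- move=> w; rewrite /h mule_ge0// lee_fin//; by case/andP: (YB01 w).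
- by move=> S FS; rewrite intA// integral_indic//; exact: (Fm FS).
- by move=> w; case/andP: (YA01 w).
rewrite [RHS]integral_mkcond; apply: eq_integral => w _.
rewrite patchE /h !indicE.
by case: (w \in C); rewrite ?(mul1e, mul0e) // muleC -EFinM.
Qed.

End CondIndep.

Local Close Scope ereal_scope.

(** * Equality in law *)

Local Open Scope ereal_scope.

Section SameLaw.
Context (R : realType) (D : option nat) d d' (T : measurableType d)
  (T' : measurableType d') (P : probability T R) (P' : probability T' R)
  (X : int -> T -> state R D) (X' : int -> T' -> state R D).

(** One constraint, possibly [setT], at each time from [-N] to 0: the form of event whose
    probability [backward] computes. *)
Definition path_rect : set (set (int -> state R D)) :=
  [set E | exists N (B : nat -> set (state R D)), (forall t, measurable (B t)) /\
    E = [set w | forall t, (t <= N)%N -> B t (w (neg_time t))]].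

Lemma path_rectI : setI_closed path_rect.
Proof.
move=> _ _ [N [B [mB ->]]] [N' [B' [mB' ->]]].
exists (maxn N N'), (fun t => (if (t <= N)%N then B t else setT) `&`
  (if (t <= N')%N then B' t else setT)); split.
  by move=> t; apply: measurableI; case: ifP.
apply/seteqP; split => w /=.
  by move=> [h h'] t _; split; case: ifP => // tN; [exact: h|exact: h'].
move=> h; split => t tN.
  by have [|+ _] := h t; rewrite ?tN// (leq_trans tN)// leq_maxl.
by have [|_] := h t; rewrite ?tN// (leq_trans tN)// leq_maxr.
Qed.

Lemma path_sys_rect : path_sys R D = <<s path_rect >>.
Proof.
apply/seteqP; split; (apply: smallest_sub; first exact: smallest_sigma_algebra).
  move=> _ [m [B [m0 [mB ->]]]]; apply: sub_sigma_algebra.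
  exists `|m|%N, (fun t => if t == `|m|%N then B else setT); split.
    by move=> t; case: ifP.
  apply/seteqP; split => w /=.
    by move=> Bw t _; case: eqP => // ->; rewrite neg_timeK.
  by move=> /(_ _ (leqnn _)); rewrite eqxx neg_timeK.
move=> _ [N [B [mB ->]]].
rewrite (_ : [set w | _] = \bigcap_t (if (t <= N)%N then [set w | B t (w (neg_time t))] else setT)).
  apply: (@bigcapT_measurable _ (g_sigma_algebraType _)) => t.
  case: ifP => _; last exact: (@measurableT _ (g_sigma_algebraType _)).
  by apply: sub_sigma_algebra; exists (neg_time t), (B t); split => //; exact: neg_time_le0.
apply/seteqP; split => w /= h t; first by move=> _; case: ifP => //; exact: h.
by move=> tN; have := h t Logic.I; rewrite tN.
Qed.

Let path_meas d0 (T0 : measurableType d0) (Y : int -> T0 -> state R D) :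
  (forall n : int, (n <= 0)%R -> measurable_fun [set: T0] (Y n)) ->
  measurable_fun [set: T0] ((fun w n => Y n w) : T0 -> g_sigma_algebraType path_rect).
Proof.
move=> mY; apply: (@measurability _ _ T0 (g_sigma_algebraType path_rect) setT _ path_rect) => //.
move=> _ [_ [N [B [mB ->]]] <-]; rewrite setTI.
rewrite (_ : _ @^-1` _ = \bigcap_t (if (t <= N)%N then [set w | B t (Y (neg_time t) w)] else setT)).
  apply: bigcapT_measurable => t; case: ifP => _; last exact: measurableT.
  have := mY _ (neg_time_le0 t) measurableT _ (mB t); by rewrite setTI.
apply/seteqP; split => w /= h t; first by move=> _; case: ifP => //; exact: h.
by move=> tN; have := h t Logic.I; rewrite tN.
Qed.

Hypotheses (mX : forall n : int, (n <= 0)%R -> measurable_fun [set: T] (X n))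
  (mX' : forall n : int, (n <= 0)%R -> measurable_fun [set: T'] (X' n)).
Variables (G : nat -> set (set T)) (G' : nat -> set (set T'))
  (Q : nat -> R.-pker state R D ~> state R D).
Hypotheses (sG : forall t, sigma_algebra setT (G t))
  (Gm : forall t, G t `<=` measurable) (Gd : forall t, G t.+1 `<=` G t)
  (GX : forall t B, measurable B -> G t (X (neg_time t) @^-1` B))
  (XQ : forall t, markov_step P (G t.+1) (X (neg_time t.+1)) (X (neg_time t)) (Q t))
  (sG' : forall t, sigma_algebra setT (G' t))
  (Gm' : forall t, G' t `<=` measurable) (Gd' : forall t, G' t.+1 `<=` G' t)
  (GX' : forall t B, measurable B -> G' t (X' (neg_time t) @^-1` B))
  (XQ' : forall t, markov_step P' (G' t.+1) (X' (neg_time t.+1)) (X' (neg_time t)) (Q t))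
  (XX' : forall t B, measurable B ->
    P (X (neg_time t) @^-1` B) = P' (X' (neg_time t) @^-1` B)).

(** The probability of a rectangle is the integral of one function, [backward Q B N], against the
    law at time [-N]. The kernels and the one-time laws are common to both processes, although they
    are Markov for different filtrations. *)
Lemma same_law_of_steps : same_law P X P' X'.
Proof.
move=> E; rewrite path_sys_rect => sE.
have hX := path_meas mX; have hX' := path_meas mX'.
rewrite -[LHS]/(law P hX E) -[RHS]/(law P' hX' E).
apply: (@prob_eq _ (g_sigma_algebraType path_rect) R path_rect) sE => //.
- exact: path_rectI.
- exact: (etrans (@probability_setT _ _ _ (law P hX)) (esym (@probability_setT _ _ _ (law P' hX')))).
- by apply: (le_lt_trans (probability_le1 (law P hX) measurableT)); exact: ltry.
move=> _ [N [B [mB ->]]].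
have [mb b01] := backward_meas Q mB N.
have b0 x : 0 <= backward Q B N x by case/andP: (b01 x).
have GT t : G t setT by rewrite -(measurable_subE (sG t)); exact: measurableT.
have GT' t : G' t setT by rewrite -(measurable_subE (sG' t)); exact: measurableT.
have mXN := mX (neg_time_le0 N); have mXN' := mX' (neg_time_le0 N).
transitivity (\int[P]_w backward Q B N (X (neg_time N) w)).
  rewrite -(@backward_prob _ _ _ Q B mB _ T P (fun t => X (neg_time t)) G N sG Gm Gd
    (fun t C _ mC => @GX t C mC) (fun t _ => @XQ t) N setT (leqnn N) (GT N)).
  by rewrite setTI.
transitivity (\int[P']_w backward Q B N (X' (neg_time N) w)); last first.
  rewrite -(@backward_prob _ _ _ Q B mB _ T' P' (fun t => X' (neg_time t)) G' N sG' Gm' Gd'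
    (fun t C _ mC => @GX' t C mC) (fun t _ => @XQ' t) N setT (leqnn N) (GT' N)).
  by rewrite setTI.
transitivity (\int[law P mXN]_x backward Q B N x).
  by rewrite ge0_integral_law// preimage_setT.
transitivity (\int[law P' mXN']_x backward Q B N x); last first.
  by rewrite ge0_integral_law// preimage_setT.
by apply: eq_measure_integral => A mA _; exact: XX'.
Qed.

End SameLaw.

Local Close Scope ereal_scope.

(** * The driving noise *)

Local Open Scope ereal_scope.

Section Noise.
Context (R : realType).
Variable U : nat -> R -> R.
Hypotheses (mU : forall n, measurable_fun [set: R] (U n))
  (Ulaw : forall n B, measurable B -> unif R (U n @^-1` B) = unif R B)
  (Uind : forall (s : seq nat) (B : nat -> set R), uniq s -> (forall i, measurable (B i)) ->
    unif R (\big[setI/setT]_(i <- s) (U i @^-1` B i)) =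
    \prod_(i <- s) unif R (U i @^-1` B i)).

Definition noise (ij : nat * nat) : R -> R := U (pickle ij).

Let V (_ : nat * nat) : measurableType _ := R.

Definition noise_sig (J : set (nat * nat)) : set (set R) := sig_family (V := V) noise J.

Lemma noise_sig_sigma J : sigma_algebra setT (noise_sig J).
Proof. exact: smallest_sigma_algebra. Qed.

Lemma noise_sigS J J' : J `<=` J' -> noise_sig J `<=` noise_sig J'.
Proof.
by move=> JJ'; apply: sub_sigma_algebra2 => A [ij /JJ' Jij Aij]; exists ij.
Qed.

Lemma noise_sig_meas J : noise_sig J `<=` measurable.
Proof. by apply: (@sig_family_meas _ _ _ _ V noise predT) => // ij _; exact: mU. Qed.

Lemma noise_sig1 (J : set (nat * nat)) ij B : J ij -> measurable B ->
  noise_sig J (noise ij @^-1` B).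
Proof.
move=> Jij mB; apply: sub_sigma_algebra; exists ij => //.
by exists B => //; rewrite setTI.
Qed.

Lemma noise_indep J1 J2 : J1 `&` J2 = set0 -> forall A B,
  noise_sig J1 A -> noise_sig J2 B -> unif R (A `&` B) = unif R A * unif R B.
Proof.
move=> J12; apply: (@indep_blocks _ _ R (unif R) _ _ V noise predT) => //.
- by move=> ij _; exact: mU.
- move=> s B us _ mB.
  pose B' n : set R := if (unpickle n : option (nat * nat)) is Some ij then B ij else setT.
  have := @Uind (map pickle s) B'.
  rewrite !big_map (map_inj_uniq (pcan_inj pickleK)) => /(_ us).
  have -> : \big[setI/setT]_(j <- s) (U (pickle j) @^-1` B' (pickle j)) =
      \big[setI/setT]_(i <- s) (noise i @^-1` B i).
    by apply: eq_bigr => i _; rewrite /B' pickleK.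
  rewrite (eq_bigr (fun i => unif R (noise i @^-1` B i))).
    by apply => n; rewrite /B'; case: unpickle => // ij; exact: mB.
  by move=> i _; rewrite /B' pickleK.
- by move=> ij j1 j2; suff : (J1 `&` J2) ij by rewrite J12.
Qed.

Lemma noise_indep1 (J : set (nat * nat)) ij A B : ~ J ij -> noise_sig J A -> measurable B ->
  unif R (A `&` noise ij @^-1` B) = unif R A * unif R B.
Proof.
move=> nJ JA mB; rewrite (@noise_indep J [set ij])//.
- by rewrite [X in _ * X](@Ulaw (pickle ij) B mB).
- by apply/seteqP; split => // z /= [Jz zij]; apply: nJ; rewrite -zij.
- exact: noise_sig1.
Qed.

(** A whole row of the array is one variable with values in infinite sequences, since [product_type]
    asks for one variable per time. *)
Definition noise_seq (m : int) : R -> state R None := fun w k => noise (`|m|%N, k) w.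

Let noise_row (n : nat) : set (nat * nat) := [set ij | ij.1 = n].

Lemma noise_seq_sig (J : set (nat * nat)) m (B : set (state R None)) :
  noise_row `|m|%N `<=` J -> measurable B -> noise_sig J (noise_seq m @^-1` B).
Proof.
move=> mJ mB.
have [h0 hC hU] := noise_sig_sigma J.
move: B mB; apply: smallest_sub.
  split => /=; first by rewrite preimage_set0.
  - by move=> A sA; exact: hC.
  - by move=> F mF; rewrite preimage_bigcup; exact: hU.
move=> _ [k [B [mB ->]]].
by apply: (@noise_sig1 J (`|m|%N, k)) => //; exact: mJ.
Qed.

Lemma noise_row_sig (J : set int) ij B (F : set (set R)) :
  sigma_algebra setT F ->
  (forall m (C : set (state R None)), J m -> measurable C -> F (noise_seq m @^-1` C)) ->
  J (neg_time ij.1) -> measurable B -> F (noise ij @^-1` B).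
Proof.
move=> sF JF Jij mB.
have := JF (neg_time ij.1) [set y : state R None | B (y ij.2)] Jij.
have -> : noise_seq (neg_time ij.1) @^-1` [set y : state R None | B (y ij.2)] = noise ij @^-1` B.
  apply/seteqP; split => w; by rewrite /= /noise_seq /neg_time abszN /= -surjective_pairing.
by apply; have := @measurable_coord R None ij.2 measurableT B mB; rewrite setTI.
Qed.

Definition noise_filt (n : int) : set (set R) :=
  gen_filt (fun _ : int => state R None) noise_seq n.

Lemma noise_filtE (n : int) : (n <= 0)%R ->
  noise_filt n = noise_sig [set ij | (`|n|%N <= ij.1)%N].
Proof.
move=> n0; apply/seteqP; split; (apply: smallest_sub; first exact: smallest_sigma_algebra).
  move=> _ [m mn [B mB <-]]; rewrite setTI; apply: noise_seq_sig => // ij /= ->.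
  by move: mn n0 => /=; lia.
move=> _ [ij nij [B mB <-]]; rewrite setTI.
apply: (@noise_row_sig [set m : int | (m <= n)%R]) => //.
- exact: smallest_sigma_algebra.
- move=> m C mn mC; apply: sub_sigma_algebra; exists m => //.
  by exists C => //; rewrite setTI.
- by move: nij n0 => /=; rewrite /neg_time; lia.
Qed.

(** Induction on the list of times, splitting off one row that is disjoint from the others. *)
Lemma noise_product_type : product_type (unif R) noise_filt.
Proof.
exists _, (fun _ : int => state R None), noise_seq; split; [|split => //].
  move=> m _ _ B mB; rewrite setTI; apply: (@noise_sig_meas (noise_row `|m|%N)).
  exact: noise_seq_sig.
move=> s B us s0 mB; elim: s us s0 => [|m s IH].
  by move=> _ _; rewrite !big_nil probability_setT.
rewrite /= => /andP[ms us] /andP[m0 s0]; rewrite !big_cons.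
rewrite (@noise_indep (noise_row `|m|%N) [set ij | exists2 m', m' \in s & ij.1 = `|m'|%N]).
- by rewrite IH.
(* [noise_seq] depends on the time through its absolute value; distinct nonpositive times still have
   distinct rows. *)
- apply/seteqP; split => // ij [/= -> [m' m's mm']].
  move: ms; rewrite (_ : m = m') ?m's//.
  by have := allP s0 m' m's; move: mm' m0 => /=; lia.
- exact: noise_seq_sig.
have sJ := noise_sig_sigma [set ij | exists2 m', m' \in s & ij.1 = `|m'|%N].
rewrite big_seq_cond; apply: big_ind => [||i /andP[si _]].
- exact: (@measurableT _ (g_sigma_algebraType _)).
- move=> A A'; rewrite -(measurable_subE sJ).
  exact: (@measurableI _ (g_sigma_algebraType _)).
- by apply: noise_seq_sig => // ij /= ->; exists i.
Qed.

End Noise.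

Local Close Scope ereal_scope.

(** * The equivalence *)

Local Open Scope ereal_scope.

Section Standard.
Context (R : realType) (D : option nat) d (T : measurableType d)
  (P : probability T R) (X : int -> T -> state R D).
Hypotheses (mX : forall n : int, (n <= 0)%R -> measurable_fun [set: T] (X n))
  (hmarkov : markov_process P X) (hmono : monotonic_markov P X)
  (tail_law : forall n : int, (n <= 0)%R ->
    forall B : set (state R D), measurable B -> forall Y : T -> R,
    cond_prob_version P (tail_sig (nat_filt X)) (X n @^-1` B) Y ->
    {ae P, forall w, Y w = fine (P (X n @^-1` B))}).

Let mXt t : measurable_fun [set: T] (X (neg_time t)).
Proof. by apply: mX; exact: neg_time_le0. Qed.

Let mu t : probability (state R D) R := law P (mXt t).

Lemma ae_not_null (nu : {measure set (state R D * state R D) -> \bar R})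
    (L : set (state R D * state R D)) : measurable L ->
  {ae nu, forall y, L y} -> nu (~` L) = 0.
Proof.
move=> mL [A [mA A0 LA]]; apply/eqP; rewrite -measure_le0 -A0.
by apply: le_measure; rewrite ?inE//; exact: measurableC.
Qed.

Lemma tail_law_standard : standard_filt P X.
Proof.
have /choice[QC hQC] : forall t, exists QC : (R.-pker state R D ~> state R D) *
    (R.-pker (state R D * state R D)%type ~> (state R D * state R D)%type),
    transition_version P X (neg_time t.+1) QC.1 /\
    forall x x' : state R D, law_support P (X (neg_time t.+1)) x ->
      law_support P (X (neg_time t.+1)) x' ->
      (forall B : set (state R D), measurable B ->
         QC.2 (x, x') (B `*` setT) = QC.1 x B /\ QC.2 (x, x') (setT `*` B) = QC.1 x' B) /\
      (forall k : coord D, (x k <= x' k)%R ->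
         {ae QC.2 (x, x'), forall y : state R D * state R D, (y.1 k <= y.2 k)%R}) /\
      (forall k : coord D, (x' k <= x k)%R ->
         {ae QC.2 (x, x'), forall y : state R D * state R D, (y.2 k <= y.1 k)%R}).
  by move=> t; have [Q [C h]] := hmono (neg_timeS_lt0 t); exists (Q, C).
pose Q t := (QC t).1; pose C t := (QC t).2.
have XQ t : markov_step P (nat_filt X (neg_time t.+1)) (X (neg_time t.+1)) (X (neg_time t)) (Q t).
  have [tv _] := hQC t; have t0 := neg_timeS_lt0 t.
  have := markov_step_of_cond_indep mX t0 (hmarkov t0) tv.
  by rewrite neg_timeS.
have /choice[N hN] : forall t, exists N : set (state R D), [/\ measurable N,
    P (X (neg_time t) @^-1` N) = 0 &
    forall x, ~ N x -> law_support P (X (neg_time t)) x].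
  by move=> t; exact: support_full (mXt t).
have muQ t B : measurable B -> mu t B = \int[mu t.+1]_x Q t x B.
  move=> mB; rewrite ge0_integral_law// ?preimage_setT//; last exact: measurable_kernel.
  rewrite -(XQ t)// ?setTI//.
  have := nat_filt_sigma X (neg_time t.+1) => sF.
  by rewrite -(measurable_subE sF); exact: measurableT.
have mN t : measurable (N t) by have [] := hN t.
have muN t : mu t (N t) = 0 by have [] := hN t.
have CQ t x x' B : ~ N t.+1 x -> ~ N t.+1 x' -> measurable B ->
    C t (x, x') (B `*` setT) = Q t x B /\ C t (x, x') (setT `*` B) = Q t x' B.
  have [_ _ sup] := hN t.+1; move=> /sup sx /sup sx' mB.
  by have [_ h] := hQC t; have [h1 _] := h _ _ sx sx'; exact: h1.
have CO t x x' (k : coord D) : ~ N t.+1 x -> ~ N t.+1 x' ->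
    ((x k <= x' k)%R -> C t (x, x') [set y | (y.2 k < y.1 k)%R] = 0) /\
    ((x' k <= x k)%R -> C t (x, x') [set y | (y.1 k < y.2 k)%R] = 0).
  have [_ _ sup] := hN t.+1; move=> /sup sx /sup sx'.
  have [_ h] := hQC t; have [_ [h2 h3]] := h _ _ sx sx'.
  have mk1 : measurable_fun [set: state R D * state R D] (fun y => y.1 k).
    exact: measurableT_comp (measurable_coord k) measurable_fst.
  have mk2 : measurable_fun [set: state R D * state R D] (fun y => y.2 k).
    exact: measurableT_comp (measurable_coord k) measurable_snd.
  split=> xx'.
    rewrite (_ : [set y | _] = ~` [set y | (y.1 k <= y.2 k)%R]).
      apply: ae_not_null (h2 k xx').
      by rewrite -[X in measurable X]setTI; exact: measurable_fun_ler.
    by apply/seteqP; split => y /=; rewrite ltNge => /negP.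
  rewrite (_ : [set y | _] = ~` [set y | (y.2 k <= y.1 k)%R]).
    apply: ae_not_null (h3 k xx').
    by rewrite -[X in measurable X]setTI; exact: measurable_fun_ler.
  by apply/seteqP; split => y /=; rewrite ltNge => /negP.
have hit_cvg s (B : set (state R D)) (e : R) : measurable B -> (0 < e)%R ->
    exists r0, forall r, (r0 <= r)%N ->
    \int[mu r]_x `|fine (hit_prob Q s B r x) - fine (mu s B)|%:E <= e%:E.
  move=> mB e0; have [r0 h] := hit_prob_cvg mX XQ tail_law s mB e0.
  exists r0 => r rr; have hr := h r rr.
  have mf : measurable_fun [set: state R D] (fun x => fine (hit_prob Q s B r x)).
    by apply: measurableT_comp => //; exact: hit_prob_meas.
  rewrite ge0_integral_law//; apply/measurable_EFinP.
  by apply: measurableT_comp => //; exact: measurable_funB.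
have [U [mU [Ulaw Uind]]] := unif_iid R.
pose G t := noise_sig U [set ij | (t <= ij.1)%N].
(* The bound on the second index is strict: [noise U (t, K)] is left out of [H t K], hence
   independent of it, and enters [H t K.+1]. *)
pose H t K := noise_sig U [set ij | (t < ij.1)%N \/ ij.1 = t /\ (ij.2 < K)%N].
have sG t : sigma_algebra setT (G t) by exact: noise_sig_sigma.
have Gm t : G t `<=` measurable by exact: noise_sig_meas.
have [|||||X' [GX' X'mu X'Q]] := @process_exists R D _ R (unif R) H G
    (fun t K => noise U (t, K)) (fun t K => noise_sig_sigma _ _) sG _ _ _ Gm _ _
    mu Q C N muQ mN muN CQ CO hit_cvg.
- by move=> t K; apply: noise_sigS => ij /= [?|[? ?]]; [left|right; split => //; exact: ltnW].
- by move=> t K; apply: noise_sigS => ij /= [?|[-> _]] //; exact: ltnW.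
- by move=> t K; apply: noise_sigS => ij /= ?; left.
- by move=> t K B mB; apply: noise_sig1 => //=; right.
- move=> t K A B HA mB; apply: (noise_indep1 mU Ulaw Uind _ HA mB) => /=.
  by rewrite !ltnn => -[|[]].
pose Y (n : int) := X' `|n|%N.
have YE t : Y (neg_time t) = X' t by rewrite /Y /neg_time abszN.
have GY (n : int) B : (n <= 0)%R -> measurable B -> noise_filt U n (Y n @^-1` B).
  by move=> n0 mB; rewrite noise_filtE//; exact: GX'.
have mY (n : int) : (n <= 0)%R -> measurable_fun [set: R] (Y n).
  move=> n0 _ B mB; rewrite setTI; have := GY n B n0 mB; rewrite noise_filtE//.
  exact: noise_sig_meas.
exists _, R, (unif R), Y; split => //; split.
  apply: (@same_law_of_steps R D _ _ T R P (unif R) X Y mX mY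
    (fun t => nat_filt X (neg_time t)) G Q) => //.
  - by move=> t; exact: nat_filt_sigma.
  - by move=> t; apply: nat_filt_meas => //; exact: neg_time_le0.
  - by move=> t; apply: nat_filt_le; exact: neg_time_le.
  - by move=> t B mB; exact: nat_filt_coord.
  - by move=> t; apply: noise_sigS => ij /= h; exact: ltnW.
  - by move=> t B mB; rewrite YE; exact: GX'.
  - by move=> t; rewrite !YE.
  - by move=> t B mB; rewrite YE X'mu.
exists (noise_filt U); split; first exact: noise_product_type.
have FG (n : int) : (n <= 0)%R -> nat_filt Y n `<=` noise_filt U n.
  move=> n0; apply: smallest_sub; first exact: smallest_sigma_algebra.
  move=> _ [m mn [B mB <-]]; rewrite setTI.
  have m0 : (m <= 0)%R by exact: le_trans n0.
  have := GY m B m0 mB; rewrite !noise_filtE//.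
  apply: noise_sigS => ij /=; apply: leq_trans.
  by move: mn n0 => /=; lia.
split => // n n0.
have [t nt] : exists t, n = neg_time t.+1.
  by exists `|n|.-1; rewrite /neg_time; lia.
have sF := nat_filt_sigma Y n.
have n0' := ltW n0.
(* The natural filtration grows by exactly one variable, which is the shape required by
   [cond_indep_of_step]. *)
have -> : nat_filt Y (n + 1)%R = <<s step_rect (nat_filt Y n) (Y (n + 1)%R) >>.
  have n1 : (n + 1 <= 0)%R by rewrite nt neg_timeS neg_time_le0.
  apply/seteqP; split; (apply: smallest_sub; first exact: smallest_sigma_algebra).
    move=> _ [m mn [B mB <-]]; rewrite setTI; apply: sub_sigma_algebra.
    have [mn'|nm] := leP m n.
      exists (Y m @^-1` B), setT; split => //; first exact: nat_filt_coord.
      by rewrite preimage_setT setIT.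
    exists setT, B; split => //.
      by rewrite -(measurable_subE sF); exact: measurableT.
    rewrite setTI (_ : m = n + 1)%R//.
    by move: mn nm => /=; lia.
  have sF1 := nat_filt_sigma Y (n + 1)%R.
  move=> _ [A [B [FA mB ->]]]; rewrite -(measurable_subE sF1).
  apply: (@measurableI _ (g_sigma_algebraType _)); rewrite (measurable_subE sF1).
    by apply: nat_filt_le FA; rewrite lerDl.
  exact: nat_filt_coord.
have GE : noise_filt U n = G t.+1 by rewrite noise_filtE// nt /neg_time abszN.
(* The step holds with respect to the whole noise up to time [n], not only to the past of [Y]; this
   is what immersion expresses. *)
apply: (@cond_indep_of_step _ _ _ R _ _ R (unif R) _ _ (Y n) (Y (n + 1)%R) (Q t)) => //.
- by rewrite GE.
- exact: FG.
- by rewrite GE.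
- by move=> B mB; exact: nat_filt_coord.
- by apply: mY; rewrite nt neg_timeS neg_time_le0.
- by rewrite GE nt neg_timeS !YE.
Qed.

End Standard.

Local Close Scope ereal_scope.

Theorem theorem4p5 (R : realType) (D : option nat)
  (hD : forall k : nat, D = Some k -> (0 < k)%N)
  (dT : measure_display) (T : measurableType dT) (P : probability T R)
  (X : int -> T -> state R D)
  (hX : forall n : int, n <= 0 -> measurable_fun setT (X n))
  (hmarkov : markov_process P X) (hmono : monotonic_markov P X) :
  [<-> Kolmogorovian P (nat_filt X);
       (forall n : int, n <= 0 -> forall B : set (state R D), measurable B ->
          forall Y : T -> R,
            cond_prob_version P (tail_sig (nat_filt X)) (X n @^-1` B) Y ->
            {ae P, forall w, Y w = fine (P (X n @^-1` B))});
       standard_filt P X].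
Proof.
tfae.
- by move=> K n n0 B mB Y; exact: Kolmogorovian_cond_law.
- exact: tail_law_standard.
- exact: standard_Kolmogorovian.
Qed.
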